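(* (i) The map $j^{aro}\colon\mathcal{AM}\to\mathcal{AF}$ is an embedding of Hopf algebroids $(\mathcal{AM},\odot,\Delta^{aro}_{LOT})\hookrightarrow(\mathcal{AF},\cdot,\Delta^{aro}_{BCK})$: it is an injective unital algebra morphism and $(j^{aro}\otimes j^{aro})\circ\Delta^{aro}_{LOT}=\Delta^{aro}_{BCK}\circ j^{aro}$ on $\mathcal{AM}$. (ii) The map $j^{cl}\colon\mathcal{CM}\to\mathcal{CF}$ is an embedding of Hopf algebras $(\mathcal{CM},\diamond,\Delta^{cl}_{LOT})\hookrightarrow(\mathcal{CF},\cdot,\Delta^{cl}_{BCK})$: it is an injective unital algebra morphism and $(j^{cl}\otimes j^{cl})\circ\Delta^{cl}_{LOT}=\Delta^{cl}_{BCK}\circ j^{cl}$. (iii) $\psi^*\circ j^{aro}=j^{cl}\circ\varphi^*$ as maps $\mathcal{AM}\to\mathcal{CF}$.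
   Context: Fix a field $\mathbb K$ of characteristic zero and a finite set $C$ of decorations. $S(V)$ denotes the symmetric algebra with unit $\mathbf 1$. Multi-indices. $\overline N(C)$ is the polynomial algebra in variables $x^a_j$ ($a\in C$, $j\ge-1$); a monomial $x^{\mathbf k}=\prod(x^a_j)^{k^a_j}$ has weight $\mathrm{wt}=\sum jk^a_j$ and $\mathbf k!=\prod_{j,a}k^a_j!$. The transpose derivation is $\overline\partial x^{\mathbf k}=\sum_{j\ge0,a\in C}k^a_jx^{\mathbf k-\mathbf e^a_j+\mathbf e^a_{j-1}}$ ($\mathbf e^a_j$ the unit multi-index). $M_n$ ($n=-1,0$) is the span of monomials of weight $n$ (non-constant for $n=0$). Let $\mathcal AM_{-1}=S(M_0)\otimes M_{-1}$, $\mathcal{AM}=S(M_0)\otimes S(M_{-1})$ (commutative product $\odot$), $\mathcal{CM}=S(\mathcal AM_{-1})$ (product $\diamond$). Symmetry factor on $\mathcal{AM}$: for pairwise distinct $\kappa^j$ (weight 0) and $\mathbf k^i$ (weight $-1$), $\sigma((x^{\kappa^1})^{\odot q_1}\odot\cdots\odot(x^{\kappa^m})^{\odot q_m}\odot(x^{\mathbf k^1})^{\odot p_1}\odot\cdots\odot(x^{\mathbf k^n})^{\odot p_n})=\prod_j q_j!(\kappa^j!)^{q_j}\prod_i p_i!(\mathbf k^i!)^{p_i}$; on $\mathcal{CM}$, for pairwise distinct basis elements $Y^i$ of $\mathcal AM_{-1}$, $\sigma((Y^1)^{\diamond p_1}\diamond\cdots\diamond(Y^n)^{\diamond p_n})=\prod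 p_i!\sigma(Y^i)^{p_i}$. Pairings: $\langle\mathbb M,\mathbb M'\rangle=\sigma(\mathbb M)\mathbf 1_{\mathbb M=\mathbb M'}$ on basis elements. $\varphi\colon\mathcal{CM}\to\mathcal{AM}$, $(\mathbf y^1\odot x^{\mathbf k^1})\diamond\cdots\diamond(\mathbf y^n\odot x^{\mathbf k^n})\mapsto\mathbf y^1\odot\cdots\odot\mathbf y^n\odot x^{\mathbf k^1}\odot\cdots\odot x^{\mathbf k^n}$, and $\varphi^*$ is its adjoint for the pairings. LOT coproducts. For $x^\kappa\in M_0$ (resp. $x^{\mathbf k}\in M_{-1}$): $\Delta^{aro}_{LOT}(x^\kappa)=x^\kappa\otimes\mathbf 1+\sum_{t\ge0}\sum\frac{\kappa!}{\sigma(x^{\kappa^1}\odot\cdots\odot x^{\kappa^t})\,\overline\kappa!}\,x^{\kappa^1}\odot\cdots\odot x^{\kappa^t}\otimes\overline\partial^{\,t}x^{\overline\kappa}$, the inner sum running over all unordered families $\{\kappa^1,\dots,\kappa^t\}$ and $\overline\kappa$ with $\kappa=\kappa^1+\cdots+\kappa^t+\overline\kappa$ and $\mathrm{wt}(x^{\kappa^i})=-1$ (same formula with $\mathbf k$ in place of $\kappa$ for $M_{-1}$). Then $\Delta^{aro}_{LOT}$ is extended to a unital algebra morphism $\mathcal{AM}\to\mathcal{AM}\otimes\mathcal{AM}$ for $\odot$, and to $\mathcal{CM}\to\mathcal{AM}\otimes\mathcal{CM}$ by $\Delta(Y^1\diamond\cdots\diamond Y^n)=\Delta(Y^1)\cdots\Delta(Y^n)$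 (product $\odot\otimes\diamond$). Set $\Delta^{cl}_{LOT}=(\varphi^*\otimes\mathrm{id})\circ\Delta^{aro}_{LOT}$ on $\mathcal{CM}$. Trees. An aromatic tree is a finite directed graph, vertices decorated by $C$, each vertex having exactly one outgoing edge except the root (none), up to isomorphism; the root's component is a tree, the others are aromas (each has a unique cycle). $T$, $A_0$ are the spans of trees and aromas, $\mathcal A=S(A_0)$, $\mathcal AT=\mathcal A\otimes T$, aromatic forests $\mathcal{AF}=S(A_0)\otimes S(T)$, clumped forests $\mathcal{CF}=S(\mathcal AT)$ (products by juxtaposition; in $\mathcal{CF}$ each aromatic tree is one factor). The fertility $f(v)$ is the number of edges ending at $v$. $\sigma$ on $\mathcal{AF}$ is the number of decoration-preserving automorphisms; on $\mathcal{CF}$, $\sigma((\pi^1)^{r_1}\cdots(\pi^n)^{r_n})=\prod r_i!\sigma(\pi^i)^{r_i}$ for distinct aromatic trees $\pi^i$. Pairing $\langle\pi,\pi'\rangle=\sigma(\pi)\mathbf 1_{\pi=\pi'}$. $\psi\colon\mathcal{CF}\to\mathcal{AF}$ forgets the clumping, $(\mathbf a^1\tau^1)\cdots(\mathbf a^m\tau^m)\mapsto\mathbf a^1\cdots\mathbf a^m\tau^1\cdots\tau^m$; $\psi^*$ is its adjoint. An admissible cut of a tree is a set of edges such that each path from a vertex to the root contains at most one of them; of an aroma, a set of non-cycle edges such that each directed path contains at most one of them. Removing the cut edges, $R^c(x)$ is the component containing the root (resp. cycle) and $P^c(x)$ the product of the other components (trees). $\Delta^{aro}_{BCK}x=x\otimes\mathbf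 1+\sum_{c}P^c(x)\otimes R^c(x)$ (sum over all admissible cuts, including the empty one) for $x$ a tree or aroma, extended as an algebra morphism on $\mathcal{AF}$. $\Delta^{cl}_{BCK}(\mathbf a\tau)=(\psi^*\otimes\mathrm{id})\Delta^{aro}_{BCK}(\mathbf a\tau)$ for aromatic trees, extended multiplicatively to $\mathcal{CF}$. Embeddings. Fertility map: $\Phi(t)=\prod_v x^{d(v)}_{f(v)-1}$ for trees, similarly for aromas. $j^{aro}(x^\kappa)=\sum_{a\text{ aroma},\Phi(a)=x^\kappa}\frac{\kappa!}{\sigma(a)}a$, $j^{aro}(x^{\mathbf k})=\sum_{t\text{ tree},\Phi(t)=x^{\mathbf k}}\frac{\mathbf k!}{\sigma(t)}t$ (equivalently $j^{aro}$ is adjoint to $\Phi$), extended multiplicatively to $\mathcal{AM}$; $j^{cl}((\mathbf y^1\odot x^{\mathbf k^1})\diamond\cdots\diamond(\mathbf y^n\odot x^{\mathbf k^n}))=j^{aro}(\mathbf y^1\odot x^{\mathbf k^1})\cdots j^{aro}(\mathbf y^n\odot x^{\mathbf k^n})$ in $\mathcal{CF}$.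
   Formalization: Δ^cl_LOT is (φ*⊗id)∘Δ^aro_LOT on each single clump Y, then extended multiplicatively to CM (literally on all of CM, (ii) fails); in both Δ^cl_LOT and Δ^cl_BCK, right factors with weight-0 factors/aromas but no weight −1 factor/tree, not in CM/CF, are sent to 0. *)

(* Defs.v *)
From HB Require Import structures.
From mathcomp Require Import all_boot all_order all_algebra all_fingroup.
From mathcomp Require Import finmap monalg.

Set Implicit Arguments.
Unset Strict Implicit.
Unset Printing Implicit Defensive.

Import GRing.Theory.
Local Open Scope ring_scope.

(* Product of two monoids of monomials: basis of a tensor product of two   *)
(* monomial algebras; the corresponding malg is the tensor product algebra *)
Definition mprod (M1 M2 : monomType) := (M1 * M2)%type.
HB.instance Definition _ (M1 M2 : monomType) := Choice.on (mprod M1 M2).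

Section MProd.
Variables M1 M2 : monomType.
Definition mprod_one : mprod M1 M2 := (mone, mone).
Definition mprod_mul (x y : mprod M1 M2) : mprod M1 M2 :=
  (mmul x.1 y.1, mmul x.2 y.2).
Lemma mprod_mulA : associative mprod_mul.
Proof. by move=> x y z; rewrite /mprod_mul !mulmA. Qed.
Lemma mprod_mul1 : left_id mprod_one mprod_mul.
Proof. by case=> x1 x2; rewrite /mprod_mul /= !mul1m. Qed.
Lemma mprod_mulr1 : right_id mprod_one mprod_mul.
Proof. by case=> x1 x2; rewrite /mprod_mul /= !mulm1. Qed.
Lemma mprod_unit (x y : mprod M1 M2) :
  mprod_mul x y = mprod_one -> x = mprod_one /\ y = mprod_one.
Proof.
case: x y => [x1 x2] [y1 y2]; rewrite /mprod_mul /mprod_one /= => -[].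
by move=> /unitm[-> ->] /unitm[-> ->].
Qed.
HB.instance Definition _ := Choice_isMonomialDef.Build (mprod M1 M2)
  mprod_mulA mprod_mul1 mprod_mulr1 mprod_unit.
End MProd.

Section FreeModules.
Variable K : fieldType.

Definition linext (B : choiceType) (V : lmodType K) (f : B -> V)
  (x : {malg K[B]}) : V := \sum_(b <- msupp x) x@_b *: f b.

Definition algext (V : choiceType) (A : lalgType K) (f : V -> A)
  (x : {malg K[{cmonom V}]}) : A :=
  linext (fun m : {cmonom V} => \prod_(v <- finsupp m) f v ^+ m v) x.

Definition tens (M1 M2 : monomType) (x : {malg K[M1]}) (y : {malg K[M2]})
  : {malg K[mprod M1 M2]} :=
  \sum_(a <- msupp x) \sum_(b <- msupp y) (x@_a * y@_b) *: << (a, b) : mprod M1 M2 >>.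

Definition tmap (M1 M2 N1 N2 : monomType) (f : M1 -> {malg K[N1]})
  (g : M2 -> {malg K[N2]}) : {malg K[mprod M1 M2]} -> {malg K[mprod N1 N2]} :=
  linext (fun ab : mprod M1 M2 => tens (f ab.1) (g ab.2)).

End FreeModules.

Definition mfact (I : choiceType) (m : {cmonom I}) : nat :=
  (\prod_(i <- finsupp m) (m i)`!)%N.

Section MultiIndices.
Variable K : fieldType.
Variable C : finType.

(* The variable x^a_j (a in C, j >= -1) is encoded as (a, j+1). *)
Definition Var := (C * nat)%type.
Definition Mon := {cmonom Var}.

Definition wt (m : Mon) : int :=
  \sum_(i <- finsupp m) ((i.2)%:Z - 1) * (m i)%:Z.

(* basis of M_0 (+) M_{-1}: monomials of weight 0 (non-constant) or -1 *)
Definition isMgen (m : Mon) := (wt m == -1) || ((wt m == 0) && (m != (onecm _))).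
Definition MonG := {m : Mon | isMgen m}.
Definition is_wm1 (v : MonG) := wt (val v) == -1.

(* AM = S(M_0) (x) S(M_{-1}) = S(M_0 (+) M_{-1}); basis: monomials in MonG *)
Definition AMb := {cmonom MonG}.
Definition AM := {malg K[AMb]}.
Definition ntrM (b : AMb) : nat := (\sum_(v <- finsupp b | is_wm1 v) b v)%N.
(* basis of AM_{-1} = S(M_0) (x) M_{-1} *)
Definition AM1b := {b : AMb | ntrM b == 1%N}.
Definition CMb := {cmonom AM1b}.
Definition CM := {malg K[CMb]}.

Definition sigmaAM (b : AMb) : nat :=
  (\prod_(v <- finsupp b) ((b v)`! * (mfact (val v)) ^ (b v)))%N.
Definition sigmaCM (c : CMb) : nat :=
  (\prod_(y <- finsupp c) ((c y)`! * (sigmaAM (val y)) ^ (c y)))%N.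
(* symmetry factor of an element of S(M_{-1}) given as a multiset of      *)
(* monomials                                                              *)
Definition sigmaS (F : {cmonom Mon}) : nat :=
  (\prod_(k <- finsupp F) ((F k)`! * (mfact k) ^ (F k)))%N.

Definition phiM (c : CMb) : AMb :=
  \big[mmul/mone]_(y <- finsupp c) expcmn (val y) (c y).

Definition factors (I : choiceType) (m : {cmonom I}) : seq I :=
  flatten [seq nseq (m i) i | i <- finsupp m].

(* candidate clumpings of b: assign each M_0 factor to an M_{-1} factor *)
Definition clumpingsM (b : AMb) : seq CMb :=
  let ks := filter (fun v => ~~ is_wm1 v) (factors b) in
  let ts := filter is_wm1 (factors b) in
  undup [seq \big[mmul/mone]_(Y <- pmap insub
              [seq mulcm (ucm (tnth (in_tuple ts) i))
                   (\big[mmul/mone]_(k < size ks | f k == i)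
                       ucm (tnth (in_tuple ks) k)) | i <- enum 'I_(size ts)])
            ucm Y
        | f : {ffun 'I_(size ks) -> 'I_(size ts)} <- enum {: {ffun 'I_(size ks) -> 'I_(size ts)}}].

(* phi^* : AM -> CM, adjoint of phi for the pairings <.,.> given by sigma *)
Definition phistar_b (b : AMb) : CM :=
  \sum_(c <- clumpingsM b | phiM c == b)
     ((sigmaAM b)%:R / (sigmaCM c)%:R) *: << c >>.
Definition phistar : AM -> CM := linext phistar_b.

Definition dbar_m (m : Mon) : {malg K[Mon]} :=
  \sum_(i <- finsupp m | (0 < i.2)%N)
     (m i)%:R *: << mulcm (divcm m (ucm i)) (ucm (i.1, i.2.-1)) >>.
Definition dbar : {malg K[Mon]} -> {malg K[Mon]} := linext dbar_m.

Definition divisors (m : Mon) : seq Mon :=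
  foldr (fun i acc => [seq mulcm (expcmn (ucm i) e) d
                         | e <- iota 0 (m i).+1, d <- acc]) [:: (onecm _)]
        (finsupp m).

(* all pairs (F, kbar) with F = {k^1,...,k^t} an unordered family of      *)
(* weight -1 monomials (a multiset) and k = k^1 + ... + k^t + kbar        *)
Fixpoint fams (fuel : nat) (m : Mon) : seq ({cmonom Mon} * Mon) :=
  match fuel with
  | 0 => [:: ((onecm _), m)]
  | fuel'.+1 =>
      ((onecm _), m) ::
      flatten [seq [seq (mulcm (ucm d) F.1, F.2) | F <- fams fuel' (divcm m d)]
              | d <- divisors m & wt d == -1]
  end.
Definition decomps (m : Mon) := undup (fams (mdeg m) m).

Definition varAM (m : Mon) : AM :=
  if insub m is Some v then << ucm v >> else 0.
Definition polyAM : {malg K[Mon]} -> AM := linext varAM.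
Definition famAM (F : {cmonom Mon}) : AM :=
  \prod_(k <- finsupp F) varAM k ^+ F k.

Definition DeltaLOT_gen (v : MonG) : {malg K[mprod AMb AMb]} :=
  tens << ucm v >> 1 +
  \sum_(Fr <- decomps (val v))
     ((mfact (val v))%:R / ((sigmaS Fr.1)%:R * (mfact Fr.2)%:R)) *:
       tens (famAM Fr.1) (polyAM (iter (mdeg Fr.1) dbar << Fr.2 >>)).
Definition DeltaLOTaro : AM -> {malg K[mprod AMb AMb]} := algext DeltaLOT_gen.

(* reading a right-hand factor of AM as an element of CM: an element with *)
(* exactly one M_{-1} factor is one clump, the unit is the unit, the      *)
(* remaining ones (no M_{-1} factor, at least one M_0 factor) give 0      *)
Definition iotaM (b : AMb) : CM :=
  if b == (onecm _) then 1 else if insub b is Some y then << ucm y >> else 0.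

(* Delta^cl_LOT : CM -> CM (x) CM: on a clump Y in AM_{-1} it is          *)
(* (phi^* (x) id) o Delta^aro_LOT (right factors read in CM through iotaM), *)
(* and it is extended multiplicatively (for the product diamond) to CM,    *)
(* exactly as Delta^cl_BCK is extended from aromatic trees to CF.          *)
Definition DeltaLOTcl : CM -> {malg K[mprod CMb CMb]} :=
  algext (fun y : AM1b =>
            tmap (fun a : AMb => phistar << a >>) iotaM (DeltaLOTaro << val y >>)).

End MultiIndices.

Section Graphs.
Variable C : finType.

(* a decorated directed graph on 'I_n in which each vertex has at most     *)
(* one outgoing edge: out v = Some w means an edge v -> w                  *)
Definition gdata (n : nat) : finType :=
  ({ffun 'I_n -> option 'I_n} * {ffun 'I_n -> C})%type.
Definition graph := {n : nat & gdata n}.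

Definition gout n (d : gdata n) := d.1.
Definition gdec n (d : gdata n) := d.2.

Definition relabel n (d : gdata n) (p : {perm 'I_n}) : gdata n :=
  ([ffun v => omap p (gout d ((p^-1)%g v))], [ffun v => gdec d ((p^-1)%g v)]).

Definition canon n (d : gdata n) : gdata n :=
  relabel d [arg min_(p < (1%g : {perm 'I_n})) choice.pickle (relabel d p)].
Definition is_canonical n (d : gdata n) :=
  [forall p : {perm 'I_n}, (choice.pickle d <= choice.pickle (relabel d p))%N].

Definition naut n (d : gdata n) : nat :=
  #|[set p : {perm 'I_n} | relabel d p == d]|.

Definition adj n (d : gdata n) : rel 'I_n :=
  fun u w => (gout d u == Some w) || (gout d w == Some u).
Definition gconnected n (d : gdata n) :=
  (0 < n)%N && [forall u, forall w, connect (adj d) u w].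
Definition has_root n (d : gdata n) := [exists v, gout d v == None].

(* isomorphism classes of connected graphs: these are exactly the trees   *)
(* (one root) and the aromas (no root, hence a unique cycle)              *)
Definition is_conn_cls (g : graph) :=
  gconnected (tagged g) && is_canonical (tagged g).
Definition ConnCls := {g : graph | is_conn_cls g}.
Definition clsOf n (d : gdata n) : option ConnCls :=
  insub (Tagged gdata (canon d)).
Definition isTree (x : ConnCls) := has_root (tagged (val x)).

Definition fert n (d : gdata n) (v : 'I_n) := #|[set u | gout d u == Some v]|.
Definition Phig n (d : gdata n) : Mon C :=
  \big[mmul/mone]_(v : 'I_n) ucm ((gdec d v, fert d v) : Var C).
Definition PhiC (x : ConnCls) := Phig (tagged (val x)).
Definition sigmaC (x : ConnCls) := naut (tagged (val x)).

Definition subg n (d : gdata n) (S : {set 'I_n}) : graph :=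
  let s := enum S in
  Tagged gdata
    (([ffun i : 'I_(size s) =>
         obind (fun w => (insub (index w s) : option 'I_(size s)))
               (gout d (tnth (in_tuple s) i))],
      [ffun i : 'I_(size s) => gdec d (tnth (in_tuple s) i)]) : gdata (size s)).

Definition comps n (d : gdata n) : seq {set 'I_n} :=
  enum [set [set w | connect (adj d) v w] | v : 'I_n].

Definition gunion (g h : graph) : graph :=
  let n := tag g in let m := tag h in
  Tagged gdata
   (([ffun v : 'I_(n + m) => match split v with
        | inl a => omap (@lshift n m) (gout (tagged g) a)
        | inr b => omap (@rshift n m) (gout (tagged h) b) end],
     [ffun v : 'I_(n + m) => match split v with
        | inl a => gdec (tagged g) a
        | inr b => gdec (tagged h) b end]) : gdata (n + m)).
Definition gempty : graph :=
  Tagged gdata ((ffun0 (card_ord 0), ffun0 (card_ord 0)) : gdata 0).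

(* admissible cuts; an edge is identified with its source vertex          *)
Definition fwd n (d : gdata n) (k : nat) (v : 'I_n) : option 'I_n :=
  iter k (obind (gout d)) (Some v).
Definition oncycle n (d : gdata n) (v : 'I_n) :=
  [exists k : 'I_n, fwd d k.+1 v == Some v].
(* c is a set of edges (of the tree, resp. non-cycle edges of the aroma)  *)
(* and each directed path contains at most one edge of c                   *)
Definition admissible n (d : gdata n) (c : {set 'I_n}) :=
  [forall v in c, (gout d v != None) && ~~ oncycle d v] &&
  [forall v, (#|[set k : 'I_n | if fwd d k v is Some u then u \in c else false]|
               <= 1)%N].
Definition cutg n (d : gdata n) (c : {set 'I_n}) : gdata n :=
  ([ffun v => if v \in c then None else gout d v], gdec d).
(* a vertex of the root (tree) resp. of the cycle (aroma) *)
Definition core n (d : gdata n) : option 'I_n :=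
  omap (fun v0 => iter n (fun v => odflt v (gout d v)) v0) [pick v : 'I_n].

End Graphs.

Section AromaticForests.
Variable K : fieldType.
Variable C : finType.

(* AF = S(A_0) (x) S(T) = S(A_0 (+) T): basis = monomials in the classes   *)
(* of aromas and trees, i.e. isomorphism classes of aromatic forests       *)
Definition AFb := {cmonom ConnCls C}.
Definition AF := {malg K[AFb]}.
Definition ntrF (f : AFb) : nat := (\sum_(x <- finsupp f | isTree x) f x)%N.
Definition ATb := {f : AFb | ntrF f == 1%N}.
Definition CFb := {cmonom ATb}.
Definition CF := {malg K[CFb]}.

Definition forest_graph (f : AFb) : graph C :=
  foldr (@gunion C) (gempty C) [seq val x | x <- factors f].
Definition sigmaAF (f : AFb) : nat := naut (tagged (forest_graph f)).
Definition sigmaCF (c : CFb) : nat :=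
  (\prod_(p <- finsupp c) ((c p)`! * (sigmaAF (val p)) ^ (c p)))%N.

Definition psiF (c : CFb) : AFb :=
  \big[mmul/mone]_(p <- finsupp c) expcmn (val p) (c p).
Definition clumpingsF (f : AFb) : seq CFb :=
  let ks := filter (fun x => ~~ isTree x) (factors f) in
  let ts := filter (@isTree C) (factors f) in
  undup [seq \big[mmul/mone]_(Y <- pmap insub
              [seq mulcm (ucm (tnth (in_tuple ts) i))
                   (\big[mmul/mone]_(k < size ks | g k == i)
                       ucm (tnth (in_tuple ks) k)) | i <- enum 'I_(size ts)])
            ucm Y
        | g : {ffun 'I_(size ks) -> 'I_(size ts)} <- enum {: {ffun 'I_(size ks) -> 'I_(size ts)}}].
(* psi^* : AF -> CF, adjoint of psi *)
Definition psistar_b (f : AFb) : CF :=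
  \sum_(c <- clumpingsF f | psiF c == f)
     ((sigmaAF f)%:R / (sigmaCF c)%:R) *: << c >>.
Definition psistar : AF -> CF := linext psistar_b.

Definition clsv n (d : gdata C n) : AF :=
  if clsOf d is Some x then << ucm x >> else 0.

Definition cut_term n (d : gdata C n) (c : {set 'I_n}) : {malg K[mprod AFb AFb]} :=
  let dc := cutg d c in
  tens (\prod_(S <- comps dc | core d \notin [seq Some v | v in S])
          clsv (tagged (subg dc S)))
       (\sum_(S <- comps dc | core d \in [seq Some v | v in S])
          clsv (tagged (subg dc S))).

Definition DeltaBCK_gen (x : ConnCls C) : {malg K[mprod AFb AFb]} :=
  let d := tagged (val x) in
  tens << ucm x >> 1 + \sum_(c : {set 'I_(tag (val x))} | admissible d c) cut_term d c.
Definition DeltaBCKaro : AF -> {malg K[mprod AFb AFb]} := algext DeltaBCK_gen.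

(* reading a right-hand factor of AF as an element of CF (same convention *)
(* as iotaM)                                                               *)
Definition iotaF (f : AFb) : CF :=
  if f == (onecm _) then 1 else if insub f is Some y then << ucm y >> else 0.

Definition DeltaBCKcl : CF -> {malg K[mprod CFb CFb]} :=
  algext (fun p : ATb =>
     tmap (fun a : AFb => psistar << a >>) iotaF (DeltaBCKaro << val p >>)).

Definition classes (n : nat) : seq (ConnCls C) :=
  undup (pmap (fun d : gdata C n => clsOf d) (enum {: gdata C n})).

Definition jaro_gen (v : MonG C) : AF :=
  \sum_(x <- classes (mdeg (val v)) |
          (PhiC x == val v) && (if is_wm1 v then isTree x else ~~ isTree x))
     ((mfact (val v))%:R / (sigmaC x)%:R) *: << ucm x >>.
Definition jaro : AM K C -> AF := algext jaro_gen.
Definition jcl : CM K C -> CF :=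
  algext (fun y : AM1b C => linext iotaF (jaro << val y >>)).

End AromaticForests.

Section TensorMaps.
Variable K : fieldType.
Variable C : finType.
Definition jaro2 : {malg K[mprod (AMb C) (AMb C)]} -> {malg K[mprod (AFb C) (AFb C)]} :=
  tmap (fun a : AMb C => @jaro K C << a >>) (fun a : AMb C => @jaro K C << a >>).
Definition jcl2 : {malg K[mprod (CMb C) (CMb C)]} -> {malg K[mprod (CFb C) (CFb C)]} :=
  tmap (fun a : CMb C => @jcl K C << a >>) (fun a : CMb C => @jcl K C << a >>).
End TensorMaps.

(* Sanity facts: canonical forms are canonical, and clsOf never fails on *)
(* a connected graph (so the insub in clsOf is only a typing device).     *)
Lemma relabelM (C : finType) n (d : gdata C n) (p q : {perm 'I_n}) :
  relabel (relabel d p) q = relabel d (p * q)%g.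
Proof.
rewrite /relabel /gout /gdec /=; congr pair; apply/ffunP=> v; rewrite !ffunE invMg permM.
  by case: (d.1 _) => //= w; rewrite permM.
by [].
Qed.
Lemma canon_canonical (C : finType) n (d : gdata C n) : is_canonical (canon d).
Proof.
apply/forallP=> q; rewrite /canon relabelM.
case: arg_minnP => // p _ hp; exact: hp.
Qed.
Lemma adj_relabel (C : finType) n (d : gdata C n) (p : {perm 'I_n}) u w :
  adj (relabel d p) (p u) (p w) = adj d u w.
Proof.
have E a b : (omap p a == Some (p b)) = (a == Some b).
  by case: a => [a|] //=; apply/eqP/eqP=> [[/perm_inj ->]|[->]].
by rewrite /adj /relabel /gout /= !ffunE !permK !E.
Qed.
Lemma connect_relabel (C : finType) n (d : gdata C n) (p : {perm 'I_n}) u w :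
  connect (adj d) u w -> connect (adj (relabel d p)) (p u) (p w).
Proof.
case/connectP=> s pth ->{w}; elim: s u pth => [|a s IH] u /=; first by rewrite connect0.
case/andP=> hua /IH h; apply: connect_trans h; apply: connect1.
by rewrite adj_relabel.
Qed.
Lemma gconnected_relabel (C : finType) n (d : gdata C n) (p : {perm 'I_n}) :
  gconnected d -> gconnected (relabel d p).
Proof.
case/andP=> n0 /forallP h; rewrite /gconnected n0; apply/forallP=> u; apply/forallP=> w.
rewrite -[u](permKV p) -[w](permKV p); apply: connect_relabel.
exact: (forallP (h _)).
Qed.
Lemma clsOfP (C : finType) n (d : gdata C n) :
  gconnected d -> exists x, clsOf d = Some x.
Proof.
move=> hc; rewrite /clsOf insubT //; last by move=> ?; eexists.
by rewrite /is_conn_cls /= canon_canonical andbT /canon gconnected_relabel.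
Qed.

(* Main.v *)
(** The idea: orbit counting turns a sum over isomorphism classes with weights
    k!/sigma into a sum over labelled graphs whose vertices have prescribed
    decorations and fertilities.

    For (i), an admissible cut of a connected labelled graph is determined by
    the non-empty set B of vertices that stay in the component of the root
    (resp. cycle), and B is exactly a set closed under following edges.  Given
    B, the graph consists of a forest of rooted trees on the complement, a
    connected graph on B, and an attachment of each of the t roots to a vertex
    of B.  Each attachment uses up one incoming edge of its target, so summing
    over attachments gives the t-th power of dbar; summing over forests gives
    the multiset of weight -1 monomials through the exponential formula.

    For (iii), phi^* and psi^* are the same sum, over all assignments of the
    factors that are not trees to those that are.  This sum is multilinear and
    natural, hence commutes with the multiplicative map j^aro.  Comparing the
    symmetry factors amounts to noting that multiplying by one more non-tree
    factor k acts on clumpings as the derivation sending y to k y.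

    The coproduct identity of (ii) follows from (i) and (iii).

    For injectivity, choose one graph x_v with Phi(x_v) = v for every v: it is
    grown from its root leaf by leaf, an aroma being obtained by adding an edge
    out of the root of a tree.  Sending x_v to the right multiple of v, and the
    other graphs to 0, gives a left inverse. *)
Require Import Defs.
From HB Require Import structures.
From mathcomp Require Import all_boot all_order all_algebra all_fingroup.
From mathcomp Require Import finmap monalg.

Set Implicit Arguments.
Unset Strict Implicit.
Unset Printing Implicit Defensive.

Import GRing.Theory.
Local Open Scope ring_scope.
Local Notation divisors := Defs.divisors.
Local Notation classes := Defs.classes.
Local Notation comps := Defs.comps.
Local Notation subg := Defs.subg.

(** * Free modules, tensor products and monomial algebras *)

(** The two coproducts cannot be matched term by term: one runs over multisets of monomials with
    rational weights, the other over cuts of a chosen representative of an isomorphism class. Both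
    are evaluated on one vertex set with a fixed label (decoration, fertility) at each vertex, where
    only the edges vary. Sub-multi-indices become subsets of vertices, and quotients of factorials
    count these subsets. The sums take values in any commutative algebra, with one weight for the
    trees cut off and one for the remaining component; the weights [tens x 1] and [tens 1 x] then
    give the coproduct. The term with right factor [1] is not a cut and is treated apart, so the
    part that stays is non-empty; the empty set can still be added to the sums because it
    contributes zero. Characteristic zero allows division by automorphism numbers, by factorials and
    by the number of trees in a forest. Clumpings of monomials and of forests are handled by one
    argument, for a set of generators with a predicate marking the trees and a weight giving their
    symmetry factors. *)

Section MprodCom.
Variables M1 M2 : conomType.
Lemma mprod_mulC : commutative (@mmul (mprod M1 M2)).
Proof.
by case=> x1 x2 [y1 y2]; congr (_, _); rewrite /= (mulmC x1, mulmC x2).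
Qed.
HB.instance Definition _ := MonomialDef_isConomialDef.Build (mprod M1 M2) mprod_mulC.
End MprodCom.

Section Linext.
Variable K : fieldType.

Lemma malgU_scale (B : choiceType) (c : K) (b : B) : << c *g b >> = c *: << b >>.
Proof. by apply/malgP=> k; rewrite mcoeffZ !mcoeffU mulrnAr mulr1. Qed.

Lemma malg_basis (B : choiceType) (x : {malg K[B]}) :
  x = \sum_(b <- msupp x) x@_b *: << b >>.
Proof. by rewrite {1}[x]monalgE; apply: eq_bigr => b _; rewrite malgU_scale. Qed.

Section OneMap.
Variables (B : choiceType) (V : lmodType K) (f : B -> V).

Lemma linextEw (d : {fset B}) x : (msupp x `<=` d)%fset ->
  linext f x = \sum_(b <- d) x@_b *: f b.
Proof.
move=> le; rewrite /linext (big_fset_incl _ le) //= => b _ /mcoeff_outdom ->.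
by rewrite scale0r.
Qed.

Lemma linext_is_linear : linear (linext f).
Proof.
move=> c x y; pose d := (msupp x `|` msupp y)%fset.
rewrite (@linextEw d (c *: x + y)); last first.
  apply: fsubset_trans (msuppD_le _ _) _; apply: fsetSU; exact: msuppZ_le.
rewrite (@linextEw d x) ?fsubsetUl // (@linextEw d y) ?fsubsetUr //.
rewrite scaler_sumr -big_split; apply: eq_bigr => b _ /=.
by rewrite mcoeffD mcoeffZ scalerDl scalerA.
Qed.
HB.instance Definition _ :=
  GRing.isLinear.Build K {malg K[B]} V *:%R (linext f) linext_is_linear.

Lemma linextU b : linext f << b >> = f b.
Proof. by rewrite /linext msuppU oner_eq0 big_seq_fset1 mcoeffUU scale1r. Qed.
End OneMap.

Lemma eq_linear_malg (B : choiceType) (V : lmodType K)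
    (f g : {linear {malg K[B]} -> V}) :
  (forall b, f << b >> = g << b >>) -> f =1 g.
Proof.
move=> h x; rewrite [x]malg_basis !linear_sum; apply: eq_bigr => b _.
by rewrite !linearZ /= h.
Qed.

Lemma eq_linext (B : choiceType) (V : lmodType K) (f g : B -> V) :
  f =1 g -> linext f =1 linext g.
Proof. by move=> h x; apply: eq_bigr => b _; rewrite h. Qed.

Section Tens.
Variables M1 M2 : monomType.
Implicit Types (x : {malg K[M1]}) (y : {malg K[M2]}).

Lemma tensEl x y :
  tens x y = linext (fun a => linext (fun b => << (a, b) : mprod M1 M2 >>) y) x.
Proof.
apply: eq_bigr => a _; rewrite scaler_sumr; apply: eq_bigr => b _.
by rewrite scalerA.
Qed.
Lemma tensEr x y :
  tens x y = linext (fun b => linext (fun a => << (a, b) : mprod M1 M2 >>) x) y.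
Proof.
rewrite /tens exchange_big; apply: eq_bigr => a _; rewrite scaler_sumr.
by apply: eq_bigr => b _; rewrite scalerA mulrC.
Qed.

Lemma tens_is_linearr x : linear (@tens K M1 M2 x).
Proof. by move=> c y y'; rewrite !tensEr linearP. Qed.
HB.instance Definition _ x :=
  GRing.isLinear.Build K _ _ *:%R (@tens K M1 M2 x) (tens_is_linearr x).

Lemma tens_suml I (r : seq I) P (F : I -> {malg K[M1]}) y :
  tens (\sum_(i <- r | P i) F i) y = \sum_(i <- r | P i) tens (F i) y.
Proof.
rewrite tensEl linear_sum; apply: eq_bigr => i _; exact/esym/tensEl.
Qed.
Lemma tensZl c x y : tens (c *: x) y = c *: tens x y.
Proof. by rewrite !tensEl linearZ. Qed.
Lemma tens0l y : tens 0 y = 0 :> {malg K[mprod M1 M2]}.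
Proof. by rewrite tensEl linear0. Qed.
Lemma tensDl x x' y : tens (x + x') y = tens x y + tens x' y.
Proof. by rewrite !tensEl linearD. Qed.
Lemma tensU a b : tens << a >> << b >> = << (a, b) : mprod M1 M2 >> :> {malg K[_]}.
Proof. by rewrite tensEl !linextU. Qed.
End Tens.

Lemma malgUM (M : monomType) (a b : M) :
  << a >> * << b >> = << mmul a b >> :> {malg K[M]}.
Proof. by rewrite malgM_def fgmulUU mulr1. Qed.

Lemma malg_mulE (M : monomType) (x y : {malg K[M]}) :
  x * y = \sum_(a <- msupp x) \sum_(b <- msupp y) (x@_a * y@_b) *: << mmul a b >>.
Proof.
by rewrite malgME; apply: eq_bigr=> a _; apply: eq_bigr => b _; rewrite malgU_scale.
Qed.

Lemma linear_mul_basis (M : monomType) (A : algType K)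
    (f : {linear {malg K[M]} -> A}) :
  (forall a b, f << mmul a b >> = f << a >> * f << b >>) ->
  forall x y, f (x * y) = f x * f y.
Proof.
move=> h x y; rewrite malg_mulE.
have fE z : f z = \sum_(a <- msupp z) z@_a *: f << a >>.
  rewrite {1}[z]malg_basis linear_sum; apply: eq_bigr => a _; exact: linearZ.
rewrite (fE x) (fE y) linear_sum mulr_suml; apply: eq_bigr => a _.
rewrite linear_sum mulr_sumr; apply: eq_bigr => b _.
by rewrite linearZ /= h -scalerAl -scalerAr scalerA.
Qed.

Lemma malg_ind (B : choiceType) (P : {malg K[B]} -> Prop) :
  P 0 -> (forall c b x, P x -> P (c *: << b >> + x)) -> forall x, P x.
Proof.
move=> P0 PD x; rewrite [x]malg_basis; elim: (X in \sum_(b <- X) _) => [|b r IH].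
  by rewrite big_nil.
by rewrite big_cons; apply: PD.
Qed.

Lemma tensM (M1 M2 : conomType) (x x' : {malg K[M1]}) (y y' : {malg K[M2]}) :
  tens (x * x') (y * y') = tens x y * tens x' y'.
Proof.
elim/malg_ind: x => [|c a x IH]; first by rewrite mul0r !tens0l mul0r.
rewrite mulrDl !tensDl mulrDl {}IH; congr (_ + _).
rewrite -scalerAl !tensZl -scalerAl; congr (_ *: _).
elim/malg_ind: x' => [|c' a' x' IH]; first by rewrite mulr0 !tens0l mulr0.
rewrite mulrDr !tensDl mulrDr {}IH; congr (_ + _).
rewrite -scalerAr !tensZl -scalerAr; congr (_ *: _).
elim/malg_ind: y => [|d b y IH]; first by rewrite mul0r !linear0 mul0r.
rewrite mulrDl !linearD /= mulrDl {}IH; congr (_ + _).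
rewrite -scalerAl !linearZ /= -scalerAl; congr (_ *: _).
elim/malg_ind: y' => [|d' b' y' IH]; first by rewrite mulr0 !linear0 mulr0.
rewrite mulrDr !linearD /= mulrDr {}IH; congr (_ + _).
rewrite -scalerAr !linearZ /= -scalerAr; congr (_ *: _).
by rewrite !malgUM !tensU malgUM.
Qed.
Lemma tens11 (M1 M2 : monomType) : tens 1 1 = 1 :> {malg K[mprod M1 M2]}.
Proof. exact: tensU. Qed.

Section Tmap.
Variables (M1 M2 N1 N2 : monomType).
Variables (f : M1 -> {malg K[N1]}) (g : M2 -> {malg K[N2]}).
HB.instance Definition _ := GRing.Linear.copy (tmap f g)
   (linext (fun ab : mprod M1 M2 => tens (f ab.1) (g ab.2))).
Lemma tmapU a b : tmap f g << (a, b) >> = tens (f a) (g b).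
Proof. exact: linextU. Qed.
Lemma tmap_tens x y : tmap f g (tens x y) = tens (linext f x) (linext g y).
Proof.
rewrite /tens linear_sum [linext f x]/linext.
rewrite -/(tens _ _) tens_suml; apply: eq_bigr => a _.
rewrite linear_sum [linext g y]/linext linear_sum; apply: eq_bigr => b _.
by rewrite !linearZ /= tmapU tensZl scalerA mulrC.
Qed.
End Tmap.

Lemma tmap_mul (M1 M2 N1 N2 : conomType)
  (f : M1 -> {malg K[N1]}) (g : M2 -> {malg K[N2]}) :
  {morph f : a b / mmul a b >-> a * b} -> {morph g : a b / mmul a b >-> a * b} ->
  {morph tmap f g : x y / x * y}.
Proof.
move=> hf hg; apply: linear_mul_basis => -[a1 a2] [b1 b2].
have -> : mmul ((a1, a2) : mprod M1 M2) (b1, b2) = (mmul a1 b1, mmul a2 b2) by [].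
by rewrite /= !tmapU hf hg tensM.
Qed.

End Linext.

(** * Monomials as multisets and their multiplicative evaluation *)

Section CMonom.
Variable I : choiceType.
Implicit Types m : {cmonom I}.

Lemma expcmnE m k i : expcmn m k i = (k * m i)%N.
Proof.
elim: k => [|k IH]; first exact: onecmE.
have -> : expcmn m k.+1 = mmul m (expcmn m k).
  by case: k {IH} => [|k] //=; rewrite mulm1.
by rewrite cmM IH mulSn.
Qed.

Lemma cm_prodE (J : Type) (r : seq J) P (F : J -> {cmonom I}) i :
  (\big[mmul/mone]_(j <- r | P j) F j) i = (\sum_(j <- r | P j) F j i)%N.
Proof.
by elim/big_rec2: _ => [|j a b _ <-]; rewrite ?cm1 // cmM.
Qed.

Lemma cm_ind (P : {cmonom I} -> Prop) :
  P mone -> (forall i m, P m -> P (mmul (ucm i) m)) -> forall m, P m.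
Proof.
move=> P1 PM m; elim: {m}(mdeg m) {-2}m (erefl (mdeg m)) => [|n IH] m hm.
  by rewrite (mdeg_eq0I hm).
have [i hi] : exists i, i \in finsupp m.
  apply/fset0Pn; apply: contra_eqN hm => /eqP h0.
  by rewrite mdegE h0 big_seq_fset0.
have e : m = mmul (ucm i) (divcm m (ucm i)).
  apply/eqP/cmP=> j; rewrite cmM cmU divcmE cmU.
  case: eqP => [<-|]; last by rewrite subn0.
  by move: hi; rewrite -cmE_neq0; case: (m i) => // k _; rewrite add1n subn1.
rewrite e; apply/PM/IH; apply: (@addnI 1).
by rewrite -[LHS](_ : mdeg m = _) // [in LHS]e mdegM mdegU.
Qed.

Definition lcmon (s : seq I) : {cmonom I} := \big[mmul/mone]_(i <- s) ucm i.
Lemma lcmonE s i : lcmon s i = count_mem i s.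
Proof.
rewrite /lcmon cm_prodE; elim: s => [|j s IH]; rewrite ?big_nil ?big_cons //=.
by rewrite IH ucmE.
Qed.
Lemma count_factors m i : count_mem i (factors m) = m i.
Proof.
rewrite /factors; rewrite count_flatten -map_comp sumnE big_map /=.
have e (j : I) : count_mem i (nseq (m j) j) = (m j * (j == i))%N.
  by rewrite count_nseq mulnC.
under eq_bigr => j _ do rewrite /= e.
case: (finsuppP m i) => h.
  rewrite big1_fset // => j hj _.
  by case: eqP => [e'|]; rewrite ?muln0 //; rewrite e' in hj; rewrite hj in h.
rewrite (big_fsetD1 i) //= eqxx muln1 big1_fset ?addn0 // => j.
by rewrite !inE => /andP[/negbTE -> _] _; rewrite muln0.
Qed.
Lemma lcmon_factors m : lcmon (factors m) = m.
Proof. by apply/eqP/cmP=> i; rewrite lcmonE count_factors. Qed.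
End CMonom.

Section MonEv.
Variable (I : choiceType) (A : comNzRingType) (f : I -> A).
Definition monev (m : {cmonom I}) : A := \prod_(v <- finsupp m) f v ^+ m v.
Lemma monevEw (d : {fset I}) (m : {cmonom I}) : (finsupp m `<=` d)%fset ->
  monev m = \prod_(v <- d) f v ^+ m v.
Proof.
move=> le; rewrite /monev (big_fset_incl _ le) //= => v _.
by rewrite -cmE_eq0 => /eqP ->.
Qed.
Lemma monevM m1 m2 : monev (mmul m1 m2) = monev m1 * monev m2.
Proof.
pose d := (finsupp m1 `|` finsupp m2)%fset.
rewrite (@monevEw d m1) ?fsubsetUl // (@monevEw d m2) ?fsubsetUr //.
rewrite (@monevEw d) ?mdomD // -big_split; apply: eq_bigr => v _ /=.
by rewrite cmM exprD.
Qed.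
Lemma monev1 : monev mone = 1.
Proof. by rewrite /monev mdom1 big_seq_fset0. Qed.
Lemma monevU i : monev (ucm i) = f i.
Proof. by rewrite /monev mdomU big_seq_fset1 cmUU expr1. Qed.
End MonEv.

Section Algext.
Variables (K : fieldType) (V : choiceType) (A : comAlgType K) (f : V -> A).
HB.instance Definition _ := GRing.Linear.copy (algext f)
   (linext (fun m : {cmonom V} => \prod_(v <- finsupp m) f v ^+ m v)).
Lemma algextB m : algext f << m >> = monev f m.
Proof. exact: linextU. Qed.
Lemma algextU v : algext f << ucm v >> = f v.
Proof. by rewrite algextB monevU. Qed.
Lemma algext_mult : monoid_morphism (algext f).
Proof.
split; first exact: (etrans (algextB mone) (monev1 _)).
apply: linear_mul_basis => a b; apply: etrans (algextB _) _; rewrite monevM.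
by congr (_ * _); apply: esym; apply: algextB.
Qed.
HB.instance Definition _ := GRing.isMonoidMorphism.Build _ _ (algext f) algext_mult.
End Algext.

Lemma eq_lrmorphism_malg (K : fieldType) (V : choiceType) (A : algType K)
    (f g : {linear {malg K[{cmonom V}]} -> A}) :
  monoid_morphism f -> monoid_morphism g ->
  (forall v, f << ucm v >> = g << ucm v >>) -> f =1 g.
Proof.
move=> [f1 fM] [g1 gM] h; apply: eq_linear_malg.
elim/cm_ind => [|v m IH]; first by rewrite f1 g1.
rewrite -malgUM; apply: etrans (fM _ _) _; apply: etrans _ (esym (gM _ _)).
by congr (_ * _); [apply: h | apply: IH].
Qed.

(** * Label multisets: counting permutations and subsets *)

Section Mon.
Variables (T : finType) (U : choiceType).
Implicit Types (h : T -> U) (A S : {set T}) (u : U).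

(** For [h] the pair of decoration and fertility, this is the fertility map restricted to the
    vertices in [A]. *)
Definition monS h A : {cmonom U} := \big[mmul/mone]_(v in A) ucm (h v).

Lemma monSE h A u : monS h A u = #|[set x in A | h x == u]|.
Proof.
rewrite /monS cm_prodE (eq_bigr (fun v => if h v == u then 1%N else 0%N)).
  by rewrite -big_mkcondr /= sum1dep_card; apply: eq_card => x; rewrite !inE.
by move=> v _; rewrite ucmE; case: eqP.
Qed.
Lemma monS0 h : monS h set0 = mone.
Proof. by rewrite /monS big_set0. Qed.
Lemma monSD1 h A v : v \in A -> monS h A = mmul (ucm (h v)) (monS h (A :\ v)).
Proof. by move=> vA; rewrite /monS (big_setD1 v). Qed.
Lemma monSD h A S : S \subset A -> monS h A = mmul (monS h S) (monS h (A :\: S)).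
Proof. by move=> sub; rewrite /monS (big_setID S) (setIidPr sub). Qed.
Lemma eq_monS h h' A : {in A, h =1 h'} -> monS h A = monS h' A.
Proof. by move=> e; apply: eq_bigr => v vA; rewrite e. Qed.
Lemma mdeg_monS h A : mdeg (monS h A) = #|A|.
Proof. by rewrite /monS mdeg_prod (eq_bigr (fun=> 1%N)) ?sum1_card // => v _; rewrite mdegU. Qed.
End Mon.

(** Passes from a sum over vertices to a sum over variables with exponents, the form in which [dbar]
    is given. *)
Lemma sum_monS (T : finType) (U : choiceType) (E : nmodType) (h : T -> U)
   (A : {set T}) (f : U -> E) :
  \sum_(v in A) f (h v) = \sum_(u <- finsupp (monS h A)) f u *+ (monS h A u).
Proof.
transitivity (\sum_(v in A) \sum_(u <- finsupp (monS h A)) f u *+ (h v == u)).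
  apply: eq_bigr => v vA; rewrite (big_fsetD1 (h v)) /=; last first.
    rewrite -cmE_neq0 monSE -lt0n; apply/card_gt0P; exists v.
    by rewrite inE vA /=.
  rewrite eqxx mulr1n big1_fset ?addr0 // => u.
  by rewrite !inE => /andP[/negbTE ne _] _; rewrite eq_sym ne.
rewrite exchange_big; apply: eq_bigr => u _ /=.
rewrite sumrMnr; congr (_ *+ _); rewrite monSE -sum1_card big_mkcond [RHS]big_mkcond /=.
by apply: eq_bigr => v _; rewrite inE; case: (v \in A) => //=; case: eqP.
Qed.

Section Mfact.
Variable I : choiceType.
Implicit Types (m : {cmonom I}).
Lemma mfactEw (d : {fset I}) m : (finsupp m `<=` d)%fset ->
  mfact m = (\prod_(i <- d) (m i)`!)%N.
Proof.
move=> le; rewrite /mfact (big_fset_incl _ le) //= => i _.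
by rewrite -cmE_eq0 => /eqP ->.
Qed.
Lemma mfact1 : mfact (mone : {cmonom I}) = 1%N.
Proof. by rewrite /mfact mdom1 big_seq_fset0. Qed.
Lemma mfactU i m : mfact (mmul (ucm i) m) = ((m i).+1 * mfact m)%N.
Proof.
pose d := (i |` finsupp m)%fset.
rewrite (@mfactEw d) ?mdomD ?mdomU // (@mfactEw d m) ?fsubsetUr //.
rewrite [LHS](big_fsetD1 i) ?fset1U1 //= [X in _ = (_ * X)%N](big_fsetD1 i) ?fset1U1 //=.
rewrite mulnA cmM cmUU add1n factS; congr (_ * _)%N.
rewrite big_seq [RHS]big_seq; apply: eq_bigr => j.
by rewrite !inE => /andP[ne _]; rewrite cmM cmU eq_sym (negbTE ne).
Qed.
Lemma mfact_gt0 m : (0 < mfact m)%N.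
Proof. by rewrite /mfact prodn_gt0 // => i; rewrite fact_gt0. Qed.
End Mfact.

Section PermCount.
Variables (T : finType) (U : choiceType).
Implicit Types (h : T -> U) (A : {set T}).

Definition pres h (p : {perm T}) := [forall x, h (p x) == h x].

(** Induction on [A]: the image of a point [a] is any point with the same label, and composing with
    a transposition leaves a permutation that fixes [a]. *)
Lemma card_perm_pres h A :
  #|[set p : {perm T} | perm_on A p && pres h p]| = mfact (monS h A).
Proof.
elim: {A}#|A| {-2}A (erefl #|A|) => [|k IH] A.
  move/eqP; rewrite cards_eq0 => /eqP ->; rewrite monS0 mfact1.
  rewrite (_ : [set p | _] = [set 1%g]) ?cards1 //; apply/setP => p.
  rewrite !inE; apply/andP/eqP => [[on _]|->].
    by apply: (perm_on_id on); rewrite cards0.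
  by split; [apply: perm_on1 | apply/forallP=> x; rewrite perm1].
move=> hA; have [a aA] : exists a, a \in A by apply/set0Pn; rewrite -card_gt0 hA.
have hA1 : #|A :\ a| = k by apply/eqP; rewrite -eqSS -hA (cardsD1 a A) aA.
rewrite (monSD1 _ aA) mfactU -(IH _ hA1).
have -> : (monS h (A :\ a) (h a)).+1 = #|[set b in A | h b == h a]|.
  by rewrite monSE [RHS](cardsD1 a) inE aA eqxx add1n; congr _.+1;
     apply: eq_card => x; rewrite !inE andbA.
rewrite -cardsX.
pose f (bq : T * {perm T}) := (bq.2 * tperm a bq.1)%g.
rewrite -[RHS](card_in_imset (f := f)) => [|[b q] [b' q']].
  apply: eq_card => p; apply/idP/imsetP => [|[[b q]]].
    rewrite inE => /andP[on /forallP pr]; exists (p a, p * tperm a (p a))%g; last first.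
      by rewrite /f /= -mulgA tperm2 mulg1.
    rewrite !inE /= perm_closed // aA pr /=; apply/andP; split.
      apply/subsetP => x; rewrite !inE permM; case: (eqVneq x a) => [->|ne].
        by rewrite tpermR eqxx.
      apply: contraR => xA; rewrite (out_perm on xA) tpermD //.
        by apply: contraNneq xA => <-.
      by apply: contraNneq xA => <-; rewrite perm_closed.
    apply/forallP => x; rewrite permM; case: tpermP => [e|e|//].
    - by rewrite -(eqP (pr x)) e (eqP (pr a)).
    - by rewrite -(eqP (pr x)) e (eqP (pr a)).
  rewrite !inE /= => /andP[/andP[bA hb] /andP[on /forallP pr]] ->; apply/andP; split.
    apply: perm_onM; first by apply: subset_trans on _; rewrite subD1set.
    apply: subset_trans (tperm_on _ _) _.
    by apply/subsetP=> x; rewrite !inE => /orP[] /eqP ->.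
  apply/forallP => x; rewrite permM; case: tpermP => [e|e|_ _].
  - by rewrite (eqP hb) -(eqP (pr x)) e.
  - by rewrite -(eqP (pr x)) e (eqP hb).
  - exact: pr.
rewrite !inE /= => /andP[/andP[bA hb] /andP[on /forallP pr]].
move=> /andP[/andP[bA' hb'] /andP[on' /forallP pr']].
have qa : q a = a by rewrite (out_perm on) // !inE eqxx.
have qa' : q' a = a by rewrite (out_perm on') // !inE eqxx.
rewrite /f /= => e; have eb : b = b'.
  by move/permP: (e) => /(_ a); rewrite !permM qa qa' !tpermL.
by move: e; rewrite eb => /mulIg ->.
Qed.
End PermCount.

Section PermMatch.
Variables (n : nat) (U : choiceType).
Implicit Types (h : 'I_n -> U).

Lemma monST_perm h1 h2 : monS h1 setT = monS h2 setT ->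
  exists p : {perm 'I_n}, forall i, h1 (p i) = h2 i.
Proof.
move=> e; have : perm_eq [tuple h2 i | i < n] [tuple h1 i | i < n].
  apply/allP => u _ /=; rewrite !count_map.
  have c (h : 'I_n -> U) : count (preim h (pred1 u)) (enum 'I_n) = monS h setT u.
    by rewrite monSE -sum1_count big_enum_cond -sum1_card; apply: eq_bigl => x; rewrite !inE.
  rewrite -!enumT; apply/eqP; apply: etrans (c h2) _; rewrite -e; exact/esym/c.
case/tuple_permP => p hp; exists p => i.
have := congr1 (fun s => nth (h2 i) s i) hp.
by rewrite -!tnth_nth !tnth_mktuple.
Qed.

(** If one matching permutation exists, all of them form a coset of the label-preserving ones;
    equality of the label multisets provides one. *)
Lemma card_perm_match h1 h2 :
  #|[set p : {perm 'I_n} | [forall i, h1 (p i) == h2 i]]| =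
  if monS h1 setT == monS h2 setT then mfact (monS h2 setT) else 0%N.
Proof.
case: eqP => [e|ne]; last first.
  apply/eqP; rewrite cards_eq0; apply/eqP/setP => p; rewrite !inE; apply/negP.
  move=> /forallP hp; case: ne; rewrite /monS (reindex_inj (@perm_inj _ p)) /=.
  by apply: eq_big => [i|i _]; rewrite ?inE ?(eqP (hp i)).
have [q hq] := monST_perm e.
rewrite -(card_perm_pres h2).
have inj : injective (fun p : {perm 'I_n} => p * q)%g by exact: mulIg.
rewrite -[RHS](card_imset _ inj); apply: eq_card => p; apply/idP/imsetP.
  rewrite inE => /forallP hp; exists (p * q^-1)%g; last by rewrite mulgKV.
  rewrite inE; apply/andP; split; first by apply/subsetP.
  by apply/forallP => i; rewrite -hq permM permKV.
case=> p'; rewrite !inE => /andP[_ /forallP hp] ->.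
by apply/forallP => i; rewrite permM hq.
Qed.
End PermMatch.

(** The count is a product of binomial coefficients, one per label. The induction is Pascal's rule:
    a chosen point [a] lies in [S] or not, and its label [u] occurs [k u + r u] times in all. *)
Lemma card_subset_monS (T : finType) (U : choiceType) (h : T -> U) (A : {set T})
    (k r : {cmonom U}) : mmul k r = monS h A ->
  (#|[set S : {set T} | (S \subset A) && (monS h S == k)]| * (mfact k * mfact r) =
   mfact (monS h A))%N.
Proof.
elim: {A}#|A| {-2}A (erefl #|A|) k r => [|c IH] A.
  move/eqP; rewrite cards_eq0 => /eqP -> k r; rewrite monS0 => /unitm[-> ->].
  rewrite mfact1 !muln1; apply: (@eq_card1 _ set0) => S.
  rewrite !inE subset0; case: eqP => [->|//]; by rewrite monS0 eqxx.
move=> hA k r e; have [a aA] : exists a, a \in A by apply/set0Pn; rewrite -card_gt0 hA.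
have hA1 : #|A :\ a| = c by apply/eqP; rewrite -eqSS -hA (cardsD1 a A) aA.
move: e; rewrite (monSD1 _ aA); set u := h a; set m := monS _ _ => e.
rewrite mfactU.
pose N (B : {set T}) k := #|[set S : {set T} | (S \subset B) && (monS h S == k)]|.
have split : N A k = (N (A :\ a) k + #|[set S : {set T} | [&& S \subset A :\ a & mmul (ucm u) (monS h S) == k]]|)%N.
  rewrite /N -(cardsID [set S : {set T} | a \in S]) addnC; congr addn.
    apply: eq_card => S; rewrite !inE subsetD1.
    by case: (a \in S); rewrite /= ?andbF ?andbT.
  rewrite -[RHS](card_in_imset (f := fun S => a |: S)) => [|S S'].
    apply: eq_card => S; rewrite !inE; apply/idP/imsetP.
      case/andP=> /andP[sub /eqP hS] aS; exists (S :\ a); last by rewrite setD1K.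
      by rewrite inE setSD //= -monSD1 ?hS.
    case=> S'; rewrite inE => /andP[sub hS] ->; rewrite setU11 andbT.
    move: sub; rewrite subsetD1 => /andP[sub na].
    by rewrite subUset sub1set aA sub /= (monSD1 _ (setU11 _ _)) setU1K.
  rewrite !inE !subsetD1 => /andP[/andP[_ na] _] /andP[/andP[_ na'] _] e'.
  by rewrite -(setU1K na) e' setU1K.
have hk0 (b : {cmonom U}) : b u != 0%N -> exists b', b = mmul (ucm u) b'.
  move=> bu; exists (divcm b (ucm u)); apply/eqP/cmP => i.
  rewrite cmM cmU divcmE cmU; case: eqP => [<-|]; last by rewrite subn0.
  by rewrite subnKC // lt0n.
have cancel (b b' : {cmonom U}) : (mmul (ucm u) b == mmul (ucm u) b') = (b == b').
  apply/eqP/eqP => [/eqP/cmP h'|-> //]; apply/eqP/cmP => i.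
  by have := h' i; rewrite !cmM => /addnI.
have m_u : (k u + r u = (m u).+1)%N.
  by move/eqP/cmP: e => /(_ u); rewrite !cmM cmUU add1n.
rewrite -/(N A k) split mulnDl -m_u mulnDl addnC; congr addn.
  case: (eqVneq (k u) 0%N) => [k0|/hk0[k' ek]].
    rewrite k0 mul0n (_ : [set _ | _] = set0) ?cards0 //.
    apply/setP => S; rewrite !inE; apply/negbTE/negP => /andP[_ /eqP ek].
    by move: k0; rewrite -ek cmM cmUU.
  have em : mmul k' r = m by apply/eqP; rewrite -cancel mulmA -ek e.
  rewrite -(IH _ hA1 k' r em) ek mfactU cmM cmUU add1n.
  rewrite (eq_card (B := [set S : {set T} | (S \subset A :\ a) && (monS h S == k')])).
    by rewrite -mulnA mulnCA.
  by move=> S; rewrite !inE cancel.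
case: (eqVneq (r u) 0%N) => [r0|/hk0[r' er]].
  rewrite r0 mul0n (_ : N _ _ = 0%N) //; apply/eqP; rewrite cards_eq0.
  apply/eqP/setP => S; rewrite !inE; apply/negbTE/negP => /andP[sub /eqP ek].
  have := m_u; rewrite r0 addn0 -ek /m (monSD _ sub) cmM => e'.
  by have := leq_addr (monS h ((A :\ a) :\: S) u) (monS h S u); rewrite -ltnS -e' ltnn.
have em : mmul k r' = m by apply/eqP; rewrite -cancel mulmA [mmul _ k]mulmC -mulmA -er e.
rewrite -(IH _ hA1 k r' em) er mfactU cmM cmUU add1n.
by rewrite [(mfact k * _)%N]mulnCA mulnCA.
Qed.

(** * Isomorphism classes of labelled graphs *)

(** The value is [None] exactly when [S] is not connected, so disconnected graphs get weight zero in
    the sums below. *)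
HB.lock Definition clsS (C : finType) n (d : gdata C n) (S : {set 'I_n}) :=
  clsOf (tagged (subg d S)).

Section Cls.
Variable C : finType.

Lemma gdata_ext n (d d' : gdata C n) :
  (forall u w, (gout d u == Some w) = (gout d' u == Some w)) ->
  gdec d =1 gdec d' -> d = d'.
Proof.
case: d d' => o c [o' c'] ho hc; congr pair; last exact/ffunP.
apply/ffunP => u; have := ho u; rewrite /gout /=.
case: (o u) => [w|] h; first by have := h w; rewrite eqxx => /esym/eqP.
by case: (o' u) h => // w /(_ w); rewrite eqxx.
Qed.

Section Relabel.
Variable n : nat.
Implicit Types (d : gdata C n) (p q : {perm 'I_n}).

Lemma relabel1 d : relabel d 1%g = d.
Proof.
case: d => o c; congr pair; apply/ffunP => v; rewrite ffunE invg1 perm1 /gout /gdec //=.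
by case: (o v) => //= w; rewrite perm1.
Qed.
Lemma relabelK d p : relabel (relabel d p) p^-1%g = d.
Proof. by rewrite relabelM mulgV relabel1. Qed.

Lemma canonE d : exists p, canon d = relabel d p.
Proof. by eexists. Qed.

(** Two canonical forms in one orbit both minimise the [pickle] code, so their codes agree, and
    [pickle] is injective. *)
Lemma canonical_relabel d p :
  is_canonical d -> is_canonical (relabel d p) -> relabel d p = d.
Proof.
move=> /forallP h1 /forallP h2; apply: (pcan_inj choice.pickleK).
apply/eqP; rewrite eqn_leq h1 andbT.
by have := h2 p^-1%g; rewrite relabelK.
Qed.

Lemma canon_id d : is_canonical d -> canon d = d.
Proof.
move=> hd; have [p hp] := canonE d; rewrite hp.
by apply: canonical_relabel => //; rewrite -hp canon_canonical.
Qed.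

Lemma canon_relabel d p : canon (relabel d p) = canon d.
Proof.
have [q hq] := canonE (relabel d p); have [r hr] := canonE d.
have e : canon (relabel d p) = relabel (canon d) (r^-1 * (p * q))%g.
  by rewrite hq hr !relabelM mulKVg.
rewrite e; apply: canonical_relabel; first exact: canon_canonical.
by rewrite -e canon_canonical.
Qed.

Lemma gconnected_relabelE d p : gconnected (relabel d p) = gconnected d.
Proof.
apply/idP/idP; last exact: gconnected_relabel.
by move=> h; rewrite -(relabelK d p); apply: gconnected_relabel.
Qed.

Lemma clsOf_relabel d p : clsOf (relabel d p) = clsOf d.
Proof. by rewrite /clsOf canon_relabel. Qed.

Lemma clsOf_None d : ~~ gconnected d -> clsOf d = None.
Proof.
move=> h; rewrite /clsOf insubF //; have [p ->] := canonE d.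
by rewrite /is_conn_cls /= gconnected_relabelE (negbTE h).
Qed.

Lemma clsOf_SomeE d (x : ConnCls C) (r : gdata C n) : val x = Tagged (@gdata C) r ->
  (clsOf d == Some x) = [exists p, relabel r p == d].
Proof.
move=> hx; have /andP[] := valP x; rewrite hx /= => hc hr.
apply/eqP/existsP => [|[p /eqP <-]].
  rewrite /clsOf; case: insubP => // x' _ e [e']; move: e; rewrite e' hx => e.
  have /eqP := e; rewrite eq_Tagged => /eqP /= {}e.
  have [p hp] := canonE d; exists p^-1%g; rewrite e hp; exact/eqP/relabelK.
rewrite clsOf_relabel /clsOf canon_id // -hx; exact: valK.
Qed.
End Relabel.

Lemma clsOf_val (x : ConnCls C) : clsOf (tagged (val x)) = Some x.
Proof.
case e: (val x) => [n r]; apply/eqP; rewrite (@clsOf_SomeE n r x r) //.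
by apply/existsP; exists 1%g; rewrite relabel1.
Qed.

Lemma clsOf_iso n m (d : gdata C n) (d' : gdata C m) (f : 'I_n -> 'I_m) :
  bijective f ->
  (forall u w, (gout d u == Some w) = (gout d' (f u) == Some (f w))) ->
  (forall u, gdec d' (f u) = gdec d u) -> clsOf d = clsOf d'.
Proof.
move=> bf; have e : n = m by rewrite -(card_ord n) -(card_ord m); apply: bij_eq_card bf.
case: m / e d' f bf => d' f bf ho hd; pose p := perm (bij_inj bf).
rewrite -(clsOf_relabel d p); congr clsOf; rewrite /relabel.
have pE u : p u = f u by rewrite permE.
case: d' ho hd => o' c' ho hd; congr pair; apply/ffunP => v; rewrite ffunE; last first.
  by rewrite -hd -pE permKV.
set u := (p^-1)%g v; have -> : v = f u by rewrite -pE permKV.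
case e: (gout d u) => [w|] /=.
  by have := ho u w; rewrite e eqxx => /esym/eqP; rewrite /gout /= => ->; rewrite pE.
case e': (o' (f u)) => [w|] //; have := ho u ((p^-1)%g w).
by rewrite e /gout /= e' -pE permKV eqxx.
Qed.

Section Subg.
Variables (n : nat) (d : gdata C n) (S : {set 'I_n}).
(** The inclusion of [subg d S], whose vertices are renumbered by [enum S], into [d]. *)
Definition sgv (i : 'I_(size (enum S))) : 'I_n := tnth (in_tuple (enum S)) i.
Lemma sgv_inj : injective sgv.
Proof.
move=> i j; rewrite /sgv !(tnth_nth (sgv i)) => /eqP.
by rewrite nth_uniq ?enum_uniq // => /eqP /val_inj.
Qed.
Lemma sgv_in i : sgv i \in S.
Proof. by rewrite -mem_enum; apply: mem_tnth. Qed.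
Lemma sgv_onto v : v \in S -> exists i, sgv i = v.
Proof.
by rewrite -mem_enum => h; case/(@tnthP _ _ (in_tuple (enum S))): h => i ->; exists i.
Qed.
Lemma subg_out i j : (gout (tagged (subg d S)) i == Some j) = (gout d (sgv i) == Some (sgv j)).
Proof.
rewrite /subg /gout /= ffunE -/(sgv i); case: (d.1 (sgv i)) => [w|] //=.
apply/eqP/eqP => [|[->]].
  case: insubP => // k hk e [ej]; subst j; congr Some; rewrite /sgv (tnth_nth w) /= e.
  by rewrite nth_index // -index_mem.
by rewrite /sgv (tnth_nth w) /= index_uniq ?enum_uniq // insubT //= => h; congr Some; apply: val_inj.
Qed.
Lemma subg_dec i : gdec (tagged (subg d S)) i = gdec d (sgv i).
Proof. by rewrite /gdec /= ffunE. Qed.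
End Subg.

Lemma clsS_iso n m (d : gdata C n) (d' : gdata C m) (S : {set 'I_n}) (S' : {set 'I_m}) f :
  {in S &, injective f} -> f @: S = S' ->
  {in S &, forall u w, (gout d u == Some w) = (gout d' (f u) == Some (f w))} ->
  {in S, forall u, gdec d' (f u) = gdec d u} -> clsS d S = clsS d' S'.
Proof.
move=> finj fS ho hd.
have hg (i : 'I_(size (enum S))) : exists j : 'I_(size (enum S')), sgv j == f (sgv i).
  have /sgv_onto[j hj] : f (sgv i) \in S' by rewrite -fS imset_f ?sgv_in.
  by exists j; rewrite hj.
pose g i := xchoose (hg i); have gE i : sgv (g i) = f (sgv i) by apply/eqP/(xchooseP (hg i)).
have ginj : injective g.
  move=> i j e; apply: sgv_inj; apply: finj; rewrite ?sgv_in //.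
  by rewrite -!gE e.
rewrite clsS.unlock; apply: (@clsOf_iso _ _ _ _ g).
- apply: inj_card_bij => //; rewrite !card_ord -!cardE -fS.
  by rewrite card_in_imset.
- by move=> i j; rewrite !subg_out !gE ho ?sgv_in.
- by move=> i; rewrite !subg_dec gE hd ?sgv_in.
Qed.

Lemma clsS_eq n (d d' : gdata C n) (S : {set 'I_n}) :
  {in S &, forall u w, (gout d u == Some w) = (gout d' u == Some w)} ->
  {in S, forall u, gdec d' u = gdec d u} -> clsS d S = clsS d' S.
Proof.
by move=> ho hd; apply: (@clsS_iso _ _ _ _ _ _ id) => //; rewrite imset_id.
Qed.

Lemma clsS_setT n (d : gdata C n) : clsS d setT = clsOf d.
Proof.
rewrite clsS.unlock; apply: (@clsOf_iso _ _ _ _ (@sgv n setT)).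
- apply: inj_card_bij; first exact: sgv_inj.
  by rewrite !card_ord -cardE cardsT card_ord.
- by move=> i j; rewrite subg_out.
- by move=> i; rewrite subg_dec.
Qed.

(** Unlike [subg], this restriction keeps the vertex set ['I_n], with no edges at the vertices
    outside [S]; restrictions to several subsets can then be compared and glued without
    renumbering. *)
Definition rst n (d : gdata C n) (S : {set 'I_n}) : gdata C n :=
  ([ffun v => if v \in S then
       (if gout d v is Some w then if w \in S then Some w else None else None)
     else None], gdec d).

Lemma rst_out n (d : gdata C n) S u w :
  (gout (rst d S) u == Some w) = [&& u \in S, w \in S & gout d u == Some w].
Proof.
rewrite /rst /gout /= ffunE; case: (u \in S) => //=.
case: (d.1 u) => [x|]; last by rewrite andbF.
have -> : (Some x == Some w) = (x == w) by [].
case: (eqVneq x w) => [<-|ne]; first by case: (x \in S); rewrite ?eqxx.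
by rewrite andbF; case: (x \in S) => //; apply/eqP => -[] /eqP; rewrite (negbTE ne).
Qed.

Lemma adj_rst n (d : gdata C n) S u w :
  adj (rst d S) u w = [&& u \in S, w \in S & adj d u w].
Proof.
rewrite /adj !rst_out; case: (u \in S); case: (w \in S) => //=.
Qed.

Definition conn n (d : gdata C n) (S : {set 'I_n}) :=
  (S != set0) && [forall u in S, forall w in S, connect (adj (rst d S)) u w].

Lemma adj_sym n (d : gdata C n) : symmetric (adj d).
Proof. by move=> u w; rewrite /adj orbC. Qed.
Lemma conn_sym n (d : gdata C n) : connect_sym (adj d).
Proof. exact/sym_connect_sym/adj_sym. Qed.

Lemma connP n (d : gdata C n) S :
  reflect (S != set0 /\ {in S &, forall u w, connect (adj (rst d S)) u w}) (conn d S).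
Proof.
apply: (iffP andP) => -[S0 h]; split=> //.
  by move=> u w uS wS; move/forall_inP: h => /(_ u uS) /forall_inP /(_ w wS).
by apply/forall_inP => u uS; apply/forall_inP => w wS; apply: h.
Qed.

Lemma connect_img (T T' : finType) (e : rel T) (e' : rel T') (f : T -> T') :
  (forall u w, e u w -> connect e' (f u) (f w)) ->
  forall u w, connect e u w -> connect e' (f u) (f w).
Proof.
move=> h u w /connectP[s p ->]; elim: s u p => [|a s IH] u /=; first by rewrite connect0.
by case/andP => /h hu /IH; apply: connect_trans.
Qed.

Lemma gconnected_subg n (d : gdata C n) S : gconnected (tagged (subg d S)) = conn d S.
Proof.
have -> : gconnected (tagged (subg d S)) =
    (S != set0) && [forall u, forall w, connect (adj (tagged (subg d S))) u w].
  by rewrite -card_gt0 cardE.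
rewrite /conn; congr (_ && _).
have adjE i j : adj (tagged (subg d S)) i j = adj (rst d S) (sgv i) (sgv j).
  by rewrite adj_rst !sgv_in /adj !subg_out.
apply/forallP/forall_inP => [h u uS|h i].
  apply/forall_inP => w wS; have [i <-] := sgv_onto uS; have [j <-] := sgv_onto wS.
  apply: connect_img (forallP (h i) j) => a b; rewrite adjE; exact: connect1.
apply/forallP => j; move/forall_inP: (h _ (sgv_in i)) => /(_ _ (sgv_in j)).
case/connectP => s; elim: s i => [|a s IH] i /=.
  by move=> _ /sgv_inj ->; rewrite connect0.
case/andP => hia p e; have aS : a \in S by move: hia; rewrite adj_rst => /and3P[].
have [k ek] := sgv_onto aS; rewrite -ek in hia p e.
by apply: connect_trans (connect1 _) (IH k p e); rewrite adjE.
Qed.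

Lemma conn_setT n (d : gdata C n) : conn d setT = gconnected d.
Proof.
rewrite /conn /gconnected -card_gt0 cardsT card_ord; congr (_ && _).
have e u w : adj (rst d setT) u w = adj d u w by rewrite adj_rst !inE.
apply: eq_forallb => u; rewrite inE /=; apply: eq_forallb => w; rewrite inE /=.
exact: eq_connect.
Qed.

Lemma rst_rst n (d : gdata C n) S A : rst (rst d A) S = rst d (S :&: A).
Proof.
by apply: gdata_ext => // u w; rewrite !rst_out !inE; case: (u \in S); case: (u \in A);
   case: (w \in S); case: (w \in A).
Qed.

Lemma conn_rst n (d : gdata C n) (S A : {set _}) : S \subset A -> conn (rst d A) S = conn d S.
Proof. by move=> /setIidPl sub; rewrite /conn rst_rst sub. Qed.

Lemma clsS_rst n (d : gdata C n) (S A : {set _}) : S \subset A -> clsS (rst d A) S = clsS d S.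
Proof.
move=> /subsetP sub; apply: clsS_eq => [u w uS wS|//].
by rewrite rst_out !sub.
Qed.

Lemma clsS_None n (d : gdata C n) S : ~~ conn d S -> clsS d S = None.
Proof. by rewrite -gconnected_subg clsS.unlock; apply: clsOf_None. Qed.
End Cls.

(** * Orbit counting: class sums as sums over labelled graphs *)

Section LabelledSum.
Variables (K : fieldType) (charK : [pchar K] =i pred0) (C : finType).
Variables (E : comAlgType K) (w : ConnCls C -> E).

Lemma natK_neq0 n : (0 < n)%N -> n%:R != 0 :> K.
Proof. by move=> n0; rewrite (pcharf0P K).1 // -lt0n. Qed.

Definition typ n (d : gdata C n) (v : 'I_n) : Var C := (gdec d v, fert d v).
Definition owt (o : option (ConnCls C)) : E := if o is Some x then w x else 0.

Lemma Phig_monS n (d : gdata C n) : Phig d = monS (typ d) setT.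
Proof. by apply: eq_bigl => v; rewrite inE. Qed.

Lemma fert_relabel n (d : gdata C n) (p : {perm 'I_n}) v : fert (relabel d p) (p v) = fert d v.
Proof.
rewrite /fert -[RHS](card_imset _ (@perm_inj _ p)); apply: eq_card => u.
apply/idP/imsetP; rewrite ?inE.
  rewrite /relabel /gout /= ffunE => h; exists ((p^-1)%g u); last by rewrite permKV.
  rewrite inE /gout; case: (d.1 _) h => //= x /eqP[/perm_inj ->]; exact: eqxx.
by case=> u'; rewrite inE /relabel /gout /= => /eqP h ->; rewrite ffunE permK h.
Qed.
Lemma typ_relabel n (d : gdata C n) (p : {perm 'I_n}) v : typ (relabel d p) (p v) = typ d v.
Proof. by rewrite /typ fert_relabel /gdec /= ffunE permK. Qed.

Lemma clsOf_tag n (d : gdata C n) x : clsOf d = Some x ->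
  exists r : gdata C n, val x = Tagged (@gdata C) r.
Proof.
by rewrite /clsOf; case: insubP => // x' _ e [<-]; exists (canon d).
Qed.

Lemma classesP n x : x \in classes C n ->
  exists r : gdata C n, val x = Tagged (@gdata C) r.
Proof.
rewrite mem_undup mem_pmap => /mapP[d _ /esym]; exact: clsOf_tag.
Qed.
Lemma mem_classes n (d : gdata C n) x : clsOf d = Some x -> x \in classes C n.
Proof.
by move=> e; rewrite mem_undup mem_pmap; apply/mapP; exists d; rewrite ?mem_enum.
Qed.
Lemma mem_classes_val x : x \in classes C (tag (val x)).
Proof. exact/mem_classes/clsOf_val. Qed.

Lemma card_relabel_eq n (r d : gdata C n) (q : {perm 'I_n}) : relabel r q = d ->
  #|[set p : {perm 'I_n} | relabel r p == d]| = naut r.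
Proof.
move=> e; rewrite /naut -[RHS](card_imset _ (mulIg q)); apply: eq_card => p.
apply/idP/imsetP => [|[p']]; rewrite inE.
  by move/eqP => hp; exists (p * q^-1)%g; rewrite ?mulgKV // inE -relabelM hp -e relabelK.
by move=> /eqP hp ->; rewrite inE -relabelM hp e.
Qed.
Lemma naut_gt0 n (r : gdata C n) : (0 < naut r)%N.
Proof. by apply/card_gt0P; exists 1%g; rewrite inE relabel1. Qed.

(* Orbit counting: a permutation of the vertices of the representative of x with  *)
(* the prescribed types is the same as a labelled copy of x and an automorphism.  *)
Lemma card_labelled n (h : 'I_n -> Var C) x (r : gdata C n) :
  val x = Tagged (@gdata C) r ->
  (#|[set d : gdata C n | [forall v, typ d v == h v] && (clsOf d == Some x)]| * naut r)%N
  = if Phig r == monS h setT then mfact (monS h setT) else 0%N.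
Proof.
move=> hx.
have -> : (if Phig r == monS h setT then mfact (monS h setT) else 0%N) =
    (if monS h setT == Phig r then mfact (Phig r) else 0%N).
  by rewrite eq_sym; case: eqP => // ->.
rewrite Phig_monS -card_perm_match.
have -> : #|[set p : {perm 'I_n} | [forall i, h (p i) == typ r i]]| =
   #|[set p : {perm 'I_n} | [forall v, typ (relabel r p) v == h v]]|.
  apply: eq_card => p; rewrite !inE; apply/forallP/forallP => H v.
    by rewrite -[v](permKV p) typ_relabel eq_sym.
  by rewrite -(eqP (H (p v))) typ_relabel.
rewrite -[RHS]sum1_card (partition_big (relabel r)
  (fun d => d \in [set d : gdata C n | [forall v, typ d v == h v] && (clsOf d == Some x)])) /=.
  rewrite -sum_nat_const; apply: eq_bigr => d; rewrite inE (clsOf_SomeE _ hx).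
  case/andP=> hd /existsP[q /eqP hq]; rewrite -(card_relabel_eq hq) -sum1_card.
  apply: eq_bigl => p; rewrite !inE; case: eqP => [->|]; last by rewrite andbF.
  by rewrite hd.
move=> p; rewrite !inE => -> /=; rewrite (clsOf_SomeE _ hx).
by apply/existsP; exists p.
Qed.

(** With [w x] the basis element of [x] this is the image of the monomial under j^aro. Trees and
    aromas are not separated because the weight of [k] already decides which of them occur. *)
Definition class_sum (k : Mon C) : E :=
  \sum_(x <- classes C (mdeg k) | PhiC x == k) ((mfact k)%:R / (sigmaC x)%:R) *: w x.

(** By [card_labelled], a class [x] whose label multiset is [k] has [mfact k / sigmaC x] labelled
    copies with the labels prescribed by [h]. *)
Lemma labelled_sum n (h : 'I_n -> Var C) :
  \sum_(d : gdata C n | [forall v, typ d v == h v]) owt (clsOf d) = class_sum (monS h setT).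
Proof.
have deg : mdeg (monS h setT) = n by rewrite mdeg_monS cardsT card_ord.
rewrite /class_sum deg big_mkcond /= [RHS]big_mkcond /=.
transitivity (\sum_(d : gdata C n) \sum_(x <- classes C n)
   (if [forall v, typ d v == h v] && (clsOf d == Some x) then w x else 0)).
  apply: eq_bigr => d _; case: ifP => hd; last by rewrite big1.
  case e: (clsOf d) => [x|]; last by rewrite big1.
  rewrite /= (bigD1_seq x) ?undup_uniq ?(mem_classes e) //= eqxx big1 ?addr0 //.
  by move=> y ne; case: eqP => // -[exy]; rewrite exy eqxx in ne.
rewrite exchange_big big_seq [RHS]big_seq; apply: eq_bigr => x /classesP[r hr].
rewrite -big_mkcond /= (eq_bigl (fun d => d \in [set d : gdata C n |
  [forall v, typ d v == h v] && (clsOf d == Some x)])); last by move=> d; rewrite inE.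
rewrite sumr_const -scaler_nat.
have := card_labelled h hr; set N := #|_|.
have -> : PhiC x = Phig r by rewrite /PhiC hr.
have -> : sigmaC x = naut r by rewrite /sigmaC hr.
case: eqP => _ hN; last first.
  by move/eqP: hN; rewrite muln_eq0 -[naut r == _]negbK -lt0n naut_gt0 orbF => /eqP ->; rewrite scale0r.
by rewrite -hN natrM mulfK // natK_neq0 ?naut_gt0.
Qed.

Section Subsets.
Variables (n : nat) (h : 'I_n -> Var C).
(** Decorations are read off [h], so that a sum over graphs becomes a sum over edge maps alone. *)
Definition graph_of (o : {ffun 'I_n -> option 'I_n}) : gdata C n := (o, [ffun v => (h v).1]).
Definition supp_on (d : gdata C n) (S : {set 'I_n}) := rst d S == d.

Lemma supp_out (d : gdata C n) (S : {set _}) u v : supp_on d S ->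
  gout d u == Some v -> (u \in S) && (v \in S).
Proof. by move=> /eqP <-; rewrite rst_out => /and3P[-> ->]. Qed.
Lemma supp_onP (d : gdata C n) (S : {set _}) :
  (forall u v, gout d u == Some v -> (u \in S) && (v \in S)) -> supp_on d S.
Proof.
move=> H; apply/eqP/gdata_ext => // u v; rewrite rst_out.
by case e: (gout d u == Some v); rewrite ?andbF //; case/andP: (H _ _ e) => -> ->.
Qed.

(** The same count transported along the numbering of [S]; it allows disjoint subsets of one vertex
    set to carry the pieces of a graph. *)
Lemma labelled_sum_sub (S : {set 'I_n}) :
  \sum_(o : {ffun 'I_n -> option 'I_n} |
      supp_on (graph_of o) S && [forall v in S, fert (graph_of o) v == (h v).2]) owt (clsS (graph_of o) S)
  = class_sum (monS h S).
Proof.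
pose m := size (enum S); pose h' (i : 'I_m) := h (sgv i).
have -> : monS h S = monS h' setT.
  rewrite /monS -big_enum big_tnth; apply: eq_bigl => i; by rewrite inE.
rewrite -labelled_sum.
pose Phi (o : {ffun 'I_n -> option 'I_n}) : gdata C m := tagged (subg (graph_of o) S).
(* Inverse of [Phi] on the edge maps supported on [S]: a vertex outside [S] gets no edge. *)
pose Psi (d : gdata C m) : {ffun 'I_n -> option 'I_n} :=
  [ffun v => obind (fun i => omap (@sgv _ S) (gout d i)) [pick i | sgv i == v]].
have PsiE d i : Psi d (sgv i) = omap (@sgv _ S) (gout d i).
  rewrite ffunE; case: pickP => [j /eqP /sgv_inj -> //|/(_ i)]; by rewrite eqxx.
have PsiN d v : v \notin S -> Psi d v = None.
  by move=> vS; rewrite ffunE; case: pickP => // j /eqP e; rewrite -e sgv_in in vS.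
rewrite [RHS](reindex_onto Phi Psi) /=; last first.
  move=> d /forallP hd; apply: gdata_ext => [i j|i].
    rewrite subg_out /gout /= PsiE; case: (d.1 i) => //= k.
    by apply/eqP/eqP => [[/sgv_inj ->]|[->]].
  rewrite subg_dec /gdec /= ffunE.
  by have /eqP := hd i; rewrite /typ /h' => <-.
apply: eq_big => [o|o _]; last by rewrite clsS.unlock.
have -> : (Psi (Phi o) == o) = supp_on (graph_of o) S.
  apply/eqP/idP => [e|hs].
    apply: supp_onP => u v; rewrite /gout /= -e => /eqP.
    case: (boolP (u \in S)) => [/sgv_onto[i <-]|/PsiN -> //].
    by rewrite PsiE; case: (gout _ i) => //= j [<-]; rewrite sgv_in.
  apply/ffunP => u; case: (boolP (u \in S)) => [|uS].
    case/sgv_onto => i <-; rewrite PsiE.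
    case e: (o (sgv i)) => [v|].
      have := @supp_out (graph_of o) S (sgv i) v hs; rewrite /gout /= e eqxx => /(_ isT).
      case/andP => _ /sgv_onto[j hj].
      have : gout (Phi o) i == Some j by rewrite subg_out /gout /= e hj.
      by move=> /eqP -> /=; rewrite hj.
    case e' : (gout (Phi o) i) => [j|] //.
    by have := @subg_out _ _ (graph_of o) S i j; rewrite -/(Phi o) e' eqxx /gout /= e.
  rewrite PsiN //; case e: (o u) => [v|] //.
  have := @supp_out (graph_of o) S u v hs; rewrite /gout /= e eqxx => /(_ isT).
  by rewrite (negbTE uS).
rewrite andbC; case: (boolP (supp_on _ _)) => hs; rewrite ?andbF //= !andbT.
have fE i : fert (Phi o) i = fert (graph_of o) (sgv i).
  rewrite /fert -[LHS](card_imset _ (@sgv_inj _ S)); apply: eq_card => u.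
  apply/imsetP/idP => [[j]|]; rewrite !inE.
    by rewrite subg_out => hj ->.
  move=> hu; have /andP[/sgv_onto[j hj] _] := supp_out hs hu.
  by exists j => //; rewrite inE subg_out hj.
apply/forall_inP/forallP => [H i|H v /sgv_onto[i <-]].
  rewrite /typ fE /h' (eqP (H _ (sgv_in i))).
  by rewrite subg_dec /gdec /= ffunE -surjective_pairing.
by rewrite -fE -/(h' i) -(eqP (H i)).
Qed.
End Subsets.
End LabelledSum.

(** * Components, forests and attachments *)

Definition gcomp (C : finType) n (d : gdata C n) (A : {set 'I_n}) v :=
  [set w in A | connect (adj (rst d A)) v w].
HB.lock Definition pcomps (C : finType) n (d : gdata C n) (A : {set 'I_n}) :
  {set {set 'I_n}} := [set gcomp d A v | v in A].

Section Pcomps.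
Variables (C : finType) (n : nat).
Implicit Types (d : gdata C n) (A B S T : {set 'I_n}).

Lemma pcompsE d A : pcomps d A = [set gcomp d A v | v in A].
Proof. by rewrite pcomps.unlock. Qed.
Definition nocross d T A := [forall u in T, forall v in A :\: T, ~~ adj d u v].

Lemma nocrossP d T A :
  reflect (forall u v, u \in T -> v \in A -> adj d u v -> v \in T) (nocross d T A).
Proof.
apply: (iffP forall_inP) => H.
  move=> u v uT vA a; have /forall_inP /(_ v) := H u uT; rewrite inE vA andbT.
  by case: (v \in T) => // /(_ isT); rewrite a.
move=> u uT; apply/forall_inP => v; rewrite inE => /andP[vT vA]; apply/negP.
by move/(H u v uT vA); rewrite (negbTE vT).
Qed.

Lemma connect_inv (X : finType) (e : rel X) (P : pred X) :
  (forall u w, P u -> e u w -> P w) -> forall u w, connect e u w -> P u -> P w.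
Proof.
move=> H u w /connectP[s p ->]; elim: s u p => [|a s IH] u //= /andP[ea p] Pu.
exact: IH p (H _ _ Pu ea).
Qed.

(** An edgewise description of components, with no base vertex; restriction, gluing and removal of a
    component are all checked through it. *)
Lemma mem_pcomps d A T :
  (T \in pcomps d A) = [&& T \subset A, conn d T & nocross d T A].
Proof.
rewrite pcompsE; apply/imsetP/and3P => [[v vA ->]|[/subsetP sub /connP[T0 hc] /nocrossP nc]].
  have sub : gcomp d A v \subset A by apply/subsetP => w; rewrite inE => /andP[].
  have step a b : a \in gcomp d A v -> b \in A -> adj d a b -> b \in gcomp d A v.
    rewrite !inE => /andP[aA ca] bA ab; rewrite bA; apply: connect_trans ca _.
    by apply: connect1; rewrite adj_rst aA bA.
  split=> //; last by apply/nocrossP.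
  have vv : v \in gcomp d A v by rewrite inE vA connect0.
  apply/connP; split; first by apply/set0Pn; exists v.
  have cv w : w \in gcomp d A v -> connect (adj (rst d (gcomp d A v))) v w.
    have aux s a : a \in gcomp d A v -> path (adj (rst d A)) a s ->
        connect (adj (rst d (gcomp d A v))) a (last a s).
      elim: s a => [|b s IH] a aT /=; first by rewrite connect0.
      rewrite adj_rst => /andP[/and3P[aA bA ab] p].
      have bT := step _ _ aT bA ab.
      by apply: connect_trans (IH _ bT p); apply: connect1; rewrite adj_rst aT bT.
    by rewrite inE => /andP[wA /connectP[s p ->]]; apply: aux.
  by move=> u w uT wT; apply: connect_trans (cv _ wT); rewrite conn_sym cv.
case/set0Pn: T0 => v vT; exists v; first exact: sub.
apply/setP => w; rewrite inE; apply/idP/andP => [wT|[wA cw]].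
  split; first exact: sub.
  have := hc _ _ vT wT; apply: (connect_img (f := id)) => a b.
  by rewrite adj_rst => /and3P[aT bT ab]; apply: connect1; rewrite adj_rst !sub.
apply: (connect_inv (P := mem T) _ cw vT) => a b aT.
by rewrite adj_rst => /and3P[_ bA]; apply: nc.
Qed.

Lemma pcomps_eq d A T T' x : T \in pcomps d A -> T' \in pcomps d A ->
  x \in T -> x \in T' -> T = T'.
Proof.
have key v : x \in gcomp d A v -> gcomp d A v = gcomp d A x.
  rewrite inE => /andP[_ cx]; apply/setP => w; rewrite !inE.
  by rewrite (same_connect (@conn_sym _ _ _) cx).
by rewrite pcompsE => /imsetP[v _ ->] /imsetP[v' _ ->] /key -> /key ->.
Qed.

Lemma pcomps_cover d A v : v \in A -> exists2 T, T \in pcomps d A & v \in T.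
Proof.
by move=> vA; exists (gcomp d A v); rewrite ?pcompsE; [apply: imset_f | rewrite inE vA connect0].
Qed.

Lemma pcomps_n0 d A T : T \in pcomps d A -> T != set0.
Proof. by rewrite mem_pcomps => /and3P[_ /connP[]]. Qed.

Lemma pcomps_sub d A T : T \in pcomps d A -> T \subset A.
Proof. by rewrite mem_pcomps => /and3P[]. Qed.

Lemma pcompsD d A S : S \in pcomps d A -> pcomps d (A :\: S) = pcomps d A :\ S.
Proof.
move=> hS; apply/setP => T; rewrite in_setD1.
have /and3P[/subsetP subS cS /nocrossP ncS] : [&& S \subset A, conn d S & nocross d S A].
  by rewrite -mem_pcomps.
apply/idP/andP => [hT|[ne hT]].
  have := hT; rewrite mem_pcomps => /and3P[/subsetP subT cT /nocrossP ncT].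
  have T0 := pcomps_n0 hT; split.
    by apply: contraNneq T0 => e; apply/eqP/setP => x; rewrite inE; apply/negbTE/negP => xT;
       have := subT x xT; rewrite inE -e xT.
  rewrite mem_pcomps cT; apply/and3P; split=> //.
    by apply/subsetP => x /subT; rewrite inE => /andP[].
  apply/nocrossP => u v uT vA uv; case: (boolP (v \in S)) => vS; last first.
    by apply: ncT uv => //; rewrite inE vS.
  have := subT u uT; rewrite inE => /andP[]; rewrite (ncS v u) 1?adj_sym //.
  by have := subT u uT; rewrite inE => /andP[].
have dis x : x \in T -> x \notin S.
  by move=> xT; apply: contra ne => xS; apply/eqP; apply: pcomps_eq hT hS xT xS.
move: hT; rewrite !mem_pcomps => /and3P[/subsetP subT cT /nocrossP ncT].
rewrite cT; apply/and3P; split=> //.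
  by apply/subsetP => x xT; rewrite inE dis ?subT.
by apply/nocrossP => u v uT; rewrite inE => /andP[_ vA]; apply: ncT.
Qed.

Lemma pcomps_rst d A B : A \subset B -> pcomps (rst d B) A = pcomps d A.
Proof.
by move=> /setIidPl sub; rewrite !pcompsE; apply: eq_imset => v; apply/setP=> w; rewrite !inE rst_rst sub.
Qed.

Lemma pcomps0 d : pcomps d set0 = set0.
Proof. by rewrite pcompsE imset0. Qed.

(** A root is relative to [T]: its edge in [d] may leave [T]. This is the situation of a tree that
    is about to be cut off. *)
Definition rooted d T := [exists v in T, gout (rst d T) v == None].
Definition forest d A := [forall T in pcomps d A, rooted d T].

Lemma rooted_rst d T B : T \subset B -> rooted (rst d B) T = rooted d T.
Proof. by move=> /setIidPl sub; rewrite /rooted rst_rst sub. Qed.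
Lemma forest_rst d A B : A \subset B -> forest (rst d B) A = forest d A.
Proof.
move=> sub; rewrite /forest pcomps_rst //; apply: eq_forallb => T.
apply: implyb_id2l => /pcomps_sub hT; apply: rooted_rst; exact: subset_trans sub.
Qed.
Lemma forestD d A S : S \in pcomps d A ->
  forest d A = rooted d S && forest d (A :\: S).
Proof.
move=> hS; rewrite /forest pcompsD //; apply/forall_inP/andP => [H|[hr /forall_inP H] T hT].
  by split; [apply: H | apply/forall_inP => T; rewrite inE => /andP[_]; apply: H].
by case: (eqVneq T S) => [->//|ne]; apply: H; rewrite !inE ne.
Qed.

End Pcomps.

(** * Splitting a tree off a forest *)

Section Weight.
Variables (K : fieldType) (C : finType) (E : comAlgType K) (w : ConnCls C -> E) (n : nat).
Implicit Types (d : gdata C n) (A B S T : {set 'I_n}).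
Definition pcomps_wt d A : E := \prod_(T in pcomps d A) owt w (clsS d T).

Lemma pcomps_wtD d A S : S \in pcomps d A -> pcomps_wt d A = owt w (clsS d S) * pcomps_wt d (A :\: S).
Proof. by move=> hS; rewrite /pcomps_wt (big_setD1 _ hS) pcompsD. Qed.
Lemma pcomps_wt_rst d A B : A \subset B -> pcomps_wt (rst d B) A = pcomps_wt d A.
Proof.
move=> sub; rewrite /pcomps_wt pcomps_rst //; apply: eq_bigr => T /pcomps_sub hT.
rewrite clsS_rst //; exact: subset_trans sub.
Qed.
Lemma pcomps_wt0 d : pcomps_wt d set0 = 1.
Proof. by rewrite /pcomps_wt pcomps0 big_set0. Qed.

Section Glue.
Variable h : 'I_n -> Var C.
Local Notation outT := {ffun 'I_n -> option 'I_n}.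
Local Notation graph_of := (graph_of h).
Implicit Types (o : outT).

Definition restr o A : outT := (rst (graph_of o) A).1.
Lemma rst_graph_of o A : rst (graph_of o) A = graph_of (restr o A). Proof. by []. Qed.
(** The priority of [o1] is immaterial for the pairs that count: they have no common source of
    edges. *)
Definition glue o1 o2 : outT := [ffun v => if o1 v is Some x then Some x else o2 v].

Lemma graph_of_inj : injective graph_of. Proof. by move=> o o' []. Qed.
Lemma graph_of_ext o o' :
  (forall u v, (gout (graph_of o) u == Some v) = (gout (graph_of o') u == Some v)) -> o = o'.
Proof. by move=> H; apply/graph_of_inj/gdata_ext. Qed.

Lemma glue_out o1 o2 A B u v : supp_on (graph_of o1) A -> supp_on (graph_of o2) B -> [disjoint A & B] ->
  (gout (graph_of (glue o1 o2)) u == Some v) = (gout (graph_of o1) u == Some v) || (gout (graph_of o2) u == Some v).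
Proof.
move=> s1 s2 dis; rewrite /gout /= ffunE.
case e1: (o1 u) => [x|] //.
have := @supp_out _ _ (graph_of o1) A u x s1; rewrite /gout /= e1 eqxx => /(_ isT) /andP[uA _].
case e2: (o2 u) => [y|]; last by rewrite orbF.
have := @supp_out _ _ (graph_of o2) B u y s2; rewrite /gout /= e2 eqxx => /(_ isT) /andP[uB _].
by move/pred0P: dis => /(_ u) /=; rewrite uA uB.
Qed.

Definition fertok o A := [forall v in A, fert (graph_of o) v == (h v).2].
Definition is_forest_on t A o := [&& supp_on (graph_of o) A, fertok o A, forest (graph_of o) A & #|pcomps (graph_of o) A| == t].
Definition is_tree_on T o := [&& supp_on (graph_of o) T, fertok o T, conn (graph_of o) T & rooted (graph_of o) T].
Definition forest_sum t A : E := \sum_(o | is_forest_on t A o) pcomps_wt (graph_of o) A.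
Definition tree_sum T : E := \sum_(o | is_tree_on T o) owt w (clsS (graph_of o) T).

Lemma fert_rst (d : gdata C n) A B v : v \in B -> supp_on d A -> B \subset A ->
  (forall u, u \in A -> gout d u == Some v -> u \in B) -> fert (rst d B) v = fert d v.
Proof.
move=> vB sA sub H; apply: eq_card => u; rewrite !inE rst_out vB /=.
case e: (gout d u == Some v); rewrite ?andbF // andbT.
by apply: H => //; have /andP[] := supp_out sA e.
Qed.

Lemma supp_rst (d : gdata C n) A : supp_on (rst d A) A.
Proof. by rewrite /supp_on rst_rst setIid. Qed.

Section Split.
Variables (A T : {set 'I_n}).
Hypothesis sub : T \subset A.
Let splt o := (restr o T, restr o (A :\: T)).
Let dis : [disjoint T & A :\: T].
Proof. by apply/pred0P => x /=; rewrite inE; case: (x \in T). Qed.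

Lemma splt_glue o1 o2 : supp_on (graph_of o1) T -> supp_on (graph_of o2) (A :\: T) ->
  [/\ splt (glue o1 o2) = (o1, o2), supp_on (graph_of (glue o1 o2)) A &
      nocross (graph_of (glue o1 o2)) T A].
Proof.
move=> s1 s2; have g u v := @glue_out _ _ _ _ u v s1 s2 dis.
have in1 u v : gout (graph_of o1) u == Some v -> (u \in T) && (v \in T) by apply: supp_out.
have in2 u v : gout (graph_of o2) u == Some v -> (u \in A :\: T) && (v \in A :\: T) by apply: supp_out.
split.
- congr pair; apply: graph_of_ext => u v; rewrite -rst_graph_of rst_out g.
    apply/and3P/idP => [[uT vT /orP[//|/in2]]|h1]; first by rewrite !inE uT.
    by case/andP: (in1 _ _ h1) => -> ->; rewrite h1.
  apply/and3P/idP => [[uT vT /orP[/in1|//]]|h1].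
    by move: uT; rewrite inE => /andP[/negbTE ->].
  by case/andP: (in2 _ _ h1) => -> ->; rewrite h1 orbT.
- apply: supp_onP => u v; rewrite g => /orP[/in1|/in2] /andP[].
    by move=> uT vT; rewrite !(subsetP sub).
  by rewrite !inE => /andP[_ ->] /andP[_ ->].
apply/nocrossP => u v uT vA; rewrite /adj !g => /orP[] /orP[] h1.
- by case/andP: (in1 _ _ h1).
- by case/andP: (in2 _ _ h1); rewrite inE uT.
- by case/andP: (in1 _ _ h1).
by case/andP: (in2 _ _ h1) => _; rewrite inE uT.
Qed.

(** Without edges between [T] and the rest of [A], fertilities, components and roots on either side
    are those of the two restrictions. *)
Lemma splt_ok t o : supp_on (graph_of o) A -> nocross (graph_of o) T A ->
  (is_forest_on t.+1 A o && (T \in pcomps (graph_of o) A)) =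
  (is_tree_on T (restr o T) && is_forest_on t (A :\: T) (restr o (A :\: T))).
Proof.
move=> sA nc; rewrite /is_forest_on /is_tree_on sA -!rst_graph_of !supp_rst mem_pcomps sub nc /=.
rewrite conn_rst // rooted_rst // forest_rst // pcomps_rst // andbT.
case: (boolP (conn (graph_of o) T)) => cT; last by rewrite !andbF.
have hT : T \in pcomps (graph_of o) A by rewrite mem_pcomps sub cT.
rewrite (forestD hT) pcompsD // (cardsD1 T) hT add1n eqSS.
have subD : A :\: T \subset A by apply: subsetDl.
have -> : fertok o A = fertok (restr o T) T && fertok (restr o (A :\: T)) (A :\: T).
  move/nocrossP: nc => nc.
  have f1 v : v \in T -> fert (graph_of (restr o T)) v = fert (graph_of o) v.
    move=> vT; rewrite -rst_graph_of (@fert_rst _ A) // => u uA e.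
    by apply: (nc v) => //; rewrite /adj e orbT.
  have f2 v : v \in A :\: T -> fert (graph_of (restr o (A :\: T))) v = fert (graph_of o) v.
    move=> vT; rewrite -rst_graph_of (@fert_rst _ A) // => u uA e; rewrite inE uA andbT.
    move: vT; rewrite inE => /andP[vT vA]; apply: contra vT => uT.
    by apply: (nc u) => //; rewrite /adj e.
  apply/forall_inP/andP => [H|[/forall_inP H1 /forall_inP H2] v vA].
    split; apply/forall_inP => v hv; rewrite ?f1 ?f2 // H //.
      exact: (subsetP sub).
    exact: (subsetP subD).
  case: (boolP (v \in T)) => vT; first by rewrite -f1 // H1.
  by rewrite -f2 ?H2 // inE vT.
by rewrite -!andbA; do !bool_congr.
Qed.

(** Forests having [T] as a component are pairs of a tree on [T] and a forest on the rest, and the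
    weight is multiplicative. *)
Lemma sum_splt t :
  \sum_(o | is_forest_on t.+1 A o && (T \in pcomps (graph_of o) A)) pcomps_wt (graph_of o) A = tree_sum T * forest_sum t (A :\: T).
Proof.
rewrite /tree_sum /forest_sum big_distrlr /= pair_big_dep /=.
rewrite (reindex_onto (fun p : outT * outT => glue p.1 p.2) splt) /=; last first.
  move=> o /andP[/and4P[sA _ _ _]]; rewrite mem_pcomps => /and3P[_ _ /nocrossP nc].
  apply: graph_of_ext => u v; rewrite (@glue_out _ _ T (A :\: T)) ?supp_rst //.
  rewrite -!rst_graph_of !rst_out !inE; case e: (_ == _); rewrite ?andbF // !andbT.
  have /andP[uA vA] := supp_out sA e; rewrite uA vA !andbT.
  case: (boolP (u \in T)) => uT /=; first by rewrite (nc u) // /adj e.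
  by apply/negP => vT; move: uT; rewrite (nc v) // /adj e orbT.
apply: eq_big => -[o1 o2] /=.
  apply/idP/idP => [/andP[hP /eqP e]|].
    have [/and4P[sA _ _ _]] := andP hP; rewrite mem_pcomps => /and3P[_ _ nc].
    by move: hP; rewrite (splt_ok _ sA nc); case: e => -> ->.
  case/andP => h1 h2; have s1 : supp_on (graph_of o1) T by case/and4P: h1.
  have s2 : supp_on (graph_of o2) (A :\: T) by case/and4P: h2.
  have [e sA nc] := splt_glue s1 s2; rewrite (splt_ok _ sA nc) e eqxx andbT.
  by case: e => -> ->; rewrite h1 h2.
case/andP => /andP[_ hT] /eqP[]; move: (glue o1 o2) hT => o hT <- <-.
by rewrite (pcomps_wtD hT) -!rst_graph_of clsS_rst // pcomps_wt_rst // subsetDl.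
Qed.
End Split.

(** Double counting of the pairs formed by a forest and one of its [t.+1] components. *)
Lemma forest_sum_rec t A : forest_sum t.+1 A *+ t.+1 = \sum_(T : {set 'I_n} | T \subset A) tree_sum T * forest_sum t (A :\: T).
Proof.
rewrite /forest_sum -sumrMnl; transitivity (\sum_(o | is_forest_on t.+1 A o)
    \sum_(T : {set 'I_n} | T \in pcomps (graph_of o) A) pcomps_wt (graph_of o) A).
  by apply: eq_bigr => o /and4P[_ _ _ /eqP e]; rewrite sumr_const e.
rewrite (exchange_big_dep (fun T : {set 'I_n} => T \subset A)) /=; last first.
  by move=> o T _ /pcomps_sub.
by apply: eq_bigr => T sub; rewrite -(sum_splt sub).
Qed.

Lemma forest_sum_0 A : forest_sum 0 A = if A == set0 then 1 else 0.
Proof.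
rewrite /forest_sum; case: eqP => [->|A0]; last first.
  rewrite big1 // => o /and4P[_ _ _]; rewrite cards_eq0 => /eqP h0.
  case: A0; apply/setP => x; rewrite inE; apply/negbTE/negP => /(pcomps_cover (graph_of o))[T].
  by rewrite h0 inE.
rewrite (big_pred1 [ffun _ => None]) ?pcomps_wt0 // => o; rewrite /= /is_forest_on pcomps0 cards0 eqxx andbT.
have -> : forest (graph_of o) set0 by apply/forall_inP => T; rewrite pcomps0 inE.
have -> : fertok o set0 by apply/forall_inP => T; rewrite inE.
rewrite !andbT; apply/idP/eqP => [s|->].
  have z u v : (gout (graph_of [ffun => None]) u == Some v) = false by rewrite /gout /= ffunE.
  by apply: graph_of_ext => u v; rewrite z; apply/negbTE/negP => /(supp_out s); rewrite inE.
by apply: supp_onP => u v; rewrite /gout /= ffunE.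
Qed.
End Glue.
End Weight.

(** * Powers of the transpose derivation as attachments of roots *)

Section Dbar.
Variables (K : fieldType) (C : finType) (V : lmodType K) (g : Mon C -> V).

HB.instance Definition _ := GRing.Linear.copy (@dbar K C) (linext (@dbar_m K C)).

(** Used with [g] a class sum, it is the image under j^aro, up to the choice of weight, of a power
    of [dbar] on a monomial. *)
Definition dbar_ext t (k : Mon C) : V := linext g (iter t (@dbar K C) << k >>).

Lemma iter_dbar_linear t : linear (fun x => linext g (iter t (@dbar K C) x)).
Proof.
move=> a x y; elim: t x y => [|t IH] x y; first by rewrite /= linearP.
by rewrite !iterSr linearP IH.
Qed.

Lemma dbar_extS t k : dbar_ext t.+1 k = \sum_(i <- finsupp k | (0 < i.2)%N)
   dbar_ext t (mulcm (divcm k (ucm i)) (ucm ((i.1, i.2.-1) : Var C))) *+ k i.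
Proof.
pose f : {linear {malg K[Mon C]} -> V} := HB.pack (fun x => linext g (iter t (@dbar K C) x))
  (GRing.isLinear.Build _ _ _ _ _ (iter_dbar_linear t)).
rewrite /dbar_ext iterSr; have -> : dbar << k >> = @dbar_m K C k by exact: linextU.
rewrite -[LHS]/(f _) linear_sum; apply: eq_bigr => i _.
by rewrite linearZ /= scaler_nat.
Qed.

(** Prescribes one incoming edge less at [x]. The truncated predecessor at fertility 0 is harmless:
    the sums below require [0 < (h x).2]. *)
Definition decr_fert n (h : 'I_n -> Var C) x : 'I_n -> Var C :=
  fun v => if v == x then ((h v).1, (h v).2.-1) else h v.

Lemma monS_decr n (h : 'I_n -> Var C) (B : {set 'I_n}) x : x \in B ->
  monS (decr_fert h x) B =
  mulcm (divcm (monS h B) (ucm (h x))) (ucm (((h x).1, (h x).2.-1) : Var C)).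
Proof.
move=> xB; rewrite (monSD1 _ xB) [in RHS](monSD1 _ xB) mulmC /decr_fert eqxx.
have -> : monS (fun v => if v == x then ((h v).1, (h v).2.-1) else h v) (B :\ x) = monS h (B :\ x).
  by apply: eq_monS => v; rewrite !inE => /andP[/negbTE ->].
apply/eqP/cmP => i; rewrite mulcmE divcmE !cmM; congr (_ + _)%N.
by rewrite addKn.
Qed.

(** An exponent counts the vertices with that label, so one [dbar] is the choice of a vertex of [B]
    that loses an incoming edge. The encoded index of a variable is the fertility, and the condition
    that the true index be non-negative says that it is positive. *)
Lemma dbar_extS_monS n (h : 'I_n -> Var C) (B : {set 'I_n}) t :
  dbar_ext t.+1 (monS h B) = \sum_(x in B | (0 < (h x).2)%N) dbar_ext t (monS (decr_fert h x) B).
Proof.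
rewrite dbar_extS big_mkcond /=.
pose f (i : Var C) := if (0 < i.2)%N then
   dbar_ext t (mulcm (divcm (monS h B) (ucm i)) (ucm ((i.1, i.2.-1) : Var C))) else 0.
transitivity (\sum_(i <- finsupp (monS h B)) f i *+ monS h B i).
  by apply: eq_bigr => i _; rewrite /f; case: ifP; rewrite ?mul0rn.
rewrite -sum_monS [RHS]big_mkcondr /=; apply: eq_bigr => x xB.
by rewrite /f monS_decr.
Qed.
End Dbar.

Section Attach.
Variables (K : fieldType) (charK : [pchar K] =i pred0) (C : finType).
Variables (E : comAlgType K) (w : ConnCls C -> E) (n : nat).
Local Notation outT := {ffun 'I_n -> option 'I_n}.
Implicit Types (h : 'I_n -> Var C) (A B R : {set 'I_n}) (o : outT).

(** All edges end in [B] and start in [R] or [B]. The prescribed fertilities on [B] count the edges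
    coming from [R] as well. *)
Definition attach R B h o := [&& [forall u in R, o u != None],
  [forall u, if o u is Some v then (u \in R :|: B) && (v \in B) else true],
  fertok h o B & conn (graph_of h o) B].

Definition upd o r x : outT := [ffun v => if v == r then x else o v].

Lemma graph_of_decr h x o : graph_of (decr_fert h x) o = graph_of h o.
Proof. by congr pair; apply/ffunP => v; rewrite !ffunE /decr_fert; case: eqP. Qed.

(** Removing the edge from [r] to [x] leaves an attachment of the other roots in which [x] expects
    one incoming edge less. This is the step that matches one application of [dbar]. *)
Lemma attach_upd R B h o r x : r \in R -> [disjoint R & B] -> x \in B ->
  attach R B h (upd o r (Some x)) && (upd (upd o r (Some x)) r None == o) =
  (0 < (h x).2)%N && attach (R :\ r) B (decr_fert h x) o.
Proof.
move=> rR dis xB; have rB : r \notin B.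
  by apply/negP => rB; move/pred0P: dis => /(_ r) /=; rewrite rR rB.
have -> : (upd (upd o r (Some x)) r None == o) = (o r == None).
  apply/eqP/eqP => [<-|e]; first by rewrite !ffunE eqxx.
  by apply/ffunP => v; rewrite !ffunE; case: eqP => // ->.
case: (eqVneq (o r) None) => er; last first.
  rewrite andbF; apply/esym/negbTE; rewrite negb_and; apply/orP; right.
  apply/negP => /and4P[_ /forallP /(_ r)]; case: (o r) er => // y _.
  by rewrite !inE eqxx (negbTE rB).
rewrite andbT /attach.
have -> : [forall u in R, upd o r (Some x) u != None] = [forall u in R :\ r, o u != None].
  apply/forall_inP/forall_inP => H u.
    by rewrite inE => /andP[ne uR]; have := H u uR; rewrite ffunE; move: ne; rewrite inE => /negbTE ->.
  by move=> uR; rewrite ffunE; case: (eqVneq u r) => // ne; apply: (H u); rewrite !inE ne.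
have -> : [forall u, if upd o r (Some x) u is Some v then (u \in R :|: B) && (v \in B) else true]
   = [forall u, if o u is Some v then (u \in R :\ r :|: B) && (v \in B) else true].
  apply: eq_forallb => u; rewrite ffunE !inE; case: (eqVneq u r) => [->|//].
  by rewrite er rR xB.
have -> : conn (graph_of h (upd o r (Some x))) B = conn (graph_of (decr_fert h x) o) B.
  have e : rst (graph_of h (upd o r (Some x))) B = rst (graph_of h o) B.
    apply: gdata_ext => // u v; rewrite !rst_out /gout /= /upd ffunE.
    by case: (eqVneq u r) => // ->; rewrite (negbTE rB).
  by rewrite graph_of_decr /conn e.
have f v : fert (graph_of h (upd o r (Some x))) v = (fert (graph_of h o) v + (v == x))%N.
  rewrite /fert (cardsD1 r) addnC; congr (_ + _)%N; last first.
    by rewrite inE /gout /= ffunE eqxx; congr nat_of_bool; apply/eqP/eqP => [[]|->].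
  apply: eq_card => u; rewrite !inE /gout /= ffunE; case: (eqVneq u r) => //= ->.
  by rewrite er.
have -> : fertok h (upd o r (Some x)) B = (0 < (h x).2)%N && fertok (decr_fert h x) o B.
  apply/forall_inP/andP => [H|[h0 /forall_inP H] v vB].
    split; first by rewrite -(eqP (H x xB)) f eqxx addn1.
    apply/forall_inP => v vB; rewrite graph_of_decr /decr_fert; have := H v vB; rewrite f.
    by case: (eqVneq v x) => [->|_]; rewrite ?addn0 // addn1 => /eqP <-.
  have := H v vB; rewrite graph_of_decr /decr_fert f; case: (eqVneq v x) => [->|_]; rewrite ?addn0 // addn1.
  by move=> /eqP /= ->; rewrite prednK.
by case: (0 < (h x).2)%N => //=; rewrite !andbF.
Qed.

(** Connectedness may be required at no cost, since the other graphs have weight zero. *)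
Lemma labelled_sum_conn h B :
  \sum_(o : outT | [&& supp_on (graph_of h o) B, fertok h o B & conn (graph_of h o) B])
     owt w (clsS (graph_of h o) B) = class_sum w (monS h B).
Proof.
rewrite -labelled_sum_sub // [RHS]big_mkcond [LHS]big_mkcond; apply: eq_bigr => o _.
rewrite andbA; case: (boolP (conn _ _)) => [|/clsS_None ->]; rewrite ?andbT //.
by rewrite andbF /=; case: ifP.
Qed.

(** Induction on the number of roots: the choice of a target for one of them accounts for one
    [dbar]. *)
Lemma attach_sum R B h : [disjoint R & B] ->
  \sum_(o : outT | attach R B h o) owt w (clsS (graph_of h o) B) = dbar_ext (class_sum w) #|R| (monS h B).
Proof.
elim: {R}#|R| {-2}R (erefl #|R|) h => [|t IH] R.
  move/eqP; rewrite cards_eq0 => /eqP -> h _.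
  rewrite cards0 /dbar_ext /= linextU -labelled_sum_conn; apply: eq_bigl => o.
  rewrite /attach andbA; congr (_ && _).
  have -> : [forall u in set0, o u != None] by apply/forall_inP => u; rewrite inE.
  rewrite /=; apply/forallP/idP => [H|s u].
    by apply: supp_onP => u v; rewrite /gout /=; have := H u; rewrite set0U; case: (o u) => // y hy /eqP[<-].
  case e: (o u) => [v|] //; rewrite set0U; apply: (supp_out s).
  by rewrite /gout /= e.
move=> hR h dis; have [r rR] : exists r, r \in R by apply/set0Pn; rewrite -card_gt0 hR.
have hR1 : #|R :\ r| = t by apply/eqP; rewrite -eqSS -hR (cardsD1 r R) rR.
have dis1 : [disjoint R :\ r & B].
  by apply: disjointWl dis; apply: subD1set.
(* Sort by the target [x] of [r]; the default value never occurs because every vertex of [R] has an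
   edge. *)
rewrite hR dbar_extS_monS (partition_big (fun o => odflt r (o r)) (fun x => x \in B)) /=; last first.
  move=> o /and4P[/forall_inP /(_ r rR) + /forallP /(_ r)].
  by case: (o r) => //= y _ /andP[].
rewrite [RHS]big_mkcondr /=; apply: eq_bigr => x xB.
have rB : r != x by apply/eqP => e; move/pred0P: dis => /(_ r) /=; rewrite rR e xB.
rewrite (reindex_onto (fun o => upd o r (Some x)) (fun o => upd o r None)) /=; last first.
  move=> o /andP[/and4P[/forall_inP /(_ r rR) er _ _ _] /eqP e].
  apply/ffunP => v; rewrite !ffunE; case: eqP => // ->.
  by case: (o r) er e => //= y _ ->.
rewrite (eq_bigl (fun o => (0 < (h x).2)%N && attach (R :\ r) B (decr_fert h x) o)); last first.
  by move=> o; rewrite -attach_upd // ffunE eqxx /= eqxx andbT.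
case: ifP => h0; last by rewrite big_pred0.
rewrite -[in RHS]hR1 -(IH _ hR1) //; apply: eq_bigr => o _; rewrite graph_of_decr; congr (owt w _).
apply: clsS_eq => // u v uB vB; rewrite /gout /= ffunE; case: (eqVneq u r) => // e.
by move/pred0P: dis => /(_ r) /=; rewrite rR -e uB.
Qed.
End Attach.

(** * Cuts as sets closed under following edges *)

Section Fc.
Variables (C : finType) (n : nat).
Implicit Types (d : gdata C n) (A B T : {set 'I_n}).

Definition erel d : rel 'I_n := fun u v => gout d u == Some v.
Definition fwd_closed d B := [forall u in B, if gout d u is Some v then v \in B else true].
Definition groots d A := [set v in A | gout d v == None].

Lemma fwd_closedP d B : reflect (forall u v, u \in B -> gout d u == Some v -> v \in B) (fwd_closed d B).
Proof.
apply: (iffP forall_inP) => H u; first by move=> v uB /eqP e; have := H u uB; rewrite e.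
by move=> uB; case e: (gout d u) => [v|] //; apply: (H u) => //; rewrite e.
Qed.

Lemma fwd_closed_connect d B u v : fwd_closed d B -> u \in B -> connect (erel d) u v -> v \in B.
Proof.
move=> /fwd_closedP f uB c; apply: (connect_inv (P := mem B) _ c uB) => a b aB; exact: f.
Qed.

Lemma connect_step (T : finType) (e : rel T) a x :
  connect e a x -> a = x \/ exists2 b, e a b & connect e b x.
Proof.
case/connectP => -[|b s] /=; first by left.
by case/andP => ab p ->; right; exists b => //; apply/connectP; exists s.
Qed.

Lemma conn_ind d T (P : 'I_n -> Prop) : conn d T ->
  (forall a b, a \in T -> b \in T -> gout d a == Some b -> P a <-> P b) ->
  {in T &, forall u v, P u -> P v}.
Proof.
move=> /connP[_ c] H u v uT vT Pu; case/connectP: (c u v uT vT) => s.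
elim: s u uT Pu => [|b s IH] u uT Pu /=; first by move=> _ ->.
rewrite adj_rst => /andP[/and3P[_ bT /orP ab] p] e; apply: (IH b) => //.
by case: ab => ab; apply/(H _ _ _ _ ab).
Qed.

(** Reaching the root [u] along edges is invariant under adjacency, as each vertex has at most one
    outgoing edge. So [v] reaches [u], but [v] has no edge to leave by. *)
Lemma conn_root_uniq d T u v : conn d T -> u \in T -> v \in T ->
  gout (rst d T) u = None -> gout (rst d T) v = None -> u = v.
Proof.
move=> c uT vT hu hv.
suff: connect (erel (rst d T)) v u.
  by move/connect_step => [//|[b]]; rewrite /erel hv.
apply: (conn_ind (P := fun x => connect (erel (rst d T)) x u) c _ uT vT); last exact: connect0.
move=> a b aT bT ab; split=> [/connect_step[ea|[b' ab' cb]]|cb].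
- by move: ab; have := rst_out d T a b; rewrite aT bT /= ea hu => <-.
- move: ab'; rewrite /erel rst_out => /and3P[_ _ ab']; move: ab; rewrite (eqP ab').
  by move=> /eqP[<-].
by apply: connect_trans cb; apply: connect1; rewrite /erel rst_out aT bT.
Qed.

(** Sending a root to its component is a bijection, since a component has only one root. *)
Lemma card_roots d A : supp_on d A -> forest d A -> #|groots d A| = #|pcomps d A|.
Proof.
move=> s /forall_inP f.
have e1 T v : T \in pcomps d A -> v \in T -> (gout (rst d T) v == None) = (gout d v == None).
  rewrite mem_pcomps => /and3P[_ _ /nocrossP nc] vT.
  case e: (gout d v) => [x|].
    have xT : x \in T.
      have /andP[_ xA] : (v \in A) && (x \in A) by apply: (supp_out s); rewrite e.
      by apply: (nc v) => //; rewrite /adj e eqxx.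
    by have := rst_out d T v x; rewrite vT xT e eqxx => /eqP ->.
  case e': (gout (rst d T) v) => [x|] //.
  by have := rst_out d T v x; rewrite e' eqxx e andbF andbF.
have <- : gcomp d A @: groots d A = pcomps d A.
  apply/setP => T; apply/imsetP/idP => [[v]|hT].
    by rewrite inE => /andP[vA _] ->; rewrite pcompsE; apply: imset_f.
  have /existsP[v /andP[vT]] := f T hT; rewrite (e1 T) // => hv.
  have vA := subsetP (pcomps_sub hT) v vT.
  exists v; first by rewrite inE vA.
  apply: (pcomps_eq (x := v) hT _ vT); first by rewrite pcompsE; apply: imset_f.
  by rewrite inE vA connect0.
rewrite card_in_imset // => u v; rewrite !inE => /andP[uA hu] /andP[vA hv] e.
have hT : gcomp d A u \in pcomps d A by rewrite pcompsE; apply: imset_f.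
have uT : u \in gcomp d A u by rewrite inE uA connect0.
have vT : v \in gcomp d A u by rewrite e inE vA connect0.
have c : conn d (gcomp d A u) by move: hT; rewrite mem_pcomps => /and3P[].
by apply: (conn_root_uniq c uT vT); apply/eqP; rewrite e1.
Qed.

Section ConnFc.
Variables (d : gdata C n) (B : {set 'I_n}).
Hypotheses (B0 : B != set0) (f : fwd_closed d B).

(** Reaching [B] is invariant under adjacency: a path from the source of an edge to [B] either
    starts in [B], and closure applies, or begins with that edge. *)
Lemma fwd_closed_reach : gconnected d -> forall v, exists2 b, b \in B & connect (erel d) v b.
Proof.
rewrite -conn_setT => c v; have /set0Pn[b0 b0B] := B0.
apply: (conn_ind (P := fun v => exists2 b, b \in B & connect (erel d) v b) c _ (in_setT b0) (in_setT v)).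
  move=> a x _ _ ax; split=> -[b bB cb]; last first.
    by exists b => //; apply: connect_trans cb; apply: connect1.
  case/connect_step: cb => [e|[x' ax' cb]].
    by exists x; rewrite ?connect0 //; apply: (fwd_closedP _ _ f a); rewrite // e.
  by exists b => //; move: ax' ax; rewrite /erel => /eqP -> /eqP[<-].
by exists b0 => //; apply: connect0.
Qed.

(** Send a vertex to the first vertex of [B] on its forward path. Adjacent vertices go to equal or
    adjacent ones, so a walk in [d] becomes a walk inside [B]. *)
Lemma fwd_closed_conn : gconnected d -> conn d B.
Proof.
rewrite -conn_setT => c; apply/connP; split=> // b v bB vB.
(* Following [e] stops at the first entry into [B]. *)
pose e : rel 'I_n := fun u x => (u \notin B) && (gout d u == Some x).
pose P x := exists2 b', b' \in B & connect e x b' /\ connect (adj (rst d B)) b b'.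
have eB x y : x \in B -> connect e x y -> x = y.
  by move=> xB /connect_step[//|[z]]; rewrite /e xB.
have [b' b'B [/(eB _ _ vB) -> //]] : P v.
apply: (conn_ind (P := P) c _ (in_setT b) (in_setT v)); last first.
  by exists b => //; split; apply: connect0.
move=> a x _ _ ax; case: (boolP (a \in B)) => aB.
  have xB : x \in B by apply: (fwd_closedP _ _ f a).
  have ad : adj (rst d B) a x by rewrite adj_rst aB xB /adj ax.
  split=> -[y yB [/eB <- // cy]].
    by exists x => //; split; [apply: connect0 | apply: connect_trans cy (connect1 _)].
  exists a => //; split; first exact: connect0.
  by apply: connect_trans cy (connect1 _); rewrite adj_sym.
have ex : e a x by rewrite /e aB.
split=> -[y yB [cx cy]]; exists y => //; split=> //; last first.
  exact: connect_trans (connect1 ex) cx.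
case/connect_step: cx => [ay|[z /andP[_ /eqP az] cz]]; first by rewrite ay yB in aB.
by move: ax; rewrite az => /eqP[<-].
Qed.

(** A component of the complement without a root would keep every forward path inside itself, yet
    these paths reach [B]. *)
Lemma fwd_closed_forest : gconnected d -> forest d (~: B).
Proof.
move=> c; apply/forall_inP => T hT; apply: contraT => /existsPn nr.
have /set0Pn[v vT] := pcomps_n0 hT; have [b bB cb] := fwd_closed_reach c v.
have hTB := subsetP (pcomps_sub hT).
have : b \in T.
  apply: (connect_inv (P := mem T) _ cb vT) => a x aT ax.
  have := nr a; rewrite (aT : a \in T) /=; case e: (gout (rst d T) a) => [y|] // _.
  have := rst_out d T a y; rewrite e eqxx => /esym/and3P[_ tree_sum ay].
  by move: ax; rewrite /erel (eqP ay) => /eqP[<-].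
by move/hTB; rewrite inE bB.
Qed.

Lemma fwd_closed_noroot : gconnected d -> forall v, v \notin B -> gout d v != None.
Proof.
move=> c v vB; have [b bB /connect_step[e|[x]]] := fwd_closed_reach c v.
  by rewrite e bB in vB.
by rewrite /erel => /eqP ->.
Qed.

(** The edge out of the root of a tree ends neither in that tree nor in another component of the
    complement, hence in [B]. *)
Lemma fwd_closed_gconnected : conn d B -> forest d (~: B) ->
  (forall v, v \notin B -> gout d v != None) -> gconnected d.
Proof.
move=> /connP[_ cB] /forall_inP fo nr; rewrite -conn_setT; apply/connP.
have /set0Pn[b0 b0B] := B0.
split; first by apply/set0Pn; exists b0; rewrite inE.
have lift T : forall u v, connect (adj (rst d T)) u v -> connect (adj (rst d setT)) u v.
  apply: (connect_img (f := id)) => u v; rewrite adj_rst => /and3P[_ _ a].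
  by apply: connect1; rewrite adj_rst !inE.
suff H v : connect (adj (rst d setT)) v b0.
  by move=> u v _ _; apply: connect_trans (H u) _; rewrite conn_sym.
case: (boolP (v \in B)) => vB; first by apply: (lift B); apply: cB.
have /(pcomps_cover d)[T hT vT] : v \in ~: B by rewrite inE.
have /existsP[r /andP[rT hr]] := fo T hT.
have sub := subsetP (pcomps_sub hT).
have rB : r \notin B by have := sub r rT; rewrite inE.
case e: (gout d r) (nr r rB) => [x|] // _.
move: hT; rewrite mem_pcomps => /and3P[_ /connP[_ cT] /nocrossP nc].
have xB : x \in B.
  apply: contraT => xB; have xT : x \in T by apply: (nc r); rewrite // ?inE // /adj e eqxx.
  by have := rst_out d T r x; rewrite rT xT e eqxx (eqP hr).
apply: connect_trans (lift T _ _ (cT _ _ vT rT)) _.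
apply: (connect_trans (y := x)); last by apply: (lift B); apply: cB.
by apply: connect1; rewrite adj_rst !inE /= /adj e eqxx.
Qed.
End ConnFc.
End Fc.

(** * Graphs with a given closed set as forests with attachments *)

Section FcSum.
Variables (K : fieldType) (charK : [pchar K] =i pred0) (C : finType).
Variables (E : comAlgType K) (u w : ConnCls C -> E) (n : nat) (h : 'I_n -> Var C).
Local Notation outT := {ffun 'I_n -> option 'I_n}.
Local Notation graph_of := (graph_of h).
Implicit Types (A B R : {set 'I_n}) (o : outT).

Definition is_any_forest A o := [&& supp_on (graph_of o) A, fertok h o A & forest (graph_of o) A].

Section OneB.
Variable B : {set 'I_n}.
Hypothesis B0 : B != set0.
Let A := ~: B.
(** Contains both the edges inside [B] and those joining the cut-off roots to [B]. *)
Definition rest o : outT :=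
  [ffun v => if o v is Some x then if x \in B then Some x else None else None].
Let splt o := (restr h o A, rest o).

Lemma rest_out o a x : (gout (graph_of (rest o)) a == Some x) = (x \in B) && (gout (graph_of o) a == Some x).
Proof.
rewrite /gout /= ffunE; case: (o a) => [y|]; last by rewrite andbF.
have -> : (Some y == Some x) = (y == x) by [].
case: (eqVneq y x) => [<-|ne]; first by case: ifP; rewrite ?eqxx.
rewrite andbF; case: ifP => // _; apply/eqP => -[e]; by rewrite e eqxx in ne.
Qed.

Lemma rst_glue_eq o1 o2 : (splt (glue o1 o2) == (o1, o2)) ->
  forall a x, (gout (graph_of (glue o1 o2)) a == Some x) =
     (gout (graph_of o1) a == Some x) || (gout (graph_of o2) a == Some x).
Proof.
move=> /eqP[e1 e2] a x; rewrite /gout /= ffunE; case e: (o1 a) => [y|] //.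
case e': (o2 a) => [z|]; last by rewrite orbF.
have := rest_out (glue o1 o2) a z; rewrite e2 {1}/gout /= e' eqxx => /esym/andP[zB].
rewrite /gout /= ffunE e => /eqP[ez].
have := rst_out (graph_of (glue o1 o2)) A a y; rewrite rst_graph_of e1 {1}/gout /= e eqxx.
by move=> /esym/and3P[_]; rewrite inE ez zB.
Qed.

(** The second conjunct on the left is the side condition of the reindexing by [glue]. Fertilities
    separate because no edge runs from [B] to its complement: a vertex outside [B] receives edges
    from [o1] only, a vertex of [B] from [o2] only. *)
Lemma fwd_closed_cond o1 o2 :
  [&& gconnected (graph_of (glue o1 o2)), fertok h (glue o1 o2) setT & fwd_closed (graph_of (glue o1 o2)) B]
    && (splt (glue o1 o2) == (o1, o2)) =
  is_any_forest A o1 && attach (groots (graph_of o1) A) B h o2.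
Proof.
set o := glue o1 o2.
have inA a : (a \in A) = (a \notin B) by rewrite inE.
apply/andP/andP => [[/and3P[c fe f] hs]|[/and3P[s1 f1 fo1] /and4P[/forall_inP r2 /forallP h2 f2 c2]]].
  have g a x := rst_glue_eq hs a x; rewrite -/o in g hs.
  have [e1 e2] := eqP hs.
  have f' := fwd_closedP _ _ f.
  have o1E a x : (gout (graph_of o1) a == Some x) = [&& a \in A, x \in A & gout (graph_of o) a == Some x].
    by rewrite -e1 -rst_graph_of rst_out.
  have o2E a x : (gout (graph_of o2) a == Some x) = (x \in B) && (gout (graph_of o) a == Some x).
    by rewrite -e2 rest_out.
  split.
    apply/and3P; split.
    - by apply: supp_onP => a x; rewrite o1E => /and3P[-> ->].
    - apply/forall_inP => v vA; have /forall_inP/(_ v (in_setT v)) /eqP <- := fe.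
      apply/eqP/eq_card => a; rewrite !inE o1E vA /=; case ev: (_ == _); rewrite ?andbF // andbT.
      by rewrite inA; apply/negP => aB; have := f' a v aB ev; apply/negP; rewrite -inA.
    by rewrite -e1 -rst_graph_of forest_rst // fwd_closed_forest.
  apply/and4P; split.
  - apply/forall_inP => a; rewrite inE => /andP[]; rewrite inA => aB /eqP h0.
    have := fwd_closed_noroot B0 f c aB; case e: (gout (graph_of o) a) => [x|] // _.
    have : (gout (graph_of o1) a == Some x) || (gout (graph_of o2) a == Some x) by rewrite -g e.
    by rewrite h0 /= /gout /= => /eqP ->.
  - apply/forallP => a; case e: (o2 a) => [x|] //.
    have := o2E a x; rewrite {1}/gout /= e eqxx => /esym/andP[xB ax]; rewrite xB andbT inE.
    case: (boolP (a \in B)) => aB; rewrite ?orbT // orbF inE inA aB /=.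
    case e': (gout (graph_of o1) a) => [y|] //.
    have := o1E a y; rewrite e' eqxx => /esym/and3P[_ yA]; rewrite (eqP ax) => /eqP[ey].
    by move: yA; rewrite -ey inA xB.
  - apply/forall_inP => v vB; have /forall_inP/(_ v (in_setT v)) /eqP <- := fe.
    by apply/eqP/eq_card => a; rewrite !inE o2E vB.
  have -> : conn (graph_of o2) B = conn (graph_of o) B.
    rewrite /conn; have -> // : rst (graph_of o2) B = rst (graph_of o) B.
    apply: gdata_ext => // a x; rewrite !rst_out o2E.
    by case: (x \in B); rewrite ?andbF.
  exact: fwd_closed_conn.
have in1 a x : gout (graph_of o1) a == Some x -> (a \in A) && (x \in A) by apply: supp_out.
have in2 a x : gout (graph_of o2) a == Some x -> (a \in groots (graph_of o1) A :|: B) && (x \in B).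
  by move=> /eqP; rewrite /gout /= => e; have := h2 a; rewrite e.
have excl a x y : gout (graph_of o1) a == Some x -> gout (graph_of o2) a == Some y -> false.
  move=> h1 /in2 /andP[]; rewrite inE => /orP[|aB _].
    by rewrite inE => /andP[_]; rewrite (eqP h1).
  by case/andP: (in1 _ _ h1); rewrite inA aB.
have g a x : (gout (graph_of o) a == Some x) = (gout (graph_of o1) a == Some x) || (gout (graph_of o2) a == Some x).
  rewrite /gout /= ffunE; case e1: (o1 a) => [y|] //.
  case e2: (o2 a) => [z|]; last by rewrite orbF.
  by have := excl a y z; rewrite /gout /= e1 e2 !eqxx => /(_ isT isT).
have o1E a x : (gout (graph_of o1) a == Some x) = [&& a \in A, x \in A & gout (graph_of o) a == Some x].
  rewrite g; apply/idP/and3P => [h1|[aA xA /orP[//|/in2/andP[_]]]].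
    by case/andP: (in1 _ _ h1) => -> ->; rewrite h1.
  by rewrite inA in xA; rewrite (negbTE xA).
have o2E a x : (gout (graph_of o2) a == Some x) = (x \in B) && (gout (graph_of o) a == Some x).
  rewrite g; apply/idP/andP => [h1|[xB /orP[/in1/andP[_]|//]]].
    by case/andP: (in2 _ _ h1) => _ ->; rewrite h1 orbT.
  by rewrite inA xB.
have f : fwd_closed (graph_of o) B.
  apply/fwd_closedP => a x aB; rewrite g => /orP[/in1/andP[]|/in2/andP[_ //]].
  by rewrite inA aB.
have hs : splt o = (o1, o2).
  congr pair; apply: (@graph_of_ext _ _ h) => a x; rewrite ?rest_out ?o2E //.
  by rewrite -rst_graph_of rst_out o1E.
split; last by rewrite hs.
apply/and3P; split=> //.
  apply: (fwd_closed_gconnected B0).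
  - have <- : conn (graph_of o2) B = conn (graph_of o) B; last by [].
    rewrite /conn; have -> // : rst (graph_of o2) B = rst (graph_of o) B.
    apply: gdata_ext => // a x; rewrite !rst_out o2E.
    by case: (x \in B); rewrite ?andbF.
  - by rewrite -(@forest_rst _ _ _ _ A) // rst_graph_of; case: hs => ->.
  move=> v vB; case e: (gout (graph_of o1) v) => [x|].
    by have := g v x; rewrite e eqxx => /eqP ->.
  have := r2 v; rewrite !inE vB e eqxx => /(_ isT); case e2: (o2 v) => [x|] // _.
  by have := g v x; rewrite [gout (graph_of o2) v]e2 eqxx orbT => /eqP ->.
apply/forall_inP => v _; case: (boolP (v \in B)) => vB.
  have /forall_inP/(_ v vB) /eqP <- := f2.
  by apply/eqP/eq_card => a; rewrite !inE o2E vB.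
have vA : v \in A by rewrite inA.
have /forall_inP/(_ v vA) /eqP <- := f1; apply/eqP/eq_card => a; rewrite !inE g.
case e: (gout (graph_of o2) a == Some v); last by rewrite orbF.
by case/andP: (in2 _ _ e); rewrite (negbTE vB).
Qed.

(** For a fixed forest on the complement, summing over the ways to attach its roots replaces the
    second factor by a power of [dbar]; the exponent is the number of trees, which is the number of
    roots. *)
Lemma fwd_closed_sum1 :
  \sum_(o : outT | [&& gconnected (graph_of o), fertok h o setT & fwd_closed (graph_of o) B])
     pcomps_wt u (graph_of o) A * owt w (clsS (graph_of o) B) =
  \sum_(o : outT | is_any_forest A o) pcomps_wt u (graph_of o) A * dbar_ext (class_sum w) #|pcomps (graph_of o) A| (monS h B).
Proof.
transitivity (\sum_(o1 : outT | is_any_forest A o1) \sum_(o2 : outT | attach (groots (graph_of o1) A) B h o2)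
    pcomps_wt u (graph_of o1) A * owt w (clsS (graph_of o2) B)); last first.
  apply: eq_bigr => o /and3P[s _ f]; rewrite -mulr_sumr -card_roots // attach_sum //.
  by apply/pred0P => x /=; rewrite !inE; case: (x \in B); rewrite ?andbF.
rewrite pair_big_dep /= (reindex_onto (fun p : outT * outT => glue p.1 p.2) splt) /=; last first.
  move=> o /and3P[_ _ /fwd_closedP f]; apply/ffunP => a; rewrite ffunE.
  case e: (restr h o A a) => [x|].
    have := rst_out (graph_of o) A a x; rewrite rst_graph_of {1}/gout /= e eqxx => /esym/and3P[_ _ /eqP].
    by [].
  rewrite ffunE; case e': (o a) => [x|] //; case: ifP => // /negbT xB.
  have aB : a \notin B by apply: contra xB => aB; apply: (f a); rewrite // /gout /= e'.
  have := rst_out (graph_of o) A a x; rewrite rst_graph_of {1}/gout /= e !inE aB xB.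
  by rewrite /gout /= e' eqxx.
apply: eq_big => -[o1 o2] /=; first exact: fwd_closed_cond.
case/andP => _ /eqP[]; move: (glue o1 o2) => o <- <-.
rewrite -rst_graph_of pcomps_wt_rst //; congr (_ * owt w _); apply: clsS_eq => // a x aB xB.
by rewrite rest_out xB.
Qed.
End OneB.
End FcSum.

(** * The bijection between admissible cuts and closed sets *)

Section CutSet.
Variables (C : finType) (n : nat).
Implicit Types (d : gdata C n) (A B T : {set 'I_n}) (c : {set 'I_n}).

Lemma fwd0 d k : iter k (obind (gout d)) None = None.
Proof. by elim: k => //= k ->. Qed.

Lemma fwdD d i j v x : fwd d i v = Some x -> fwd d (j + i) v = fwd d j x.
Proof. by rewrite /fwd iterD => ->. Qed.

Lemma fwdSr d k v x : gout d v = Some x -> fwd d k.+1 v = fwd d k x.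
Proof. by move=> e; rewrite -addn1; apply: fwdD; rewrite /fwd /= e. Qed.

Lemma fwd_connect d k v x : fwd d k v = Some x -> connect (erel d) v x.
Proof.
elim: k v => [|k IH] v; first by case=> ->; apply: connect0.
case e: (gout d v) => [y|]; last by rewrite /fwd iterSr /= e fwd0.
by rewrite (fwdSr _ e) => /IH; apply: connect_trans; apply: connect1; rewrite /erel e.
Qed.

Lemma connect_fwd d v x : connect (erel d) v x -> exists2 k, (k < n)%N & fwd d k v = Some x.
Proof.
case/connectP => s0 /shortenP[s p us _] ->; exists (size s).
  by have := max_card (mem (v :: s)); rewrite (card_uniqP us) card_ord.
elim: s v p {us} => [|y s IH] v //= /andP[/eqP vy p].
by have := IH y p; rewrite -(fwdSr _ vy).
Qed.

(** An edge is named by its source, so these are the edges entering [B]; [upOf] recovers [B] as the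
    vertices from which no cut edge can be reached. *)
Definition cutOf d B := [set v | (v \notin B) && (if gout d v is Some x then x \in B else false)].
Definition upOf d c := [set v | [forall x in c, ~~ connect (erel d) v x]].

Lemma upOfP d c v : reflect (forall x, x \in c -> ~ connect (erel d) v x) (v \in upOf d c).
Proof.
rewrite inE; apply: (iffP forall_inP) => H x xc; first by apply/negP/H.
by apply/negP/H.
Qed.

Lemma admissible_upOfK d c : admissible d c -> cutOf d (upOf d c) = c.
Proof.
case/andP => /forall_inP h1 /forallP h2.
(* Behind a cut edge there is no further one: meeting [v] again would put [v] on the cycle, and
   meeting another source would put two cut edges on one directed path. *)
have key v x y : v \in c -> gout d v = Some y -> x \in c -> ~ connect (erel d) y x.
  move=> vc e xc cyx; have /andP[_ /negP nc] := h1 v vc.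
  case: (eqVneq x v) => [exv|ne].
    have [k kn hk] := connect_fwd cyx; apply: nc; apply/existsP.
    by exists (Ordinal kn); rewrite (fwdSr _ e) hk exv.
  have : connect (erel d) v x.
    by apply: connect_trans cyx; apply: connect1; rewrite /erel e.
  case/connect_fwd => k kn hk; have n0 : (0 < n)%N by apply: leq_ltn_trans kn.
  have := h2 v; rewrite leqNgt => /negP[]; apply/card_gt1P.
  exists (Ordinal n0), (Ordinal kn); rewrite !inE /= hk vc xc; split=> //.
  apply/eqP => -[k0]; move: hk; rewrite -k0 => -[evx]; by rewrite evx eqxx in ne.
apply/setP => v; rewrite inE; apply/andP/idP => [[vB]|vc].
  case e: (gout d v) => [y|] // /upOfP yB.
  have : v \notin upOf d c by [].
  rewrite inE negb_forall => /existsP[x]; rewrite negb_imply negbK => /andP[xc].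
  case/connect_step => [->//|[z]]; rewrite /erel e => /eqP[<-] cz.
  by case: (yB _ xc cz).
split; first by apply/negP => /upOfP /(_ v vc); apply; apply: connect0.
have /andP[] := h1 v vc; case e: (gout d v) => [y|] // _ _.
by apply/upOfP => x xc; apply: key e xc.
Qed.

(** A path that has entered [B] stays there, so it uses one edge of [cutOf d B] at most, and no such
    edge lies on a cycle. The equation for [upOf] is the side condition of the reindexing in
    [cut_sum]. *)
Lemma cutOf_adm d B : gconnected d ->
  admissible d (cutOf d B) && (upOf d (cutOf d B) == B) = (B != set0) && fwd_closed d B.
Proof.
move=> cd; have n0 : (0 < n)%N by case/andP: cd.
apply/andP/andP => [[ha /eqP hu]|[B0 f]].
  have f : fwd_closed d B.
    apply/fwd_closedP => a x aB /eqP ax; rewrite -hu; apply/upOfP => y yc cxy.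
    move: aB; rewrite -hu => /upOfP /(_ y yc); apply; apply: connect_trans cxy.
    by apply: connect1; rewrite /erel ax.
  split=> //; apply/eqP => B0; have : Ordinal n0 \in B; last by rewrite B0 inE.
  rewrite -hu; apply/upOfP => x; rewrite inE B0 inE /=.
  by case: (gout d x) => // y; rewrite inE.
have stay v k x : v \in B -> fwd d k v = Some x -> x \in B.
  by move=> vB /fwd_connect; apply: fwd_closed_connect f vB.
have after v k x : v \in cutOf d B -> fwd d k.+1 v = Some x -> x \in B.
  rewrite inE => /andP[_]; case e: (gout d v) => [y|] // yB.
  by rewrite (fwdSr _ e); apply: stay.
split.
  apply/andP; split.
    apply/forall_inP => v vc; apply/andP; split.
      by move: vc; rewrite inE => /andP[_]; case: (gout d v).
    apply/existsP => -[k /eqP e]; have := after _ _ _ vc e.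
    by move: vc; rewrite inE => /andP[/negbTE ->].
  apply/forallP => v; rewrite leqNgt; apply/negP => /card_gt1P[i [j]].
  rewrite !inE => -[hi hj ne].
  wlog lt : i j hi hj ne / (i < j)%N.
    move=> H; case: (ltngtP i j) => [lt|lt|/val_inj e]; [exact: (H i j)| |by rewrite e eqxx in ne].
    by apply: (H j i); rewrite // eq_sym.
  case e: (fwd d i v) hi => [x|] // xc; case e': (fwd d j v) hj => [y|] // yc.
  have := fwdD (j - i) e; rewrite subnK 1?ltnW // e' => /esym.
  have : (j - i = (j - i).-1.+1)%N by rewrite prednK // subn_gt0.
  move=> -> /(after _ _ _ xc); by move: yc; rewrite inE => /andP[/negbTE ->].
apply/eqP/setP => v; apply/idP/idP => [/upOfP H|vB]; last first.
  apply/upOfP => x xc cx; move: xc; rewrite inE (fwd_closed_connect f vB cx) //.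
apply: contraT => vB; have [b bB /connectP[s]] := fwd_closed_reach B0 f cd v.
elim: s v vB {H} (H) => [|y s IH] v vB H /=; first by move=> _ e; rewrite -e bB in vB.
case/andP => vy p e; case: (boolP (y \in B)) => yB.
  case: (H v); last exact: connect0.
  by rewrite inE vB; move: vy; rewrite /erel => /eqP ->.
apply: (IH y) => // x xc cx; case: (H x xc); apply: connect_trans cx.
exact: connect1.
Qed.

Section OneCut.
Variables (d : gdata C n) (B : {set 'I_n}).
Hypotheses (cd : gconnected d) (B0 : B != set0) (f : fwd_closed d B).
Let dc := cutg d (cutOf d B).

(** By closure every edge between [B] and its complement enters [B]; the cut removes exactly
    these. *)
Lemma cutg_out a x : (gout dc a == Some x) =
  (gout d a == Some x) && ((a \in B) == (x \in B)).
Proof.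
have -> : gout dc a = if a \in cutOf d B then None else gout d a by rewrite {1}/gout /= ffunE.
rewrite inE; case e: (gout d a) => [y|]; last by rewrite if_same.
have -> : (Some y == Some x) = (y == x) by [].
have h (b : bool) : ((if b then None else Some y) == Some x) = ~~ b && (y == x) by case: b.
rewrite h; case: (eqVneq y x) => [<-|ne]; last by rewrite andbF.
case: (boolP (a \in B)) => aB /=; last by case: (y \in B).
by rewrite (fwd_closedP _ _ f a y) ?e ?eqxx.
Qed.

Lemma adj_cutg a x : adj dc a x = adj d a x && ((a \in B) == (x \in B)).
Proof. by rewrite /adj !cutg_out [(x \in B) == _]eq_sym -andb_orl. Qed.

Lemma adj_cutg_rst (S : {set 'I_n}) a : S = B \/ S = ~: B -> a \in S ->
  forall x, adj dc a x = adj (rst d S) a x.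
Proof.
move=> hS aS x; rewrite adj_rst adj_cutg aS /=; case: hS aS => -> .
  by move=> ->; rewrite andbC eq_sym eqb_id.
by rewrite !inE => /negbTE ->; rewrite andbC; case: (x \in B).
Qed.

Lemma connect_cutg (S : {set 'I_n}) a x : S = B \/ S = ~: B -> a \in S ->
  connect (adj dc) a x = (x \in S) && connect (adj (rst d S)) a x.
Proof.
move=> hS aS; apply/idP/andP => [/connectP[s p ->]|[_]].
  elim: s a aS p => [|y s IH] a aS /=; first by rewrite connect0.
  rewrite (adj_cutg_rst hS) // => /andP[ay p].
  have yS : y \in S by move: ay; rewrite adj_rst => /and3P[].
  have [? cc] := IH y yS p; split=> //; exact: connect_trans (connect1 ay) cc.
apply: (connect_img (f := id)) => y z yz; apply: connect1.
by rewrite (adj_cutg_rst hS) //; move: yz; rewrite adj_rst => /and3P[].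
Qed.

Lemma comps_cutg T : (T \in comps dc) = (T == B) || (T \in pcomps d (~: B)).
Proof.
rewrite /comps mem_enum; apply/imsetP/orP => [[v _ ->]|].
  case: (boolP (v \in B)) => vB; [left|right].
    have /connP[_ cB] := fwd_closed_conn B0 f cd.
    apply/eqP/setP => x; rewrite inE (@connect_cutg B) //; last by left.
    by case: (boolP (x \in B)) => // xB; rewrite cB.
  rewrite pcompsE; have vA : v \in ~: B by rewrite inE.
  apply/imsetP; exists v => //; apply/setP => x; rewrite !inE (@connect_cutg (~: B)) ?inE //.
  by right.
case=> [/eqP ->|]; last first.
  rewrite pcompsE => /imsetP[v vA ->]; exists v => //.
  apply/setP => x; rewrite !inE (@connect_cutg (~: B)) ?inE //; first by right.
  by rewrite inE in vA.
have /set0Pn[v vB] := B0; exists v => //; have /connP[_ cB] := fwd_closed_conn B0 f cd.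
apply/setP => x; rewrite inE (@connect_cutg B) //; last by left.
by case: (boolP (x \in B)) => // xB; rewrite cB.
Qed.

(** After [n] steps the walk of [core] is at the root or on the cycle, hence periodic. It reaches
    [B] and comes back, so by closure it was in [B] already. *)
Lemma core_in : exists2 b, core d = Some b & b \in B.
Proof.
rewrite /core; case: pickP => [v0 _|n0]; last first.
  by have /set0Pn[b _] := B0; have := n0 b.
rewrite /=; set g := fun v => odflt v (gout d v); exists (iter n g v0) => //.
set z := iter n g v0.
have gB k b : b \in B -> iter k g b \in B.
  elim: k => //= k IH bB; rewrite /g; case e: (gout d (iter k g b)) => [x|] /=; last exact: IH.
  by apply: (fwd_closedP _ _ f (iter k g b)); rewrite ?e ?IH.
have [b bB cb] := fwd_closed_reach B0 f cd z.
have [m hm] : exists m, b = iter m g z.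
  case/connectP: cb => s; elim: s z => [|y s IH] z' /=; first by move=> _ ->; exists 0%N.
  case/andP => /eqP zy p /(IH y p)[m ->]; exists m.+1.
  by rewrite iterSr /g zy.
(* Pigeonhole on the [n.+1] iterates 0 to [n]; [z] is the last of them, so it lies in the periodic
   part. *)
have [p p0 hp] : exists2 p, (0 < p)%N & iter p g z = z.
  have /injectivePn[i [j ne eij]] : ~~ injectiveb (fun k : 'I_n.+1 => iter k g v0).
    apply/injectiveP => inj; have := leq_card _ inj; by rewrite !card_ord ltnn.
  wlog lt : i j ne eij / (i < j)%N.
    move=> H; case: (ltngtP i j) => [lt|lt|/val_inj e]; [exact: (H i j)| |by rewrite e eqxx in ne].
    by apply: (H j i); rewrite // eq_sym.
  exists (j - i)%N; first by rewrite subn_gt0.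
  have hi : (i <= n)%N by rewrite -ltnS.
  have zi : z = iter (n - i) g (iter i g v0) by rewrite -iterD subnK.
  by rewrite zi -iterD addnC iterD -[iter (j - i) g _]iterD subnK 1?ltnW // -eij.
(* A multiple of the period that is at least [m], so that the return to [z] passes through [b]. *)
have hmp : iter (m * p) g z = z.
  by elim: (m) => // k IH; rewrite mulSn addnC iterD hp.
have mp : (m <= m * p)%N by rewrite leq_pmulr.
by rewrite -hmp -(subnK mp) iterD -hm; apply: gB.
Qed.
End OneCut.
End CutSet.

Section CutSum.
Variables (K : fieldType) (C : finType) (E : comAlgType K) (u w : ConnCls C -> E).

(** The sum over cuts of the BCK coproduct, with [u] for the components cut off and [w] for the one
    containing [core d]. *)
Definition cutsum n (d : gdata C n) : E :=
  \sum_(c : {set 'I_n} | admissible d c)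
    (\prod_(S <- comps (cutg d c) | core d \notin [seq Some v | v in S])
       owt u (clsS (cutg d c) S)) *
    (\sum_(S <- comps (cutg d c) | core d \in [seq Some v | v in S])
       owt w (clsS (cutg d c) S)).

Definition fwd_closed_sum n (d : gdata C n) : E :=
  \sum_(B : {set 'I_n} | (B != set0) && fwd_closed d B) pcomps_wt u d (~: B) * owt w (clsS d B).

Lemma cut_sum n (d : gdata C n) : gconnected d -> cutsum d = fwd_closed_sum d.
Proof.
move=> cd; rewrite /cutsum (reindex_onto (cutOf d) (upOf d)) /=; last first.
  by move=> c; apply: admissible_upOfK.
apply: eq_big => [B|B]; first exact: cutOf_adm.
rewrite cutOf_adm // => /andP[B0 f].
have [b hb bB] := core_in cd B0 f.
have inS (S : {set 'I_n}) : (core d \in [seq Some v | v in S]) = (b \in S).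
  rewrite hb; apply/imageP/idP => [[x xS [->]]|] //.
  by move=> bS; exists b.
have un : uniq (comps (cutg d (cutOf d B))) by apply: enum_uniq.
have mE := comps_cutg cd B0 f.
have BnA : B \notin pcomps d (~: B).
  by apply/negP => /pcomps_sub /subsetP /(_ b bB); rewrite inE bB.
have cE (S : {set 'I_n}) : S \in comps (cutg d (cutOf d B)) ->
    clsS (cutg d (cutOf d B)) S = clsS d S.
  rewrite mE => hS; apply: clsS_eq => // x y xS yS; rewrite (cutg_out f).
  case/orP: hS => [/eqP eS|/pcomps_sub/subsetP sub].
    by rewrite eS in xS yS; rewrite xS yS eqxx andbT.
  by have := sub x xS; have := sub y yS; rewrite !inE => /negbTE -> /negbTE ->; rewrite andbT.
congr (_ * _).
  rewrite big_mkcond (big_uniq _ un) -big_mkcondr /=; apply: eq_big => [S|S /andP[hS _]].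
    rewrite inS mE; case: (eqVneq S B) => [->|_]; first by rewrite bB andbF (negbTE BnA).
    rewrite /=; case hS: (S \in pcomps _ _) => //=; apply/negP => bS.
    by have := subsetP (pcomps_sub hS) b bS; rewrite inE bB.
  by rewrite cE.
rewrite big_mkcond (big_uniq _ un) -big_mkcondr /= (big_pred1 B) ?cE ?mE ?eqxx // => S.
rewrite inS mE /=; case: (eqVneq S B) => [->|_]; first by rewrite bB.
rewrite /=; case hS: (S \in pcomps _ _) => //=; apply/negP => bS.
by have := subsetP (pcomps_sub hS) b bS; rewrite inE bB.
Qed.

Section Relabel.
Variables (n : nat) (d : gdata C n) (p : {perm 'I_n}).
Local Notation d' := (relabel d p).
Implicit Types (A B S T : {set 'I_n}).

Lemma relabel_out a b : (gout d' (p a) == Some (p b)) = (gout d a == Some b).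
Proof.
rewrite /gout /= ffunE permK /gout; case: (d.1 a) => //= x.
by apply/eqP/eqP => [[/perm_inj ->]|[->]].
Qed.

Lemma rst_relabel A : rst d' (p @: A) = relabel (rst d A) p.
Proof.
apply: gdata_ext => [a b|a]; last by rewrite /gdec /= !ffunE.
rewrite rst_out -[a](permKV p) -[b](permKV p) relabel_out !mem_imset; try exact: perm_inj.
have -> : gout (relabel (rst d A) p) (p ((p^-1)%g a)) == Some (p ((p^-1)%g b)) =
  (gout (rst d A) ((p^-1)%g a) == Some ((p^-1)%g b)).
  rewrite /gout /= ffunE permK /gout; case: ((rst d A).1 _) => //= x.
  by apply/eqP/eqP => [[/perm_inj ->]|[->]].
by rewrite rst_out.
Qed.

Lemma clsS_relabel S : clsS d' (p @: S) = clsS d S.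
Proof.
apply/esym; apply: (@clsS_iso _ _ _ _ _ _ _ p) => //.
- by move=> ? ? _ _; apply: perm_inj.
- by move=> a b _ _; rewrite relabel_out.
by move=> a _; rewrite /gdec /= ffunE permK.
Qed.

Lemma pcomps_relabel A : pcomps d' (p @: A) = [set p @: (T : {set _}) | T in pcomps d A].
Proof.
rewrite !pcompsE -!imset_comp /=; apply: eq_imset => v /=; apply/setP => x.
rewrite -[x](permKV p) mem_imset; last exact: perm_inj.
rewrite !inE mem_imset; last exact: perm_inj.
congr (_ && _); rewrite rst_relabel; apply/idP/idP; last exact: connect_relabel.
by move/(connect_relabel p^-1%g); rewrite relabelK !permK.
Qed.

Lemma pcomps_wt_relabel A : pcomps_wt u d' (p @: A) = pcomps_wt u d A.
Proof.
rewrite /pcomps_wt pcomps_relabel big_imset /=; last first.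
  by move=> S T _ _; apply: imset_inj; apply: perm_inj.
by apply: eq_bigr => T _; rewrite clsS_relabel.
Qed.

(** The coproduct is computed on a chosen representative while the labelled sum meets every
    relabelling of it, so the value has to depend on the class only. *)
Lemma fwd_closed_sum_relabel : fwd_closed_sum d' = fwd_closed_sum d.
Proof.
rewrite /fwd_closed_sum (reindex (fun B : {set 'I_n} => p @: B)) /=; last first.
  exists (fun B : {set 'I_n} => p^-1%g @: B) => B _; rewrite -imset_comp -[RHS]imset_id;
  by apply: eq_imset => x /=; rewrite ?permK ?permKV.
apply: eq_big => [B|B _]; last first.
  rewrite clsS_relabel; congr (_ * _); rewrite -pcomps_wt_relabel; congr (pcomps_wt u d' _).
  by apply/setP => x; rewrite -[x](permKV p) inE !mem_imset ?inE //; apply: perm_inj.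
rewrite imset_eq0; congr (_ && _); apply/fwd_closedP/fwd_closedP => H a b aB ab.
  have := H (p a) (p b); rewrite relabel_out !mem_imset; try exact: perm_inj.
  by apply.
case/imsetP: aB ab => a' a'B ->; rewrite -[b](permKV p) relabel_out => /(H _ _ a'B).
by move=> bB; rewrite mem_imset //; apply: perm_inj.
Qed.
End Relabel.

Lemma fwd_closed_sum_cls n (d : gdata C n) x : clsOf d = Some x -> fwd_closed_sum (tagged (val x)) = fwd_closed_sum d.
Proof.
move=> e; have [r hr] := clsOf_tag e; have := clsOf_SomeE d hr.
by rewrite e eqxx hr => /esym/existsP[p /eqP <-]; rewrite fwd_closed_sum_relabel.
Qed.

End CutSum.

(** * Decompositions of multi-indices and the exponential formula *)

Section Flat.
Variables (I J : choiceType) (g : I -> {cmonom J}).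
Implicit Types F G : {cmonom I}.
(** Common form of [phiM], of [psiF] and of the product of a family of monomials. *)
Definition flat F : {cmonom J} := \big[mmul/mone]_(k <- finsupp F) expcmn (g k) (F k).
Lemma flatEw (d : {fset I}) F j : (finsupp F `<=` d)%fset ->
  flat F j = (\sum_(k <- d) F k * g k j)%N.
Proof.
move=> le; rewrite /flat cm_prodE -(big_fset_incl _ le) /=; last first.
  by move=> k _; rewrite -cmE_eq0 => /eqP ->.
by apply: eq_bigr => k _; rewrite expcmnE.
Qed.
Lemma flatM F G : flat (mmul F G) = mmul (flat F) (flat G).
Proof.
pose d := (finsupp F `|` finsupp G)%fset; apply/eqP/cmP => j.
rewrite cmM (@flatEw d) ?mdomD // (@flatEw d F) ?fsubsetUl // (@flatEw d G) ?fsubsetUr //.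
by rewrite -big_split; apply: eq_bigr => k _ /=; rewrite cmM mulnDl.
Qed.
Lemma flat1 : flat mone = mone.
Proof. by rewrite /flat mdom1 big_seq_fset0. Qed.
Lemma flatU k : flat (ucm k) = g k.
Proof. by rewrite /flat mdomU big_seq_fset1 cmUU. Qed.
End Flat.

Section Sig.
Variables (I : choiceType) (w : I -> nat).
Implicit Types F : {cmonom I}.
(** Common form of the symmetry factors of families, monomials, clumps and forests, [w] being the
    factor of a single generator. *)
Definition sig F : nat := (\prod_(k <- finsupp F) ((F k)`! * (w k) ^ (F k)))%N.
Lemma sigEw (d : {fset I}) F : (finsupp F `<=` d)%fset ->
  sig F = (\prod_(k <- d) ((F k)`! * (w k) ^ (F k)))%N.
Proof.
move=> le; rewrite /sig (big_fset_incl _ le) //= => k _.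
by rewrite -cmE_eq0 => /eqP ->.
Qed.
Lemma sig1 : sig mone = 1%N.
Proof. by rewrite /sig mdom1 big_seq_fset0. Qed.
Lemma sigU k F : sig (mmul (ucm k) F) = ((F k).+1 * w k * sig F)%N.
Proof.
pose d := (k |` finsupp F)%fset.
rewrite (@sigEw d) ?mdomD ?mdomU // (@sigEw d F) ?fsubsetUr //.
rewrite [LHS](big_fsetD1 k) ?fset1U1 //= [X in _ = (_ * X)%N](big_fsetD1 k) ?fset1U1 //=.
rewrite mulnA cmM cmUU add1n factS expnS; congr (_ * _)%N; first by rewrite -!mulnA; congr (_ * _)%N; rewrite mulnCA.
rewrite big_seq [RHS]big_seq; apply: eq_bigr => j.
by rewrite !inE => /andP[ne _]; rewrite cmM cmU eq_sym (negbTE ne).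
Qed.
Lemma sig_gt0 F : (forall k, 0 < w k)%N -> (0 < sig F)%N.
Proof. by move=> w0; rewrite /sig prodn_gt0 // => k; rewrite muln_gt0 fact_gt0 expn_gt0 w0. Qed.
End Sig.

Section CmDiv.
Variable I : choiceType.
Implicit Types (m a b : {cmonom I}) (i : I).
Lemma mulIcm m : injective (mmul m).
Proof. by move=> a b /eqP/cmP e; apply/eqP/cmP => i; have := e i; rewrite !cmM => /addnI. Qed.
Lemma divcm_mul a b : divcm (mmul a b) a = b.
Proof. by apply/eqP/cmP => i; rewrite divcmE cmM addKn. Qed.
Lemma mul_divcm a m : (forall i, a i <= m i)%N -> mmul a (divcm m a) = m.
Proof. by move=> le; apply/eqP/cmP => i; rewrite cmM divcmE subnKC. Qed.
Lemma ucm_div m i : i \in finsupp m -> mmul (ucm i) (divcm m (ucm i)) = m.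
Proof.
rewrite -cmE_neq0 -lt0n => im; apply: mul_divcm => j; rewrite cmU.
by case: eqP => // <-.
Qed.
End CmDiv.

Section Decomps.
Variable C : finType.
Implicit Types (m k : Mon C) (F : {cmonom (Mon C)}).

Lemma wtEw (d : {fset (Var C)}) m : (finsupp m `<=` d)%fset ->
  wt m = \sum_(i <- d) ((i.2)%:Z - 1) * (m i)%:Z.
Proof.
move=> le; rewrite /wt (big_fset_incl _ le) //= => i _.
by rewrite -cmE_eq0 => /eqP ->; rewrite mulr0.
Qed.
Lemma wtM m k : wt (mmul m k) = wt m + wt k.
Proof.
pose d := (finsupp m `|` finsupp k)%fset.
rewrite (@wtEw d m) ?fsubsetUl // (@wtEw d k) ?fsubsetUr //.
rewrite (@wtEw d) ?mdomD // -big_split; apply: eq_bigr => i _ /=.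
by rewrite cmM PoszD mulrDr.
Qed.
Lemma wt1 : wt (mone : Mon C) = 0.
Proof. by rewrite /wt mdom1 big_seq_fset0. Qed.
Lemma wtU (i : Var C) : wt (ucm i) = (i.2)%:Z - 1.
Proof. by rewrite /wt mdomU big_seq_fset1 cmUU mulr1. Qed.

Lemma mem_divisors m k : (k \in divisors m) <-> exists r, mmul k r = m.
Proof.
(* Generalised from the support of [m] to any duplicate-free list of variables, for the induction on
   the [foldr]. *)
have aux (s : seq (Var C)) : uniq s -> forall a : Mon C,
  (a \in foldr (fun i acc => [seq mulcm (expcmn (ucm i) e) d
                         | e <- iota 0 (m i).+1, d <- acc]) [:: (onecm _)] s) <->
  forall i, (a i <= if i \in s then m i else 0)%N.
  elim: s => [|j s IH] => [_|/andP[js us]] a.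
    rewrite mem_seq1; split=> [/eqP -> i|H]; first by rewrite onecmE.
    by apply/cmP => i; rewrite onecmE; apply/eqP; rewrite -leqn0; exact: (H i).
  split=> [/allpairsPdep[e [b [he /(IH us) hb ->]]] i|H].
    rewrite mulcmE expcmnE cmU inE eq_sym; have := hb i.
    case: (eqVneq i j) => [->|_] /=; last by rewrite muln0.
    by rewrite (negbTE js) leqn0 => /eqP ->; rewrite muln1 addn0; move: he; rewrite mem_iota.
  apply/allpairsPdep; exists (a j), (divcm a (expcmn (ucm j) (a j))); split.
  - by rewrite mem_iota /= add0n ltnS; have := H j; rewrite inE eqxx.
  - apply/(IH us) => i; rewrite divcmE expcmnE cmU eq_sym; have := H i; rewrite inE.
    case: (eqVneq i j) => [->|_] /=; first by rewrite muln1 subnn.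
    by rewrite muln0 subn0.
  apply/eqP/cmP => i; rewrite mulcmE divcmE expcmnE cmU.
  by case: eqP => [->|_]; rewrite ?muln1 ?subnn ?addn0 // muln0 subn0.
rewrite /divisors; split=> [/(aux _ (fset_uniq _)) H|[r e]].
  exists (divcm m k); apply: mul_divcm => i; have := H i.
  by case: (boolP (i \in finsupp m)) => // _; rewrite leqn0 => /eqP ->.
apply/(aux _ (fset_uniq _)) => i; have le : (k i <= m i)%N by rewrite -e cmM leq_addr.
by case: ifP => // /negbT; rewrite -cmE_eq0 => /eqP m0; rewrite m0 in le.
Qed.

Definition famprod F : Mon C := flat id F.
Definition dec_ok m (Fr : {cmonom (Mon C)} * Mon C) :=
  (forall k, k \in finsupp Fr.1 -> wt k = -1) /\ mmul (famprod Fr.1) Fr.2 = m.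

(** Each recursive call adds one member to the family, so the fuel bounds its size and nothing
    else. *)
Lemma mem_fams f m F r : ((F, r) \in fams f m) <-> dec_ok m (F, r) /\ (mdeg F <= f)%N.
Proof.
elim: f m F r => [|f IH] m F r.
  rewrite /= inE; split=> [/eqP[-> ->]|[[_ /= e]]].
    split; last by rewrite [mdeg _]mdeg1.
    by split=> [k|] /=; rewrite ?mdom1 ?inE // /famprod [flat _ _]flat1 mul1m.
  rewrite leqn0 => /eqP/mdeg_eq0I F1; move: e; rewrite F1 /famprod flat1 mul1m => ->.
  exact: eqxx.
rewrite [fams _ _]/= in_cons; split=> [/orP[/eqP[-> ->]|/flattenP[s /mapP[d]]]|[[hw /= e] hd]].
- split; last by rewrite [mdeg _]mdeg1.
  by split=> [k|] /=; rewrite ?mdom1 ?inE // /famprod [flat _ _]flat1 mul1m.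
- rewrite mem_filter => /andP[/eqP wd /mem_divisors[q <-]] -> /mapP[[F' r'] /= hF [-> ->]].
  rewrite divcm_mul in hF; have [[hw /= e] hd] := (IH _ _ _).1 hF.
  split; last by rewrite mdegM mdegU add1n ltnS.
  split=> /= [k|]; last by rewrite /famprod flatM flatU -mulmA; congr mmul.
  rewrite mdomD mdomU in_fsetU in_fset1 => /orP[/eqP ->|/hw]; first exact: wd.
  exact.
case: (eqVneq F mone) => [F1|F1].
  by move: e; rewrite F1 /famprod flat1 mul1m => ->; rewrite eqxx.
have [k kF] : exists k, k \in finsupp F.
  by apply/fset0Pn; apply: contraNneq F1 => h; rewrite -mdeg_eq0 mdegE h big_seq_fset0.
have eF := ucm_div kF; set F' := divcm F (ucm k) in eF.
have em : mmul k (mmul (famprod F') r) = m by rewrite -e -eF /famprod flatM flatU mulmA.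
apply/orP; right; apply/flattenP; exists [seq (mulcm (ucm k) G.1, G.2) | G <- fams f (divcm m k)].
  apply/mapP; exists k => //; rewrite mem_filter (hw _ kF) eqxx /=.
  by apply/mem_divisors; exists (mmul (famprod F') r).
apply/mapP; exists (F', r); last by rewrite /= -[in LHS]eF.
apply/IH; split; last by move: hd; rewrite -eF mdegM mdegU add1n ltnS.
split=> /= [k' hk'|]; last by rewrite -em divcm_mul.
by apply: hw; rewrite -eF mdomD inE hk' orbT.
Qed.

Lemma mdeg_famprod F : (forall k, k \in finsupp F -> k != mone) -> (mdeg F <= mdeg (famprod F))%N.
Proof.
elim/cm_ind: F => [|k F IH] H; first by rewrite /famprod flat1 !mdeg1.
rewrite /famprod flatM flatU !mdegM mdegU leq_add //.
  by rewrite lt0n mdeg_eq0 H // mdomD mdomU in_fsetU in_fset1 eqxx.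
by apply: IH => k' h; apply: H; rewrite mdomD in_fsetU h orbT.
Qed.

(** A monomial of weight -1 is not constant, so a family has at most [mdeg m] members and the fuel
    suffices. *)
Lemma mem_decomps m Fr : (Fr \in decomps m) <-> dec_ok m Fr.
Proof.
case: Fr => F r; rewrite /decomps mem_undup; split=> [/mem_fams[]//|h].
apply/mem_fams; split=> //; case: h => /= hw <-; rewrite mdegM.
apply: leq_trans (leq_addr _ _); apply: mdeg_famprod => k /hw wk.
by apply: contra_eqN wk => /eqP ->; rewrite wt1.
Qed.
Lemma decomps_uniq m : uniq (decomps m).
Proof. exact: undup_uniq. Qed.

End Decomps.

(** * Weight as minus the number of roots *)

Section WtConn.
Variables (C : finType) (n : nat).
Implicit Types (d : gdata C n) (T : {set 'I_n}).

Lemma wt_monS (h : 'I_n -> Var C) T :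
  wt (monS h T) = \sum_(v in T) ((h v).2%:Z - 1).
Proof.
rewrite /monS (big_morph (@wt C) (@wtM C) (wt1 C)).
by apply: eq_bigr => v _; rewrite wtU.
Qed.

(** Counts the edges by target and by source: each vertex that is not a root is the source of
    exactly one. *)
Lemma sum_fert d T : supp_on d T ->
  (\sum_(v in T) fert d v + #|groots d T| = #|T|)%N.
Proof.
move=> s; rewrite -(cardsID (groots d T) T) addnC; congr (_ + _)%N.
  by apply: eq_card => v; rewrite !inE andbA andbb.
rewrite -[RHS]sum1_card [RHS](partition_big (fun v => odflt v (gout d v)) (fun v => v \in T)) /=.
  apply: eq_bigr => v vT; rewrite /fert -sum1_card; apply: eq_bigl => a; rewrite !inE.
  apply/idP/idP => [e|/andP[/andP[na aT]]].
    by have /andP[aT _] := supp_out s e; rewrite aT (eqP e) /= eqxx.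
  by move: na; rewrite aT /=; case: (gout d a) => //= x _ /eqP ->.
move=> a; rewrite !inE => /andP[na aT]; move: na; rewrite aT /=.
by case e: (gout d a) => [x|] //= _; have /andP[] : (a \in T) && (x \in T) by apply: (supp_out s); rewrite e.
Qed.

Lemma wt_roots d T (h : 'I_n -> Var C) : supp_on d T ->
  {in T, forall v, fert d v = (h v).2} -> wt (monS h T) = - (#|groots d T|)%:Z.
Proof.
move=> s f; rewrite wt_monS sumrB sumr_const -(sum_fert s) natz PoszD.
have -> : \sum_(v in T) (h v).2%:Z = (\sum_(v in T) fert d v)%N%:Z.
  by rewrite (big_morph Posz PoszD (erefl _)); apply: eq_bigr => v vT; rewrite f.
by rewrite opprD addrA subrr add0r.
Qed.

Lemma roots_le1 d T : supp_on d T -> conn d T -> (#|groots d T| <= 1)%N.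
Proof.
move=> /eqP s c; rewrite leqNgt; apply/negP => /card_gt1P[a [b]]; rewrite !inE.
move=> [/andP[aT /eqP ha] /andP[bT /eqP hb]] /eqP; apply.
by apply: (conn_root_uniq c); rewrite // s.
Qed.

(** The weight is minus the number of roots, and a connected graph has at most one root. *)
Lemma rooted_wt d T (h : 'I_n -> Var C) : supp_on d T -> conn d T ->
  {in T, forall v, fert d v = (h v).2} -> rooted d T = (wt (monS h T) == -1).
Proof.
move=> s c f; rewrite (wt_roots s f); have := roots_le1 s c.
have -> : rooted d T = (0 < #|groots d T|)%N.
  apply/existsP/card_gt0P => -[v]; rewrite ?inE (eqP s) => h1; exists v; by rewrite ?inE.
by case: #|_| => [|[|k]].
Qed.
End WtConn.

Section Exponential.
Variables (K : fieldType) (charK : [pchar K] =i pred0) (C : finType).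
Variables (E : comAlgType K) (u : ConnCls C -> E).
Implicit Types (k m r : Mon C).

(** The weight test is what confines the families of the LOT formula to weight -1. *)
Definition tree_gen k : E := if wt k == -1 then class_sum u k else 0.

Lemma tree_sum_gen n (h : 'I_n -> Var C) (T : {set 'I_n}) : tree_sum u h T = tree_gen (monS h T).
Proof.
rewrite /tree_gen /tree_sum; case: ifP => hw.
  rewrite -labelled_sum_conn //; apply: eq_bigl => o; rewrite /is_tree_on.
  case: (boolP (supp_on _ _)) => //= s; case: (boolP (fertok _ _ _)) => //= /forall_inP f.
  case: (boolP (conn _ _)) => //= c; rewrite (rooted_wt (h := h)) ?hw //.
  by move=> v vT; exact/eqP/f.
apply: big1 => o /and4P[s /forall_inP f c]; rewrite (rooted_wt (h := h)) ?hw //.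
by move=> v vT; exact/eqP/f.
Qed.

Definition dcoef m (Fr : {cmonom (Mon C)} * Mon C) : K :=
  (mfact m)%:R / ((sigmaS Fr.1)%:R * (mfact Fr.2)%:R).

(** The part of the LOT sum with families of size [t]. The right factor is an arbitrary [g],
    detached from [t], because the recursion lowers [t] and keeps [g]. *)
Definition fam_sum (g : Mon C -> E) t m : E :=
  \sum_(Fr <- decomps m | mdeg Fr.1 == t) dcoef m Fr *: (monev (class_sum u) Fr.1 * g Fr.2).

Lemma sigmaS_gt0 F : (0 < @sigmaS C F)%N.
Proof. by apply: sig_gt0 => k; apply: mfact_gt0. Qed.

Lemma fam_sum0 g m : fam_sum g 0 m = g m.
Proof.
rewrite /fam_sum (big_rem (mone, m)) /=; last first.
  apply/mem_decomps; split=> [k|] /=; first by rewrite mdom1 in_fset0.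
  by rewrite /famprod [flat _ _]flat1 mul1m.
rewrite mdeg1 eqxx monev1 mul1r /dcoef /= (_ : sigmaS mone = 1%N) ?mul1r; last exact: sig1.
rewrite divff ?natK_neq0 ?mfact_gt0 // scale1r big_seq_cond big1 ?addr0 // => -[F r].
rewrite mem_rem_uniq ?decomps_uniq // inE /= => /andP[/andP[ne /mem_decomps[_ /= e]]].
rewrite mdeg_eq0 => /eqP F1; move: ne e; rewrite F1 /famprod [flat _ _]flat1 mul1m => ne e.
by rewrite e eqxx in ne.
Qed.

(** Groups the vertex subsets by label multiset; [card_subset_monS] gives the size of each group. *)
Lemma subset_sum n (h : 'I_n -> Var C) (V : {set 'I_n}) (F : Mon C -> Mon C -> E) :
  \sum_(T : {set 'I_n} | T \subset V) F (monS h T) (monS h (V :\: T)) =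
  \sum_(k <- undup (divisors (monS h V)))
     ((mfact (monS h V))%:R / ((mfact k)%:R * (mfact (divcm (monS h V) k))%:R)) *:
        F k (divcm (monS h V) k).
Proof.
set m := monS h V.
transitivity (\sum_(T : {set 'I_n} | T \subset V) \sum_(k <- undup (divisors m) | k == monS h T)
    F k (divcm m k)).
  apply: eq_bigr => T sub; rewrite (big_rem (monS h T)) /=; last first.
    by rewrite mem_undup; apply/mem_divisors; exists (monS h (V :\: T)); rewrite -monSD.
  rewrite eqxx big_seq_cond big1 ?addr0 => [|k].
    by rewrite /m (monSD h sub) divcm_mul.
  by rewrite mem_rem_uniq ?undup_uniq // inE => /andP[/andP[/negbTE ->]].
rewrite (exchange_big_dep predT) //= big_seq [RHS]big_seq; apply: eq_bigr => k.
rewrite mem_undup => /mem_divisors[r er].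
have := card_subset_monS er; rewrite -/m; set N := #|_| => hN.
have -> : divcm m k = r by rewrite -er divcm_mul.
rewrite (eq_bigl (fun T => T \in [set S : {set 'I_n} | (S \subset V) && (monS h S == k)])); last first.
  by move=> T; rewrite inE eq_sym.
rewrite sumr_const -/N -scaler_nat; congr (_ *: _).
by rewrite -hN natrM natrM mulfK // mulf_neq0 // natK_neq0 ?mfact_gt0.
Qed.

(** The counterpart for multisets of distinguishing one tree of a forest: taking one copy of [k] out
    of [F] divides [sigmaS] by [F k * mfact k], and the multiplicities [F k] add up to [t.+1]. *)
Lemma fam_sum_rec g t m :
  fam_sum g t.+1 m *+ t.+1 =
  \sum_(k <- undup (divisors m))
     ((mfact m)%:R / ((mfact k)%:R * (mfact (divcm m k))%:R)) *: (tree_gen k * fam_sum g t (divcm m k)).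
Proof.
pose f (p : Mon C * ({cmonom (Mon C)} * Mon C)) : E :=
  ((mfact m)%:R / ((mfact p.1)%:R * ((sigmaS p.2.1)%:R * (mfact p.2.2)%:R))) *:
    (class_sum u p.1 * (monev (class_sum u) p.2.1 * g p.2.2)).
(* [l1] lists families with a distinguished member, [l2] a member followed by a family of what
   remains; they have the same entries. *)
pose l1 := [seq (k, (divcm Fr.1 (ucm k), Fr.2)) |
   Fr <- [seq Fr <- decomps m | mdeg Fr.1 == t.+1], k <- finsupp Fr.1].
pose l2 := [seq (k, Fr) | k <- [seq k <- undup (divisors m) | wt k == -1],
   Fr <- [seq Fr <- decomps (divcm m k) | mdeg Fr.1 == t]].
have dec_ex (p : Mon C * ({cmonom (Mon C)} * Mon C)) :
    wt p.1 = -1 -> dec_ok (divcm m p.1) p.2 -> (exists r, mmul p.1 r = m) ->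
    dec_ok m (mmul (ucm p.1) p.2.1, p.2.2).
  case: p => k [F r] /= wk [hw /= e] [q eq]; split=> /= [k'|].
    by rewrite mdomD mdomU in_fsetU in_fset1 => /orP[/eqP ->|/hw].
  by rewrite /famprod flatM flatU -mulmA -/(famprod F) e -eq divcm_mul.
have perm : perm_eq l1 l2.
  apply: uniq_perm.
  - apply: allpairs_uniq_dep; first by rewrite filter_uniq ?decomps_uniq.
      by move=> Fr _; apply: fset_uniq.
    move=> [[F r] k] [[F' r'] k'] /=.
    case/allpairsPdep => -[F1 r1] [k1 [_ h1 [-> -> ->]]] /allpairsPdep[[F2 r2] [k2 [_ h2 [-> -> ->]]]].
    move=> H; have e1 : k1 = k2 := congr1 fst H.
    have e2 : divcm F1 (ucm k1) = divcm F2 (ucm k2) := congr1 (fun p => p.2.1) H.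
    have e3 : r1 = r2 := congr1 (fun p => p.2.2) H.
    have e4 : F1 = F2.
      by apply: etrans (esym (ucm_div h1)) _; rewrite [X in mmul _ X]e2 e1; apply: (ucm_div h2).
    by rewrite e1 e3 e4.
  - apply: allpairs_uniq_dep; first by rewrite filter_uniq ?undup_uniq.
      by move=> k _; rewrite filter_uniq ?decomps_uniq.
    move=> [k Fr] [k' Fr'] _ _ H; have e1 : k = k' := congr1 fst H.
    by have e2 : Fr = Fr' := congr1 snd H; rewrite e1 e2.
  move=> [k [F r]]; apply/allpairsPdep/allpairsPdep.
    case=> -[F1 r1] [k1 []]; rewrite mem_filter /= => /andP[/eqP dF /mem_decomps[hw /= e]] hk.
    case=> -> -> ->; have eF := ucm_div hk.
    have em : mmul k1 (mmul (famprod (divcm F1 (ucm k1))) r1) = m.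
      by rewrite -e -[in RHS]eF /famprod flatM flatU mulmA.
    exists k1, (divcm F1 (ucm k1), r1); split=> //.
      rewrite mem_filter (hw _ hk) eqxx mem_undup /=; apply/mem_divisors; by eexists; apply: em.
    rewrite mem_filter /=; apply/andP; split.
      by move: dF; rewrite -[in LHS]eF mdegM mdegU add1n => -[->].
    apply/mem_decomps; split=> /= [k' hk'|]; last by rewrite -em divcm_mul.
    by apply: hw; rewrite -eF mdomD in_fsetU hk' orbT.
  case=> k1 [[F1 r1] []]; rewrite mem_filter mem_undup => /andP[/eqP wk /mem_divisors dk].
  rewrite mem_filter /= => /andP[/eqP dF /mem_decomps ok] [-> -> ->].
  exists (mmul (ucm k1) F1, r1), k1; split=> /=.
  - rewrite mem_filter /= mdegM mdegU dF add1n eqxx; apply/mem_decomps.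
    exact: (dec_ex (k1, (F1, r1))).
  - by rewrite mdomD mdomU in_fsetU in_fset1 eqxx.
  by rewrite divcm_mul.
transitivity (\sum_(p <- l1) f p).
  rewrite /l1 big_allpairs_dep big_filter -sumrMnl big_seq_cond [RHS]big_seq_cond.
  apply: eq_bigr => -[F r] /andP[/mem_decomps[hw /= e]] /eqP <-.
  rewrite mdegE -sumrMnr big_seq [RHS]big_seq; apply: eq_bigr => k hk.
  have eF := ucm_div hk; set F' := divcm F (ucm k) in eF *.
  have Fk : F k = (F' k).+1 by rewrite -eF cmM cmUU add1n.
  rewrite -scaler_nat scalerA /f /dcoef /= -[in sigmaS F]eF -[in monev _ F]eF.
  rewrite monevM monevU -mulrA; congr (_ *: _).
  have -> : sigmaS (mmul (ucm k) F') = (F k * mfact k * sigmaS F')%N.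
    by rewrite Fk; apply: sigU.
  have n1 := natK_neq0 charK (mfact_gt0 k); have n2 := natK_neq0 charK (sigmaS_gt0 F').
  have n3 := natK_neq0 charK (mfact_gt0 r); have n4 : (F k)%:R != 0 :> K by rewrite natK_neq0 // Fk.
  by rewrite !natrM mulrCA -!mulrA [X in _ * (_ * X)]invfM mulVKf.
rewrite (perm_big _ perm) /l2 big_allpairs_dep big_filter big_mkcond /=.
rewrite big_seq [RHS]big_seq; apply: eq_bigr => k.
rewrite mem_undup => /mem_divisors[q eq]; rewrite /tree_gen; case: ifP => wk; last first.
  by rewrite mul0r scaler0.
rewrite big_filter /fam_sum mulr_sumr scaler_sumr; apply: eq_bigr => -[F r] _ /=.
rewrite -scalerAr scalerA /f /dcoef /=; congr (_ *: _).
have n1 := natK_neq0 charK (mfact_gt0 (divcm m k)).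
rewrite -!mulrA; congr (_ * _); rewrite !invfM -!mulrA; congr (_ * _).
by rewrite mulrA mulVf // mul1r.
Qed.

(* Both sides satisfy the recursion obtained by pointing one of the t trees,
   namely forest_sum_rec and fam_sum_rec. *)
Lemma exponential n (h : 'I_n -> Var C) t (V : {set 'I_n}) g :
  \sum_(B : {set 'I_n} | B \subset V) forest_sum u h t (V :\: B) * g (monS h B) = fam_sum g t (monS h V).
Proof.
elim: t V => [|t IH] V.
  rewrite fam_sum0 (bigD1 V) //= setDv forest_sum_0 eqxx mul1r big1 ?addr0 // => B /andP[sub ne].
  rewrite forest_sum_0 setD_eq0; case: ifP => h1; rewrite ?mul0r //.
  by case/eqP: ne; apply/eqP; rewrite eqEsubset sub h1.
suff: (\sum_(B : {set 'I_n} | B \subset V) forest_sum u h t.+1 (V :\: B) * g (monS h B)) *+ t.+1 =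
  fam_sum g t.+1 (monS h V) *+ t.+1.
  rewrite -!scaler_nat => /(congr1 (fun x => (t.+1%:R)^-1 *: x)).
  by rewrite !scalerA mulVf ?natK_neq0 // !scale1r.
rewrite fam_sum_rec -(subset_sum h V (fun k r => tree_gen k * fam_sum g t r)) -sumrMnl.
transitivity (\sum_(B : {set 'I_n} | B \subset V) \sum_(T : {set 'I_n} | T \subset V :\: B)
   tree_sum u h T * forest_sum u h t (V :\: B :\: T) * g (monS h B)).
  by apply: eq_bigr => B _; rewrite -mulrnAl forest_sum_rec mulr_suml.
rewrite (exchange_big_dep (fun T : {set 'I_n} => T \subset V)) /=; last first.
  by move=> B T _ sub; apply: subset_trans sub (subsetDl _ _).
apply: eq_bigr => T sub; rewrite -IH mulr_sumr tree_sum_gen; apply: eq_big => [B|B _].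
  rewrite !subsetD sub /= disjoint_sym; by case: (B \subset V).
by rewrite -mulrA; congr (_ * (forest_sum u h t _ * _)); rewrite !setDDl setUC.
Qed.
End Exponential.

(** * The coproduct identity on generators *)

Section Generator.
Variables (K : fieldType) (charK : [pchar K] =i pred0) (C : finType).
Variables (E : comAlgType K) (u w : ConnCls C -> E).
Implicit Types (k m r : Mon C).

(** A connected graph has a vertex. Hence the empty [B] contributes nothing and may be added to the
    exponential formula. *)
Lemma class_sum_mone (f : ConnCls C -> E) : class_sum f mone = 0.
Proof.
rewrite /class_sum big_seq_cond big1 // => x /andP[]; rewrite mdeg1 => /classesP[r hr].
by have /andP[/andP[]] := valP x; rewrite hr.
Qed.

Lemma dbar_ext_mone t : dbar_ext (class_sum w) t mone = 0.
Proof.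
case: t => [|t]; first by rewrite /dbar_ext /= linextU class_sum_mone.
by rewrite dbar_extS big_seq_cond big1 // => i /andP[]; rewrite mdom1 in_fset0.
Qed.

(** Supplies the labelled vertex set on which the identity for [m] is proved. *)
Lemma enum_mon m : exists h : 'I_(mdeg m) -> Var C, monS h setT = m.
Proof.
have sz : size (factors m) = mdeg m.
  rewrite /factors size_flatten /shape -map_comp sumnE big_map; apply: eq_bigr => i _.
  by rewrite /= size_nseq.
exists (fun i => tnth (in_tuple (factors m)) (cast_ord (esym sz) i)).
rewrite -[RHS]lcmon_factors /lcmon big_tnth /monS.
rewrite (reindex (cast_ord sz)) /=; last first.
  by exists (cast_ord (esym sz)) => i _; rewrite ?cast_ordK ?cast_ordKV.
by apply: eq_big => i; rewrite ?inE // => _; rewrite cast_ordK.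
Qed.

Definition cutw (x : ConnCls C) := cutsum u w (tagged (val x)).

Lemma cut_generator m :
  \sum_(Fr <- decomps m) dcoef K m Fr *:
     (monev (class_sum u) Fr.1 * dbar_ext (class_sum w) (mdeg Fr.1) Fr.2) = class_sum cutw m.
Proof.
have [h <-] := enum_mon m; set n := mdeg m in h *.
rewrite -labelled_sum_sub //; pose P (o : {ffun 'I_n -> option 'I_n}) := fertok h o setT.
transitivity (\sum_(o : {ffun 'I_n -> option 'I_n} | gconnected (graph_of h o) && P o) fwd_closed_sum u w (graph_of h o)); last first.
  rewrite big_mkcond [RHS]big_mkcond /=; apply: eq_bigr => o _; rewrite clsS_setT -/(P o).
  have -> : supp_on (graph_of h o) setT by apply: supp_onP => a b; rewrite !inE.
  rewrite /=; case: (boolP (gconnected _)) => [c|/clsOf_None ->]; last by rewrite /=; case: ifP.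
  have [x ex] := clsOfP c; rewrite ex /= /cutw cut_sum; last by have /andP[] := valP x.
  by rewrite (fwd_closed_sum_cls _ _ ex) /P /fertok; case: ifP.
rewrite /fwd_closed_sum (exchange_big_dep (fun B : {set 'I_n} => B != set0)) /=; last by move=> o B _ /andP[].
transitivity (\sum_(B : {set 'I_n} | B != set0) \sum_(t < n.+1)
   forest_sum u h t (~: B) * dbar_ext (class_sum w) t (monS h B)); last first.
  apply: eq_bigr => B B0.
  rewrite (eq_bigl (fun o => [&& gconnected (graph_of h o), fertok h o setT & fwd_closed (graph_of h o) B])); last first.
    by move=> o; rewrite B0 /= -andbA.
  (* Sort by the number of trees; [inord] is faithful because at most [n] roots fit on the vertex
     set. *)
  rewrite fwd_closed_sum1 // [RHS](partition_big (fun o => inord #|pcomps (graph_of h o) (~: B)| : 'I_n.+1) predT) //=.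
  apply: eq_bigr => t _; rewrite /forest_sum mulr_suml.
  have le o : is_any_forest h (~: B) o -> (#|pcomps (graph_of h o) (~: B)| <= n)%N.
    case/and3P => s _ f; rewrite -card_roots //.
    by have := max_card (mem (groots (graph_of h o) (~: B))); rewrite card_ord.
  apply: eq_big => [o|o]; rewrite /is_forest_on /is_any_forest.
    rewrite !andbA -[_ && forest _ _]andbA; case: (boolP [&& _, _ & _]) => // H.
    by rewrite -val_eqE /= inordK // ltnS le.
  by case/and4P => _ _ _ /eqP ->.
rewrite exchange_big /=.
transitivity (\sum_(t < n.+1) fam_sum u (dbar_ext (class_sum w) t) t (monS h setT)); last first.
  apply: eq_bigr => t _; rewrite -(exponential charK).
  rewrite (bigD1 set0) ?sub0set //= monS0 dbar_ext_mone mulr0 add0r.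
  by apply: eq_big => [B|B _]; rewrite ?subsetT // setTD.
rewrite (partition_big (fun Fr : {cmonom (Mon C)} * Mon C => inord (mdeg Fr.1) : 'I_n.+1) predT) //=.
have bnd Fr : Fr \in decomps (monS h setT) -> (mdeg Fr.1 < n.+1)%N.
  case/mem_decomps => hw e; rewrite ltnS.
  have -> : n = mdeg (monS h setT) by rewrite mdeg_monS cardsT card_ord.
  rewrite -e mdegM; apply: leq_trans (leq_addr _ _); apply: mdeg_famprod => k /hw wk.
  by apply: contra_eqN wk => /eqP ->; rewrite wt1.
apply: eq_bigr => t _; rewrite /fam_sum big_seq_cond [RHS]big_seq_cond; apply: eq_big => [Fr|Fr].
  by apply: andb_id2l => hF; rewrite -val_eqE /= inordK // bnd.
by case/andP => hF /eqP <-; rewrite inordK // bnd.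
Qed.
End Generator.

Section ClassWt.
Variable C : finType.
Implicit Types x : ConnCls C.

Lemma class_gconnected x : gconnected (tagged (val x)).
Proof. by have /andP[] := valP x. Qed.

Lemma PhiC_wt x : wt (PhiC x) = if isTree x then -1 else 0.
Proof.
rewrite /PhiC /isTree; have := class_gconnected x; case: (val x) => n d /= c.
have s : supp_on d setT by apply: supp_onP => a b; rewrite !inE.
rewrite Phig_monS (wt_roots (d := d)) //.
have := roots_le1 s; rewrite conn_setT => /(_ c).
have -> : has_root d = (0 < #|groots d setT|)%N.
  by apply/existsP/card_gt0P => -[v]; rewrite ?inE => h1; exists v; rewrite ?inE.
by case: #|_| => [|[|k]].
Qed.

Lemma PhiC_neq1 x : PhiC x != mone.
Proof.
rewrite /PhiC; have := class_gconnected x; case: (val x) => n d /= /andP[n0 _].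
by rewrite -mdeg_eq0 Phig_monS mdeg_monS cardsT card_ord -lt0n.
Qed.

Lemma PhiC_isMgen x : isMgen (PhiC x).
Proof. by rewrite /isMgen PhiC_wt; case: (isTree x); rewrite ?PhiC_neq1. Qed.

Lemma PhiC_isTree x (v : MonG C) : PhiC x = val v ->
  (if is_wm1 v then isTree x else ~~ isTree x).
Proof.
move=> e; rewrite /is_wm1 -e PhiC_wt; by case: (isTree x).
Qed.
End ClassWt.

(** * The coproduct identity for j^aro *)

Section Jaro.
Variables (K : fieldType) (charK : [pchar K] =i pred0) (C : finType).

Definition AFgen (x : ConnCls C) : AF K C := << ucm x >>.

Lemma jaro_genE (v : MonG C) : jaro_gen K v = class_sum AFgen (val v).
Proof.
rewrite /jaro_gen /class_sum; apply: eq_bigl => x.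
by case: eqP => //= e; apply: PhiC_isTree.
Qed.

HB.instance Definition _ := GRing.LRMorphism.copy (@jaro K C) (algext (@jaro_gen K C)).

Lemma jaroU (v : MonG C) : jaro << ucm v >> = class_sum AFgen (val v).
Proof. by apply: etrans (algextU _ _) _; apply: jaro_genE. Qed.

(** Holds for every monomial: if [k] is not a generator, [varAM] is zero by default and no connected
    graph has fertility monomial [k]. *)
Lemma jaro_varAM k : jaro (varAM K k) = class_sum AFgen k.
Proof.
rewrite /varAM; case: insubP => [v _ <-|nk]; first exact: jaroU.
rewrite linear0 /class_sum big1 // => x /eqP e; by rewrite -e PhiC_isMgen in nk.
Qed.

Local Notation E2 := {malg K[mprod (AFb C) (AFb C)]}.
(** [AFgenl] and [AFgenr] are the weights [u] and [w] for which [cutsum] becomes the BCK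
    coproduct. *)
Definition AFgenl (x : ConnCls C) : E2 := tens (AFgen x) 1.
Definition AFgenr (x : ConnCls C) : E2 := tens 1 (AFgen x).

Lemma class_sum_genl k : tens (class_sum AFgen k) 1 = class_sum AFgenl k.
Proof.
rewrite /class_sum tens_suml; apply: eq_bigr => x _; exact: tensZl.
Qed.
Lemma class_sum_genr k : tens 1 (class_sum AFgen k) = class_sum AFgenr k.
Proof.
rewrite /class_sum linear_sum; apply: eq_bigr => x _; exact: linearZ.
Qed.

Lemma tens_split (M1 M2 : conomType) (a : {malg K[M1]}) (b : {malg K[M2]}) :
  tens a b = tens a 1 * tens 1 b.
Proof. by rewrite -tensM mulr1 mul1r. Qed.

Lemma tens_prodl (M1 M2 : conomType) I (r : seq I) P (F : I -> {malg K[M1]}) :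
  tens (\prod_(i <- r | P i) F i) 1 = \prod_(i <- r | P i) tens (F i) 1 :> {malg K[mprod M1 M2]}.
Proof.
elim/big_rec2: _ => [|i a b _ <-]; first exact: tens11.
by rewrite -tensM mulr1.
Qed.

Lemma tens_expl (M1 M2 : conomType) (a : {malg K[M1]}) n :
  tens (a ^+ n) 1 = (tens a 1) ^+ n :> {malg K[mprod M1 M2]}.
Proof.
elim: n => [|n IH]; first by rewrite !expr0; apply: tens11.
by rewrite !exprS -IH -tensM mulr1.
Qed.

Lemma jaro_famAM F : tens (jaro (famAM K F)) 1 = monev (class_sum AFgenl) F.
Proof.
rewrite /famAM rmorph_prod tens_prodl /monev; apply: eq_bigr => k _.
by rewrite rmorphXn /= tens_expl jaro_varAM class_sum_genl.
Qed.

Lemma jaro_polyAM t r : tens 1 (jaro (polyAM (iter t (@dbar K C) << r >>))) = dbar_ext (class_sum AFgenr) t r.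
Proof.
pose f : {linear {malg K[Mon C]} -> E2} :=
  @tens K (AFb C) (AFb C) 1 \o (@jaro K C \o linext (@varAM K C)).
apply: (eq_linear_malg (f := f) (g := linext (class_sum AFgenr))) => b.
apply: etrans _ (esym (linextU _ _)); rewrite -class_sum_genr -jaro_varAM.
by congr (tens 1 (jaro _)); apply: linextU.
Qed.

Lemma clsv_genl n (d : gdata C n) (S : {set 'I_n}) :
  tens (clsv K (tagged (subg d S))) 1 = owt AFgenl (clsS d S).
Proof. by rewrite clsS.unlock /clsv; case: (clsOf _) => [x|] //=; rewrite tens0l. Qed.
Lemma clsv_genr n (d : gdata C n) (S : {set 'I_n}) :
  tens 1 (clsv K (tagged (subg d S))) = owt AFgenr (clsS d S).
Proof. by rewrite clsS.unlock /clsv; case: (clsOf _) => [x|] //=; rewrite linear0. Qed.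

Lemma DeltaBCK_genE x : DeltaBCK_gen K x = AFgenl x + cutw AFgenl AFgenr x.
Proof.
rewrite /DeltaBCK_gen; congr (_ + _); apply: eq_bigr => c _.
rewrite /cut_term tens_split tens_prodl linear_sum; congr (_ * _).
  by apply: eq_bigr => S _; apply: clsv_genl.
by apply: eq_bigr => S _; apply: clsv_genr.
Qed.

HB.instance Definition _ := GRing.LRMorphism.copy (@DeltaBCKaro K C) (algext (@DeltaBCK_gen K C)).
HB.instance Definition _ := GRing.LRMorphism.copy (@DeltaLOTaro K C) (algext (@DeltaLOT_gen K C)).
HB.instance Definition _ := GRing.Linear.copy (@jaro2 K C)
  (tmap (fun a : AMb C => @jaro K C << a >>) (fun a : AMb C => @jaro K C << a >>)).

Lemma linext_jaro (x : AM K C) : linext (fun a : AMb C => @jaro K C << a >>) x = jaro x.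
Proof. by apply/esym/eq_linear_malg => b; rewrite /= linextU. Qed.

Lemma jaro2_tens (x y : AM K C) : @jaro2 K C (tens x y) = tens (jaro x) (jaro y).
Proof. by apply: etrans (tmap_tens _ _ _ _) _; rewrite !linext_jaro. Qed.

Lemma jaro2_mult : monoid_morphism (@jaro2 K C).
Proof.
split; first by rewrite -tens11 jaro2_tens !rmorph1 tens11.
apply: tmap_mul => a b; by rewrite -malgUM rmorphM.
Qed.

(** The terms with right factor [1] agree separately; the others are [cut_generator] for the weights
    [AFgenl] and [AFgenr]. *)
Lemma jaro_Delta_gen (v : MonG C) : jaro2 (DeltaLOT_gen K v) = DeltaBCKaro (jaro_gen K v).
Proof.
rewrite /DeltaLOT_gen linearD.
transitivity (class_sum AFgenl (val v) + class_sum (cutw AFgenl AFgenr) (val v)).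
  congr (_ + _).
    apply: etrans (jaro2_tens _ _) _; rewrite -class_sum_genl.
    by congr (tens _ _); [apply: jaroU | apply: rmorph1].
  rewrite -(cut_generator charK) linear_sum; apply: eq_bigr => Fr _.
  rewrite linearZ; congr (_ *: _); apply: etrans (jaro2_tens _ _) _.
  apply: etrans (tens_split _ _) _.
  by congr (_ * _); [apply: jaro_famAM | apply: jaro_polyAM].
rewrite jaro_genE /class_sum linear_sum -big_split; apply: eq_bigr => x _ /=.
rewrite linearZ /= -scalerDr; congr (_ *: _); rewrite -DeltaBCK_genE.
exact/esym/algextU.
Qed.

Lemma jaro_Delta (x : AM K C) : jaro2 (@DeltaLOTaro K C x) = DeltaBCKaro (jaro x).
Proof.
pose f : {linear AM K C -> E2} := @jaro2 K C \o @DeltaLOTaro K C.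
pose g : {linear AM K C -> E2} := @DeltaBCKaro K C \o @jaro K C.
apply: (eq_lrmorphism_malg (f := f) (g := g)).
- have [j1 jM] := jaro2_mult; split; first by rewrite /f /= rmorph1.
  by move=> a b; rewrite /f /= rmorphM jM.
- by split; [rewrite /g /= !rmorph1 | move=> a b; rewrite /g /= !rmorphM].
move=> v; rewrite /f /g /=; have -> : DeltaLOTaro << ucm v >> = DeltaLOT_gen K v by apply: algextU.
by rewrite jaro_Delta_gen; congr DeltaBCKaro; apply/esym/algextU.
Qed.
End Jaro.

(** * Clumpings as multilinear sums *)

Section Ins.
Variables (T : Type) (op : T -> T -> T).
(** [ins] multiplies one entry by [k] in every possible way, as in the Leibniz rule; [clumps] thus
    runs over all assignments of the [ks] to the entries of [ts], with repetitions. *)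
Fixpoint ins k (ts : seq T) : seq (seq T) :=
  if ts is t :: ts' then (op k t :: ts') :: [seq t :: l | l <- ins k ts'] else [::].
Fixpoint clumps ks (ts : seq T) : seq (seq T) :=
  if ks is k :: ks' then flatten [seq clumps ks' l | l <- ins k ts] else [:: ts].

(** Exhibits the last factor of [ks] as a single insertion into the clumpings of the others, which
    is the form needed to read it as a derivation. *)
Lemma clumps_rcons ks k ts :
  clumps (rcons ks k) ts = flatten [seq ins k l | l <- clumps ks ts].
Proof.
elim: ks ts => [|k' ks IH] ts /=.
  by rewrite cats0; elim: (ins k ts) => //= l s ->.
rewrite map_flatten -map_comp.
have -> : [seq clumps (rcons ks k) l | l <- ins k' ts] =
  [seq flatten [seq ins k l' | l' <- clumps ks l] | l <- ins k' ts] by apply: eq_map.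
by elim: (ins k' ts) => //= l s IHs; rewrite flatten_cat IHs.
Qed.

Lemma ins_cat k ts1 t ts2 : ins k (ts1 ++ t :: ts2) =
  [seq l ++ t :: ts2 | l <- ins k ts1] ++ (ts1 ++ op k t :: ts2) ::
  [seq ts1 ++ t :: l | l <- ins k ts2].
Proof.
elim: ts1 => [|t1 ts1 IH] //=; rewrite IH /= map_cat /= -!map_comp.
by congr (_ :: _ ++ _ :: _); rewrite -map_comp; apply: eq_map.
Qed.
End Ins.

Section InsMap.
Variables (T T' : Type) (op : T -> T -> T) (op' : T' -> T' -> T') (j : T -> T').
Hypothesis jop : {morph j : a b / op a b >-> op' a b}.
Lemma ins_map k ts : ins op' (j k) (map j ts) = map (map j) (ins op k ts).
Proof.
elim: ts => //= t ts ->; rewrite jop; congr (_ :: _).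
by rewrite -!map_comp; apply: eq_map.
Qed.
Lemma clumps_map ks ts : clumps op' (map j ks) (map j ts) = map (map j) (clumps op ks ts).
Proof.
elim: ks ts => //= k ks IH ts; rewrite ins_map map_flatten -!map_comp; congr flatten.
by apply: eq_map => l /=; rewrite IH.
Qed.
End InsMap.

Section Multilinear.
Variables (K : fieldType) (A : algType K) (E : comAlgType K) (theta : {linear A -> E}).
Implicit Types (ks ts l : seq A).

(** [theta] reads a product of one tree with non-trees as a clump. Linear in each entry of both
    lists, so it can be expanded along linear combinations. *)
Definition clump_sum ks ts : E := \sum_(l <- clumps *%R ks ts) \prod_(a <- l) theta a.

Lemma clump_sum_cons k ks ts : clump_sum (k :: ks) ts = \sum_(l <- ins *%R k ts) clump_sum ks l.
Proof. by rewrite /clump_sum /= big_flatten /= big_map. Qed.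

Lemma clump_sum_lin_t ks ts1 ts2 c a b :
  clump_sum ks (ts1 ++ (c *: a + b) :: ts2) = c *: clump_sum ks (ts1 ++ a :: ts2) + clump_sum ks (ts1 ++ b :: ts2).
Proof.
elim: ks ts1 ts2 a b => [|k ks IH] ts1 ts2 a b.
  rewrite /clump_sum /= !big_seq1 !big_cat !big_cons /= linearP.
  by rewrite mulrDl mulrDr -scalerAl -scalerAr.
rewrite !clump_sum_cons !ins_cat !big_cat !big_cons /= !big_map mulrDr -scalerAr IH.
rewrite (eq_bigr _ (fun l _ => IH l ts2 a b)) [X in _ + (_ + X)](eq_bigr _ (fun l _ => IH ts1 l a b)).
by rewrite !big_split /= -!scaler_sumr [X in _ + X]addrACA addrACA !scalerDr.
Qed.

Lemma clump_sum_lin_k ks1 ks2 ts c a b :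
  clump_sum (ks1 ++ (c *: a + b) :: ks2) ts = c *: clump_sum (ks1 ++ a :: ks2) ts + clump_sum (ks1 ++ b :: ks2) ts.
Proof.
elim: ks1 ts => [|k ks IH] ts /=.
  rewrite !clump_sum_cons; suff H ts1 : \sum_(l <- ins *%R (c *: a + b) ts) clump_sum ks2 (ts1 ++ l) =
     c *: (\sum_(l <- ins *%R a ts) clump_sum ks2 (ts1 ++ l)) + \sum_(l <- ins *%R b ts) clump_sum ks2 (ts1 ++ l).
    exact: (H [::]).
  elim: ts ts1 => [|t ts IH] ts1 /=; first by rewrite !big_nil scaler0 addr0.
  rewrite !big_cons !big_map mulrDl -scalerAl clump_sum_lin_t.
  have e x : \sum_(j <- ins *%R x ts) clump_sum ks2 (ts1 ++ t :: j) =
      \sum_(l <- ins *%R x ts) clump_sum ks2 (rcons ts1 t ++ l).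
    by apply: eq_bigr => l _; rewrite cat_rcons.
  by rewrite !e IH addrACA scalerDr.
rewrite !clump_sum_cons scaler_sumr -big_split; apply: eq_bigr => l _; exact: IH.
Qed.

Lemma clump_sum_0t ks ts1 ts2 : clump_sum ks (ts1 ++ 0 :: ts2) = 0.
Proof.
have := clump_sum_lin_t ks ts1 ts2 (-1) 0 0; by rewrite scaler0 addr0 scaleN1r addNr.
Qed.
Lemma clump_sum_0k ks1 ks2 ts : clump_sum (ks1 ++ 0 :: ks2) ts = 0.
Proof.
have := clump_sum_lin_k ks1 ks2 ts (-1) 0 0; by rewrite scaler0 addr0 scaleN1r addNr.
Qed.

Lemma clump_sum_sum_t (J : Type) (r : seq J) (P : pred J) (c : J -> K) (a : J -> A) ks ts1 ts2 :
  clump_sum ks (ts1 ++ (\sum_(i <- r | P i) c i *: a i) :: ts2) =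
  \sum_(i <- r | P i) c i *: clump_sum ks (ts1 ++ a i :: ts2).
Proof.
elim: r => [|i r IH]; first by rewrite !big_nil clump_sum_0t.
by rewrite !big_cons; case: (P i); rewrite // clump_sum_lin_t IH.
Qed.
Lemma clump_sum_sum_k (J : Type) (r : seq J) (P : pred J) (c : J -> K) (a : J -> A) ks1 ks2 ts :
  clump_sum (ks1 ++ (\sum_(i <- r | P i) c i *: a i) :: ks2) ts =
  \sum_(i <- r | P i) c i *: clump_sum (ks1 ++ a i :: ks2) ts.
Proof.
elim: r => [|i r IH]; first by rewrite !big_nil clump_sum_0k.
by rewrite !big_cons; case: (P i); rewrite // clump_sum_lin_k IH.
Qed.
End Multilinear.

(** Links the recursive enumeration with the one by functions used for [clumpingsM] and
    [clumpingsF]. *)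
Lemma clumps_assign (I : choiceType) (ks ts l : seq {cmonom I}) :
  l \in clumps mmul ks ts ->
  exists F : nat -> nat, (forall k, (k < size ks)%N -> (F k < size ts)%N) /\
    size l = size ts /\ forall i, (i < size ts)%N ->
    nth mone l i = mmul (nth mone ts i) (\big[mmul/mone]_(k < size ks | F k == i) nth mone ks k).
Proof.
elim: ks ts l => [|k ks IH] ts l /=.
  rewrite inE => /eqP ->; exists id; split=> //; split=> // i _.
  by rewrite big_ord0 mulm1.
case/flattenP => _ /mapP[l' hl' ->] /IH[F [hF [hs hn]]].
have [i0 [i0s e0 e1 es]] : exists i0, [/\ (i0 < size ts)%N, nth mone l' i0 = mmul k (nth mone ts i0),
    forall i, i != i0 -> nth mone l' i = nth mone ts i & size l' = size ts].
  elim: ts l' hl' {hs hn hF l} => //= t ts IHt l'; rewrite inE => /orP[/eqP ->|/mapP[l2 /IHt[i [h0 h1 h2 h3]] ->]].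
    by exists 0%N; split=> // -[].
  exists i.+1; split=> //=; last by rewrite h3.
  by case=> //= i' ne; apply: h2.
exists (fun n => if n is n'.+1 then F n' else i0); split; last split.
- by case=> //= k' hk'; rewrite -es; apply: hF.
- by rewrite hs es.
move=> i his; rewrite hn ?es //; rewrite [in RHS]big_mkcond big_ord_recl -big_mkcond /=.
case: (eqVneq i0 i) => [<-|ne]; first by rewrite e0 [mmul k _]mulmC mulmA.
by rewrite mul1m e1 1?eq_sym.
Qed.

Lemma leibniz_step (K : fieldType) (A : comAlgType K) (D : {linear A -> A}) c a x y :
  D (a * y) = D a * y + a * D y -> D (x * y) = D x * y + x * D y ->
  D ((c *: a + x) * y) = D (c *: a + x) * y + (c *: a + x) * D y.
Proof.
move=> h1 h2; rewrite mulrDl -scalerAl !linearP /= h1 h2 !mulrDl -!scalerAl scalerDr.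
exact: addrACA.
Qed.

Lemma leibniz_sym (K : fieldType) (A : comAlgType K) (D : {linear A -> A}) x y :
  D (x * y) = D x * y + x * D y -> D (y * x) = D y * x + y * D x.
Proof. by rewrite mulrC => ->; rewrite addrC; congr (_ + _); apply: mulrC. Qed.

Lemma exch_cond (I : choiceType) (a b r c : {cmonom I}) :
  (mmul b r == c) = (mmul (mmul a r) b == mmul c a).
Proof.
rewrite [mmul c a]mulmC -mulmA [mmul r b]mulmC.
by apply/eqP/eqP => [->|/mulIcm].
Qed.

Lemma mem_ucm (I : choiceType) (i j : I) : (i \in finsupp (ucm j)) = (i == j).
Proof. by rewrite mdomU in_fset1. Qed.

Lemma mem_mulU (I : choiceType) (i j : I) (m : {cmonom I}) :
  (i \in finsupp (mmul m (ucm j))) = (i \in finsupp m) || (i == j).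
Proof. by rewrite mdomD in_fsetU mem_ucm. Qed.

Lemma mem_Umul (I : choiceType) (i j : I) (m : {cmonom I}) :
  (i \in finsupp (mmul (ucm j) m)) = (i == j) || (i \in finsupp m).
Proof. by rewrite mdomD in_fsetU mem_ucm. Qed.

(** The arithmetic behind [step] in [Psi_coef]: [ry], [rY], [yk] stand for multiplicities, [wk],
    [S], [R] for symmetry factors of a generator, a clump and the remaining clumps. *)
Lemma frac_id (K : fieldType) (B ry rY yk wk S R : K) :
  ry != 0 -> rY != 0 -> yk != 0 -> wk != 0 ->
  ry * (B / (ry * S * R)) = B * wk / (rY * (yk * wk * S) * R) * (rY * yk).
Proof.
move=> n1 n2 n3 n4; have -> : rY * (yk * wk * S) * R = wk * (rY * yk) * (S * R).
  by rewrite !mulrA [rY * yk * wk]mulrC -!mulrA.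
have : rY * yk != 0 by rewrite mulf_neq0.
rewrite -(mulrA ry) (invfM ry) (invfM (wk * _)) mulrCA mulVKf //.
move: (rY * yk) (S * R)^-1 => N X n5; transitivity (B * (wk * ((wk * N)^-1 * (X * N)))); last by rewrite !mulrA.
congr (B * _); rewrite [X * N]mulrC [RHS]mulrCA [wk * (N * X)]mulrA [RHS]mulKf //.
by rewrite mulf_neq0.
Qed.

Lemma sum_pick (K : fieldType) (T : choiceType) (s : {fset T}) (P Q : pred T) (f : T -> K) y0 (cnd : bool) :
  (forall y, P y = (y == y0)) -> cnd = Q y0 -> (cnd -> y0 \in s) ->
  f y0 * cnd%:R = \sum_(y <- s) (if P y && Q y then f y else 0).
Proof.
move=> hP -> hs; case hQ: (Q y0); last first.
  by rewrite mulr0 big1 // => y _; rewrite hP; case: (eqVneq y y0) => //= ->; rewrite hQ.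
rewrite (big_fsetD1 y0) ?hs //= hP eqxx hQ mulr1 big_seq big1 ?addr0 // => y.
by rewrite in_fsetD1 hP => /andP[/negbTE ->].
Qed.

(** * Coefficients of clump sums, for arbitrary generators *)

Section Coef.
Variables (K : fieldType) (charK : [pchar K] =i pred0).
Variables (I : choiceType) (isT : pred I) (w : I -> nat).
Hypothesis w0 : forall i, (0 < w i)%N.
Definition ntr (b : {cmonom I}) : nat := (\sum_(v <- finsupp b | isT v) b v)%N.
Definition one_tree := {b : {cmonom I} | ntr b == 1%N}.
Implicit Types (b m : {cmonom I}) (c : {cmonom one_tree}) (y Y : one_tree).

Local Notation sI := (sig w).
Definition sY := sig (fun y : one_tree => sI (val y)).
Local Notation phi := (flat (fun y : one_tree => val y)).

Lemma ntrEw (d : {fset I}) b : (finsupp b `<=` d)%fset ->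
  ntr b = (\sum_(v <- d | isT v) b v)%N.
Proof.
move=> le; rewrite /ntr big_mkcond [RHS]big_mkcond /=.
rewrite (big_fset_incl _ le) //= => v _.
by rewrite -cmE_eq0 => /eqP ->; case: ifP.
Qed.
Lemma ntrM b m : ntr (mmul b m) = (ntr b + ntr m)%N.
Proof.
pose d := (finsupp b `|` finsupp m)%fset.
rewrite (@ntrEw d) ?mdomD // (@ntrEw d b) ?fsubsetUl // (@ntrEw d m) ?fsubsetUr //.
by rewrite -big_split; apply: eq_bigr => v _ /=; rewrite cmM.
Qed.
Lemma ntr1 : ntr mone = 0%N.
Proof. by rewrite /ntr big_mkcond mdom1 big_seq_fset0. Qed.
Lemma ntrU v : ntr (ucm v) = isT v.
Proof.
rewrite /ntr mdomU big_mkcond big_seq_fset1 cmUU; by case: (isT v).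
Qed.

Lemma sI_gt0 b : (0 < sI b)%N. Proof. exact: sig_gt0. Qed.
Lemma sY_gt0 c : (0 < sY c)%N. Proof. by apply: sig_gt0 => y; apply: sI_gt0. Qed.

Section Der.
Variable k : I.
Hypothesis kT : ~~ isT k.

Lemma kap_subproof y : ntr (mmul (ucm k) (val y)) == 1%N.
Proof. by rewrite ntrM ntrU (negbTE kT) add0n (valP y). Qed.
Definition kap y : one_tree := Sub (mmul (ucm k) (val y)) (kap_subproof y).
Lemma kapE y : val (kap y) = mmul (ucm k) (val y). Proof. exact: SubK. Qed.
Lemma kap_inj : injective kap.
Proof. by move=> y y' /(congr1 val); rewrite !kapE => /mulIcm /val_inj. Qed.

Lemma kap_onto Y : (0 < val Y k)%N -> exists y, kap y = Y.
Proof.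
move=> h; have e : mmul (ucm k) (divcm (val Y) (ucm k)) = val Y by rewrite ucm_div // -cmE_neq0 -lt0n.
have n1 : ntr (divcm (val Y) (ucm k)) == 1%N.
  by have := valP Y; rewrite -{1}e ntrM ntrU (negbTE kT).
by exists (Sub (divcm (val Y) (ucm k)) n1); apply: val_inj; rewrite kapE SubK e.
Qed.

(** Division by [k]; the default [Y] is used only where the quotient has not exactly one tree. *)
Definition unkap Y : one_tree := odflt Y (insub (divcm (val Y) (ucm k))).
Lemma kapK : cancel kap unkap.
Proof. by move=> y; rewrite /unkap kapE divcm_mul valK. Qed.
Lemma unkapK Y : (0 < val Y k)%N -> kap (unkap Y) = Y.
Proof. by move/kap_onto => [y <-]; rewrite kapK. Qed.

Local Notation CM := {malg K[{cmonom one_tree}]}.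

(** The derivation of the clump algebra that sends each clump [y] to [kap y]. *)
Definition der_b c : CM :=
  \sum_(y <- finsupp c) (c y)%:R *: << mmul (ucm (kap y)) (divcm c (ucm y)) >>.
Definition der : CM -> CM := linext der_b.
HB.instance Definition _ := GRing.Linear.copy der (linext der_b).

Lemma der_bEw (d : {fset one_tree}) c : (finsupp c `<=` d)%fset ->
  der_b c = \sum_(y <- d) (c y)%:R *: << mmul (ucm (kap y)) (divcm c (ucm y)) >>.
Proof.
move=> le; rewrite /der_b (big_fset_incl _ le) //= => y _.
by rewrite -cmE_eq0 => /eqP ->; rewrite scale0r.
Qed.

Lemma der_bM c c' : der_b (mmul c c') = der_b c * << c' >> + << c >> * der_b c'.
Proof.
pose d := (finsupp c `|` finsupp c')%fset.
rewrite (@der_bEw d) ?mdomD // (@der_bEw d c) ?fsubsetUl // (@der_bEw d c') ?fsubsetUr //.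
rewrite mulr_suml mulr_sumr -big_split; apply: eq_bigr => y _ /=.
have e (a b : {cmonom one_tree}) : (a y)%:R *: << mmul (ucm (kap y)) (divcm (mmul a b) (ucm y)) >> =
   (a y)%:R *: (<< mmul (ucm (kap y)) (divcm a (ucm y)) >> * << b >>) :> CM.
  case: (posnP (a y)) => [->|ay]; first by apply: etrans (scale0r _) _; apply/esym/scale0r.
  congr (_ *: _); apply: etrans _ (esym (malgUM _ _ _)); congr << _ >>.
  rewrite -mulmA; congr mmul.
  by apply: (@mulIcm _ (ucm y)); rewrite mulmA !ucm_div // -cmE_neq0 ?cmM -lt0n // addn_gt0 ay.
rewrite cmM natrD scalerDl; congr (_ + _).
  by apply: etrans (e c c') _; apply: scalerAl.
rewrite [mmul c c']mulmC; apply: etrans (e c' c) _; apply: etrans (scalerAl _ _ _) _.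
exact: mulrC.
Qed.

Lemma derM (x x' : CM) : der (x * x') = der x * x' + x * der x'.
Proof.
elim/malg_ind: x => [|a c x IH]; first by rewrite !mul0r linear0 mul0r addr0.
apply: (@leibniz_step _ _ der) IH; elim/malg_ind: x' => [|a' c' x' IH'].
  by rewrite !mulr0 linear0 mulr0 addr0.
apply: (@leibniz_sym _ _ der).
apply: (@leibniz_step _ _ der); last first.
  by apply: (@leibniz_sym _ _ der); apply: IH'.
apply: (@leibniz_sym _ _ der).
apply: etrans (congr1 der (malgUM _ _ _)) _.
apply: etrans (linextU _ _) _; apply: etrans (der_bM _ _) _.
have dU z : der << z >> = der_b z by exact: linextU.
apply: (congr2 +%R); [exact: (congr1 (fun z => z * << c' >>) (esym (dU c)))|].
exact: (congr1 (fun z => << c >> * z) (esym (dU c'))).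
Qed.

Lemma der1 : der 1 = 0.
Proof. by apply: etrans (linextU _ _) _; rewrite /der_b mdom1 big_seq_fset0. Qed.

Lemma der_bU y : der << ucm y >> = << ucm (kap y) >>.
Proof.
apply: etrans (linextU _ _) _; rewrite /der_b mdomU big_seq_fset1 cmUU scale1r.
by congr << _ >>; rewrite -[X in divcm X _]mulm1 divcm_mul mulm1.
Qed.

Definition clump_basis m : CM := if insub m is Some y then << ucm y >> else 0.

Lemma clump_basis_val y : clump_basis (val y) = << ucm y >>.
Proof. by rewrite /clump_basis valK. Qed.

Lemma der_clump_basis m : der (clump_basis m) = clump_basis (mmul (ucm k) m).
Proof.
rewrite /clump_basis; case: insubP => [y _ <-|nm].
  by rewrite der_bU; case: insubP => [y' _ e|]; [congr << ucm _ >>; apply: val_inj; rewrite e kapE | rewrite kap_subproof].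
rewrite linear0 insubF //; apply: negbTE; apply: contra nm.
by rewrite ntrM ntrU (negbTE kT).
Qed.

(** Insertion of [k] is the Leibniz rule; lists containing an entry that is no clump vanish on both
    sides. *)
Lemma der_ins (l : seq {cmonom I}) :
  der (\prod_(m <- l) clump_basis m) = \sum_(l' <- ins mmul (ucm k) l) \prod_(m <- l') clump_basis m.
Proof.
elim: l => [|m l IH]; first by rewrite !big_nil der1.
rewrite big_cons derM IH /= !big_cons big_map der_clump_basis; congr (_ + _).
by rewrite mulr_sumr; apply: eq_bigr => l' _; rewrite big_cons.
Qed.

Definition c1 c Y := mmul (ucm (unkap Y)) (divcm c (ucm Y)).

(** A monomial [c] arises by turning one clump [unkap Y] into [Y], so it comes from [c1 c Y]; the
    number of copies of [unkap Y] there is the coefficient. *)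
Lemma der_coef (x : CM) c :
  (der x)@_c = \sum_(Y <- finsupp c | (0 < val Y k)%N) (c1 c Y (unkap Y))%:R * x@_(c1 c Y).
Proof.
elim/malg_ind: x => [|a c0 x IH].
  by rewrite linear0 mcoeff0 big1 // => Y _; rewrite mcoeff0 mulr0.
have e0 : (der (a *: << c0 >> + x))@_c = a * (der << c0 >>)@_c + (der x)@_c.
  by rewrite linearP mcoeffD mcoeffZ.
apply: etrans e0 _; apply: etrans (congr1 (fun z => _ + z) IH) _.
transitivity (\sum_(Y <- finsupp c | (0 < val Y k)%N)
   (a * ((c1 c Y (unkap Y))%:R * (c1 c Y == c0)%:R) + (c1 c Y (unkap Y))%:R * x@_(c1 c Y))); last first.
  apply: eq_bigr => Y _; rewrite [in RHS]mcoeffD [in RHS]mcoeffZ [in RHS]mcoeffU1.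
  by rewrite mulrDr mulrCA eq_sym.
rewrite big_split -mulr_sumr; congr (_ * _ + _) => /=.
have -> : der << c0 >> = der_b c0 by apply: linextU.
rewrite /der_b raddf_sum /=.
transitivity (\sum_(y <- finsupp c0) \sum_(Y <- finsupp c)
   (if (Y == kap y) && (mmul c0 (ucm Y) == mmul c (ucm y)) then (c0 y)%:R else 0 : K)).
  rewrite big_seq [RHS]big_seq; apply: eq_bigr => y hy.
  rewrite mcoeffZ mcoeffU1.
  have cond : (mmul (ucm (kap y)) (divcm c0 (ucm y)) == c) = (mmul c0 (ucm (kap y)) == mmul c (ucm y)).
    apply: etrans (exch_cond (ucm y) _ _ _) _.
    exact: (congr1 (fun z => mmul z (ucm (kap y)) == mmul c (ucm y)) (ucm_div hy)).
  apply: (@sum_pick K _ _ (fun Y => Y == kap y) (fun Y => mmul c0 (ucm Y) == mmul c (ucm y)) (fun _ => (c0 y)%:R) (kap y) _ _ cond) => //.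
  move=> h; have {h}/eqP e : mmul c0 (ucm (kap y)) == mmul c (ucm y) by rewrite -cond.
  have h : kap y \in finsupp (mmul c0 (ucm (kap y))) by rewrite mem_mulU eqxx orbT.
  rewrite e mem_mulU in h; case/orP: h => [//|/eqP ky].
  have /eqP/cmP/(_ k) : val (kap y) = val y by rewrite ky.
  by rewrite kapE cmM cmUU => /eqP; rewrite -[X in _ == X]add0n eqn_add2r.
rewrite exchange_big /= [RHS]big_mkcond big_seq [RHS]big_seq; apply: eq_bigr => Y hY.
case: ifP => hk; last first.
  apply: big1 => y _; case: eqP => //= eY; move: hk.
  by rewrite eY kapE cmM cmUU.
have eY := unkapK hk; set y := unkap Y in eY *.
have cond : (c1 c Y == c0) = (mmul c0 (ucm Y) == mmul c (ucm y)).
  rewrite /c1 -/y; apply: etrans (exch_cond (ucm Y) _ _ _) _.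
  apply: etrans (congr1 (fun z => mmul z (ucm y) == mmul c0 (ucm Y)) (ucm_div hY)) _.
  exact: eq_sym.
apply: etrans (esym (@sum_pick K _ _ (fun y' => Y == kap y') (fun y' => mmul c0 (ucm Y) == mmul c (ucm y')) (fun y' => (c0 y')%:R) y _ _ cond _)) _.
- by move=> y'; rewrite -eY (inj_eq kap_inj) eq_sym.
- by move/eqP <-; rewrite /c1 -/y mem_Umul eqxx.
case: eqP => [<-//|_]; by rewrite !mulr0.
Qed.
End Der.

Local Notation CM := {malg K[{cmonom one_tree}]}.

Lemma flat_phi c i : phi c i = (\sum_(Y <- finsupp c) c Y * val Y i)%N.
Proof. exact: flatEw. Qed.

Definition Psi (ks ts : seq I) : CM :=
  \sum_(l <- clumps mmul (map (@ucm I) ks) (map (@ucm I) ts)) \prod_(m <- l) clump_basis m.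

Lemma Psi_rcons ks k ts (kT : ~~ isT k) : Psi (rcons ks k) ts = der kT (Psi ks ts).
Proof.
rewrite /Psi map_rcons clumps_rcons big_flatten /= big_map linear_sum.
by apply: eq_bigr => l _; rewrite -der_ins.
Qed.

Lemma mdeg_eq1 m : mdeg m = 1%N -> exists t, m = ucm t.
Proof.
elim/cm_ind: m => [|t m _]; first by rewrite mdeg1.
by rewrite mdegM mdegU add1n => -[/mdeg_eq0I ->]; exists t; rewrite mulm1.
Qed.

(** A clump has exactly one tree factor, and here all factors are trees. So a product of trees has
    only the clumping into single trees, which starts the induction of [Psi_coef]. *)
Lemma phi_trees ts c : all isT ts -> phi c = lcmon ts ->
  forall Z, Z \in finsupp c -> exists2 t, isT t & val Z = ucm t.
Proof.
move=> hT e Z hZ; have le i : (val Z i <= lcmon ts i)%N.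
  rewrite -e flat_phi (big_fsetD1 Z) //=; apply: leq_trans (leq_addr _ _).
  by rewrite leq_pmull // lt0n cmE_neq0.
have allT i : i \in finsupp (val Z) -> isT i.
  rewrite -cmE_neq0 -lt0n => h; have : (0 < lcmon ts i)%N by apply: leq_trans h (le i).
  by rewrite lcmonE -has_count has_pred1 => /(allP hT).
have : mdeg (val Z) = 1%N.
  apply: etrans _ (eqP (valP Z)); rewrite /ntr mdegE big_seq [RHS]big_seq_cond; apply: eq_bigl => i.
  by case hi: (i \in _) => //=; rewrite allT.
case/mdeg_eq1 => t et; exists t => //; apply: allT.
by rewrite et mdomU in_fset1 eqxx.
Qed.

Lemma phi_trees_coef ts c : all isT ts -> phi c = lcmon ts ->
  forall Y t, isT t -> val Y = ucm t -> c Y = lcmon ts t.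
Proof.
move=> hT e Y t tT eY; have vU := phi_trees hT e.
rewrite -e flat_phi; have other Z : Z \in finsupp c -> Z != Y -> val Z t = 0%N.
  move=> hZ ne; have [t' _ eZ] := vU Z hZ; rewrite eZ cmU; case: eqP => // et.
  by case/eqP: ne; apply: val_inj; rewrite eZ eY et.
case: (boolP (Y \in finsupp c)) => hY.
  rewrite (big_fsetD1 Y) //= eY cmUU muln1 big_seq big1 ?addn0 // => Z.
  by rewrite in_fsetD1 => /andP[ne hZ]; rewrite other ?muln0.
rewrite (eqP (_ : c Y == 0%N)) ?cmE_eq0 // big_seq big1 // => Z hZ.
by rewrite other ?muln0 //; apply: contraNneq hY => <-.
Qed.

Lemma Psi_nil ts c : all isT ts ->
  (Psi [::] ts)@_c = if phi c == lcmon ts then (sI (lcmon ts))%:R / (sY c)%:R else 0.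
Proof.
move=> hT; rewrite /Psi /= big_seq1 big_map.
have n1 t : isT t -> ntr (ucm t) == 1%N by rewrite ntrU => ->.
have [c0 [h1 h2 h3]] : exists c0 : {cmonom one_tree}, [/\ \prod_(t <- ts) clump_basis (ucm t) = << c0 >>,
    phi c0 = lcmon ts & sY c0 = sI (lcmon ts)].
  elim: ts hT => [|t ts IH] /=.
    by exists mone; rewrite big_nil flat1 /lcmon big_nil /sY !sig1.
  case/andP => tT hT; have [c0 [h1 h2 h3]] := IH hT.
  have [y ey] : exists y : one_tree, val y = ucm t by exists (Sub (ucm t) (n1 t tT)); apply: SubK.
  have ht : clump_basis (ucm t) = << ucm y >> := etrans (congr1 clump_basis (esym ey)) (clump_basis_val y).
  exists (mmul (ucm y) c0); split.
  - apply: etrans (big_cons _ _ _ _ _ _) _ => /=.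
    by apply: etrans (congr2 *%R ht h1) _; apply: malgUM.
  - by rewrite flatM flatU ey h2 /lcmon big_cons.
  rewrite /sY sigU -/(sY c0) h3 /lcmon big_cons -/(lcmon ts) sigU (phi_trees_coef hT h2 tT ey) ey.
  by have := sigU w t mone; rewrite mulm1 sig1 cm1 muln1 mul1n => ->.
rewrite h1 mcoeffU1; case: (eqVneq c0 c) => [<-|ne].
  by rewrite h2 eqxx h3 divff // (pcharf0P K).1 // -lt0n -h3 sY_gt0.
case: eqP => // e; case/eqP: ne; apply/eqP/cmP => Y.
have key c' : phi c' = lcmon ts -> Y \in finsupp c' -> c0 Y = c Y.
  move=> e' hY; have [t tT eY] := phi_trees hT e' hY.
  by rewrite !(phi_trees_coef hT _ tT eY).
case: (boolP (Y \in finsupp c)) => [/(key c e)//|hc].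
case: (boolP (Y \in finsupp c0)) => [/(key c0 h2)//|hc0].
by move: hc hc0; rewrite -!cmE_eq0 => /eqP -> /eqP ->.
Qed.

(** Induction on the non-trees. Adding [k] multiplies [sig] of the product by [w k] and by the new
    multiplicity of [k]; the derivation produces the same factor, since the numbers [c Y * val Y k]
    add up to the occurrences of [k] in [c]. *)
Lemma Psi_coef ks ts c : all (predC isT) ks -> all isT ts ->
  (Psi ks ts)@_c = if phi c == lcmon (ks ++ ts) then
     (sI (lcmon (ks ++ ts)))%:R / (sY c)%:R else 0.
Proof.
move=> hk hT; elim/last_ind: ks hk c => [|ks k IH] hk c; first exact: Psi_nil.
move: hk; rewrite all_rcons => /andP[/= kT {}/IH IH].
have eb : lcmon (rcons ks k ++ ts) = mmul (ucm k) (lcmon (ks ++ ts)).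
  by rewrite /lcmon cat_rcons !big_cat big_cons /= mulmA [mmul _ (ucm k)]mulmC -mulmA.
rewrite (Psi_rcons _ _ kT) der_coef // eb; set b' := lcmon (ks ++ ts) in IH *.
have nz n : (0 < n)%N -> n%:R != 0 :> K by move=> h; rewrite (pcharf0P K).1 // -lt0n.
have step Y : Y \in finsupp c -> (0 < val Y k)%N ->
  (c1 k c Y (unkap k Y))%:R * (Psi ks ts)@_(c1 k c Y) =
  if phi c == mmul (ucm k) b' then ((sI b')%:R * (w k)%:R / (sY c)%:R) * (c Y * val Y k)%:R else 0 : K.
  move=> hY hk; rewrite IH; set y := unkap k Y; have eY : kap kT y = Y := unkapK kT hk.
  have vY : val Y = mmul (ucm k) (val y) by rewrite -eY kapE.
  set r := divcm c (ucm Y); have ec : c = mmul (ucm Y) r by rewrite ucm_div.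
  rewrite /c1 -/y -/r; move: (y) (r) eY vY ec => {}y {}r eY vY ec.
  have -> : (phi (mmul (ucm y) r) == b') = (phi c == mmul (ucm k) b').
    have e1 Z : phi (mmul (ucm Z) r) = mmul (val Z) (phi r).
      by apply: etrans (flatM _ _ _) _; apply: (congr1 (mmul^~ (phi r))); apply: flatU.
    have e2 : phi c = mmul (ucm k) (phi (mmul (ucm y) r)).
      apply: etrans (congr1 _ ec) _; apply: etrans (e1 Y) _; rewrite vY -mulmA.
      by apply: congr1; apply/esym/e1.
    by rewrite e2; apply/eqP/eqP => [->//|/mulIcm].
  case: eqP => _; last by rewrite mulr0.
  have s1 : sY (mmul (ucm y) r) = ((r y).+1 * sI (val y) * sY r)%N by apply: sigU.
  have s2 : sY c = ((r Y).+1 * sI (val Y) * sY r)%N by rewrite {1}ec; apply: sigU.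
  have s3 : sI (val Y) = ((val y k).+1 * w k * sI (val y))%N by rewrite vY; apply: sigU.
  have cy : mmul (ucm y) r y = (r y).+1 by rewrite cmM cmUU.
  have cY : c Y = (r Y).+1 by rewrite {1}ec cmM cmUU.
  have Yk : val Y k = (val y k).+1 by rewrite vY cmM cmUU.
  rewrite s1 s2 s3 cy cY Yk.
  have n1 := nz _ (sI_gt0 (val y)); have n2 := nz _ (sY_gt0 r).
  have n3 := nz _ (w0 k); have n4 : (r y).+1%:R != 0 :> K by apply: nz.
  have n5 : (r Y).+1%:R != 0 :> K by apply: nz.
  have n6 : (val y k).+1%:R != 0 :> K by apply: nz.
  rewrite !natrM; move: n1 n2 n3 n4 n5 n6.
  move: (sI b')%:R (r y).+1%:R (r Y).+1%:R (val y k).+1%:R (w k)%:R (sI (val y))%:R (sY r)%:R.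
  move=> B ry rY yk wk S R n1 n2 n3 n4 n5 n6.
  exact: frac_id.
transitivity (\sum_(Y <- finsupp c) (if phi c == mmul (ucm k) b'
   then ((sI b')%:R * (w k)%:R / (sY c)%:R) * (c Y * val Y k)%:R else 0 : K)).
  rewrite big_mkcond big_seq [RHS]big_seq; apply: eq_bigr => Y hY.
  case: posnP => [->|h]; first by rewrite muln0 mulr0 if_same.
  exact: step.
case: (eqVneq (phi c) (mmul (ucm k) b')) => [e|_]; last by rewrite big1.
rewrite -mulr_sumr -natr_sum -flat_phi e cmM cmUU sigU !natrM mulrAC.
congr (_ / _); rewrite mulrC add1n -mulrA; congr (_ * _); exact: mulrC.
Qed.
End Coef.

Section Clumping.
Variables (K : fieldType) (charK : [pchar K] =i pred0).
Variables (I : choiceType) (isT : pred I) (w : I -> nat).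
Hypothesis w0 : forall i, (0 < w i)%N.
Local Notation one_tree := (one_tree isT).
Local Notation sI := (sig w).
Local Notation sY := (sY (isT := isT) w).
Local Notation phi := (flat (fun y : one_tree => val y)).
Local Notation CM := {malg K[{cmonom one_tree}]}.
Implicit Types (b m : {cmonom I}) (c : {cmonom one_tree}) (y Y : one_tree).

(** Unfolds to [clumpingsM] or [clumpingsF] for the two choices of generators, so one computation
    serves both adjoints. *)
Definition clumpings b : seq {cmonom one_tree} :=
  let ks := filter (fun v => ~~ isT v) (factors b) in
  let ts := filter isT (factors b) in
  undup [seq \big[mmul/mone]_(Y <- pmap insub
              [seq mulcm (ucm (tnth (in_tuple ts) i))
                   (\big[mmul/mone]_(k < size ks | f k == i)
                       ucm (tnth (in_tuple ks) k)) | i <- enum 'I_(size ts)])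
            ucm Y
        | f : {ffun 'I_(size ks) -> 'I_(size ts)} <- enum {: {ffun 'I_(size ks) -> 'I_(size ts)}}].

Lemma prod_clump_basis (l : seq {cmonom I}) :
  \prod_(m <- l) clump_basis K isT m = << \big[mmul/mone]_(Y <- pmap insub l) ucm Y >> :> CM \/
  \prod_(m <- l) clump_basis K isT m = 0 :> CM.
Proof.
elim: l => [|m l IH]; first by left; rewrite /= !big_nil.
have ec : \prod_(m' <- m :: l) clump_basis K isT m' = clump_basis K isT m * \prod_(m' <- l) clump_basis K isT m'.
  exact: big_cons.
rewrite ec {ec}; move: IH; move: (\prod_(m' <- l) _) => z hz.
rewrite /= /clump_basis; case: insubP => [y _ _|_]; last by right; apply: mul0r.
case: hz => ->; last by right; apply: mulr0.
by left; rewrite big_cons; apply: malgUM.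
Qed.

Definition Kof b := filter (fun v => ~~ isT v) (factors b).
Definition Tof b := filter isT (factors b).

Lemma lcmon_KT b : lcmon (Kof b ++ Tof b) = b.
Proof.
rewrite -[RHS]lcmon_factors /lcmon; apply: perm_big.
by rewrite perm_catC perm_sym -(perm_filterC isT).
Qed.

(** The list has no repetitions; with every monomial of non-zero coefficient in it, summing over it
    loses nothing. *)
Lemma mem_clumpings b c : (Psi K isT (Kof b) (Tof b))@_c != 0 -> c \in clumpings b.
Proof.
rewrite /Psi raddf_sum /= => h.
have [l hl hc] : exists2 l, l \in clumps mmul (map (@ucm I) (Kof b)) (map (@ucm I) (Tof b)) &
    (\prod_(m <- l) clump_basis K isT m)@_c != 0.
  apply/hasP; apply: contraNT h => /hasPn h; rewrite big_seq big1 // => l hl.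
  by apply/eqP; apply/negbNE; apply: h.
have ec : c = \big[mmul/mone]_(Y <- pmap insub l) ucm Y.
  case: (prod_clump_basis l) hc => ->; last by rewrite mcoeff0 eqxx.
  by rewrite mcoeffU1; case: (eqVneq _ c) => [->//|_]; rewrite eqxx.
have [F [hF [hs hn]]] := clumps_assign hl; rewrite !size_map in hF hs hn.
rewrite mem_undup; apply/mapP.
exists [ffun k : 'I_(size (Kof b)) => Ordinal (hF k (ltn_ord k))]; first by rewrite mem_enum.
rewrite ec; congr (\big[_/_]_(Y <- pmap _ _) _).
apply: (@eq_from_nth _ mone) => [|i hi]; first by rewrite size_map size_enum_ord.
have hi' : (i < size (Tof b))%N by rewrite -hs.
have x0 := tnth (in_tuple (Tof b)) (Ordinal hi').
rewrite hn // (nth_map (Ordinal hi')) ?size_enum_ord // (nth_map x0) //; congr mmul.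
  by rewrite (tnth_nth x0) nth_enum_ord.
apply: eq_big => [k|k _]; first by rewrite ffunE -val_eqE /= nth_enum_ord.
rewrite (nth_map x0) //; congr ucm; rewrite (tnth_nth x0) //.
Qed.

Lemma clumpings_sum b :
  \sum_(c <- clumpings b | phi c == b) ((sI b)%:R / (sY c)%:R) *: << c >> = Psi K isT (Kof b) (Tof b).
Proof.
apply/malgP => c; rewrite raddf_sum /=.
have hP := Psi_coef charK w0 c (filter_all (predC isT) _) (filter_all isT _).
have {}hP : (Psi K isT (Kof b) (Tof b))@_c = if phi c == b then (sI b)%:R / (sY c)%:R else 0.
  by have := hP (factors b) (factors b); rewrite (lcmon_KT b).
transitivity (\sum_(c' <- clumpings b) (if c' == c then
   if phi c == b then (sI b)%:R / (sY c)%:R else 0 else 0 : K)).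
  rewrite big_mkcond; apply: eq_bigr => c' _; rewrite /= mcoeffZ mcoeffU1.
  by case: (eqVneq c' c) => [->|_]; rewrite ?mulr1 // mulr0 if_same.
rewrite -hP -big_mkcond; case: (boolP (c \in clumpings b)) => hc.
  by rewrite -big_filter filter_pred1_uniq ?undup_uniq // big_seq1.
rewrite big_seq_cond big1 => [|c' /andP[h /eqP e]]; last by rewrite e in h; rewrite h in hc.
by apply/eqP; rewrite eq_sym; apply: contraNT hc => /mem_clumpings.
Qed.
End Clumping.

(** * Automorphisms of forests *)

Section Emb.
Variable C : finType.

(** Isomorphisms from [g] onto the part of [h] on [B]. The last clause also forbids edges leaving
    [B]. With [B] everything and [g = h] these are the automorphisms, but a general [B] permits an
    induction on components. *)
Definition isemb m n (g : gdata C m) (h : gdata C n) (B : {set 'I_n}) (f : {ffun 'I_m -> 'I_n}) :=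
  [&& injectiveb f, f @: setT == B, [forall u, gdec h (f u) == gdec g u] &
      [forall u, gout h (f u) == omap f (gout g u)]].
Definition emb m n (g : gdata C m) (h : gdata C n) B := #|[set f | isemb g h B f]|.

Lemma isembP m n (g : gdata C m) (h : gdata C n) B (f : {ffun _}) :
  reflect [/\ injective f, f @: setT = B, forall u, gdec h (f u) = gdec g u &
      forall u, gout h (f u) = omap f (gout g u)] (isemb g h B f).
Proof.
apply: (iffP and4P) => -[h1 h2 h3 h4]; split.
- exact/injectiveP.
- exact/eqP.
- by move=> u; apply/eqP/(forallP h3).
- by move=> u; apply/eqP/(forallP h4).
- exact/injectiveP.
- exact/eqP.
- by apply/forallP => u; apply/eqP.
- by apply/forallP => u; apply/eqP.
Qed.

Lemma relabel_fix n (g : gdata C n) (p : {perm _}) : reflect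
  ((forall u, gdec g (p u) = gdec g u) /\ (forall u, gout g (p u) = omap p (gout g u)))
  (relabel g p == g).
Proof.
apply: (iffP eqP) => [e|[hd ho]].
  split=> u; rewrite -{1}e /relabel /gdec /gout /= ffunE permK //.
case: g hd ho => o c; rewrite /relabel /gdec /gout /= => hd ho.
congr pair; apply/ffunP => v; rewrite ffunE.
  by rewrite -ho permKV.
by rewrite -hd permKV.
Qed.

(** The automorphisms of [g] act simply transitively on its embeddings with a given image. *)
Lemma emb_torsor m n (g : gdata C m) (h : gdata C n) B (f0 : {ffun _}) : isemb g h B f0 -> emb g h B = naut g.
Proof.
case/isembP => inj0 im0 hd0 ho0; pose F (p : {perm 'I_m}) := [ffun u => f0 (p u)].
have Finj : injective F.
  by move=> p q /ffunP e; apply/permP => u; have := e u; rewrite !ffunE => /inj0.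
rewrite /naut -[RHS](card_imset _ Finj) /emb; apply: eq_card => f; rewrite inE.
apply/isembP/imsetP => [[inj im hd ho]|[p]].
  have ex u : exists v, f0 v == f u.
    have : f u \in f0 @: setT by rewrite im0 -im imset_f.
    by case/imsetP => v _ ->; exists v.
  pose q u := xchoose (ex u); have qE u : f0 (q u) = f u := eqP (xchooseP (ex u)).
  have qinj : injective q by move=> u v e; apply: inj; rewrite -!qE e.
  exists (perm qinj); last by apply/ffunP => u; rewrite ffunE permE qE.
  rewrite inE; apply/relabel_fix; split=> u; rewrite permE.
    by rewrite -hd0 qE hd.
  have := ho0 (q u); rewrite qE ho; case: (gout g u) (gout g (q u)) => [v|] [v'|] //=.
  by rewrite -qE => -[/inj0 <-]; rewrite permE.
rewrite inE => /relabel_fix[hd ho] ->; split=> [u v|||u].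
- by rewrite !ffunE => /inj0 /perm_inj.
- rewrite -im0; apply/setP => v; apply/imsetP/imsetP => -[u _ ->].
    by exists (p u); rewrite ?ffunE.
  by exists ((p^-1)%g u); rewrite ?ffunE ?permKV.
- by move=> u; rewrite ffunE hd0 hd.
by rewrite ffunE ho0 ho; case: (gout g u) => //= v; rewrite ffunE.
Qed.

Lemma emb_id n (g : gdata C n) : isemb g g setT [ffun u => u].
Proof.
apply/isembP; split=> [u v|||u]; first by rewrite !ffunE.
- by apply/setP => v; rewrite inE; apply/imsetP; exists v; rewrite ?ffunE.
- by move=> u; rewrite ffunE.
by rewrite ffunE; case: (gout g u) => //= v; rewrite ffunE.
Qed.

(** An embedding of a disjoint union is the choice of the image [S] of the first graph and one
    embedding for each part. *)
Lemma emb_union (g g' : graph C) n (h : gdata C n) B :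
  emb (tagged (gunion g g')) h B =
  (\sum_(S : {set 'I_n} | S \subset B) emb (tagged g) h S * emb (tagged g') h (B :\: S))%N.
Proof.
case: g => m g; case: g' => m' g' /=; set u := (X in emb X _ _).
have uoL a : gout u (lshift m' a) = omap (@lshift m m') (gout g a).
  by rewrite /u /gout ffunE -[lshift m' a]/(unsplit (inl a)) unsplitK.
have uoR a : gout u (rshift m a) = omap (@rshift m m') (gout g' a).
  by rewrite /u /gout ffunE -[rshift m a]/(unsplit (inr a)) unsplitK.
have udL a : gdec u (lshift m' a) = gdec g a.
  by rewrite /u /gdec ffunE -[lshift m' a]/(unsplit (inl a)) unsplitK.
have udR a : gdec u (rshift m a) = gdec g' a.
  by rewrite /u /gdec ffunE -[rshift m a]/(unsplit (inr a)) unsplitK.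
rewrite /emb -sum1_card (partition_big (fun f : {ffun 'I_(m + m') -> 'I_n} => [set f (lshift m' a) | a : 'I_m])
   (fun S => S \subset B)) /=; last first.
  move=> f; rewrite inE => /isembP[_ <- _ _]; apply/subsetP => v /imsetP[a _ ->].
  exact: imset_f.
apply: eq_bigr => S SB; rewrite sum1dep_card -cardsX.
pose F (f : {ffun 'I_(m + m') -> 'I_n}) := ([ffun a => f (lshift m' a)], [ffun a => f (rshift m a)]).
have Finj : injective F.
  move=> f f' [/ffunP e1 /ffunP e2]; apply/ffunP => v; rewrite -[v]splitK.
  by case: (split v) => a /=; [have := e1 a | have := e2 a]; rewrite !ffunE.
rewrite -(card_imset _ Finj); apply: eq_card => -[f1 f2]; rewrite in_setX !inE.
apply/imsetP/andP => [[f]|[/isembP[inj1 im1 hd1 ho1] /isembP[inj2 im2 hd2 ho2]]].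
  rewrite inE in_set => /andP[/isembP[inj im hd ho] /eqP imL] [-> ->].
  split; apply/isembP; split.
  - by move=> a b; rewrite !ffunE => /inj /lshift_inj.
  - by rewrite -imL; apply/setP => v; apply/imsetP/imsetP => -[a _ ->]; exists a; rewrite ?ffunE.
  - by move=> a; rewrite ffunE hd udL.
  - by move=> a; rewrite ffunE ho uoL; case: (gout g a) => //= b; rewrite ffunE.
  - by move=> a b; rewrite !ffunE => /inj /rshift_inj.
  - apply/setP => v; rewrite inE -imL -im; apply/imsetP/andP => [[a _ ->]|[nv /imsetP[w _ ev]]].
      rewrite ffunE imset_f //; split=> //; apply/imsetP => -[b _ /inj /eqP].
      by rewrite eq_rlshift.
    move: ev; rewrite -[w]splitK; case: (split w) => a /= ev; last by exists a; rewrite ?ffunE.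
    by case/imsetP: nv; exists a.
  - by move=> a; rewrite ffunE hd udR.
  - by move=> a; rewrite ffunE ho uoR; case: (gout g' a) => //= b; rewrite ffunE.
pose f := [ffun v => match split v with inl a => f1 a | inr a => f2 a end].
have fL a : f (lshift m' a) = f1 a by rewrite ffunE -[lshift m' a]/(unsplit (inl a)) unsplitK.
have fR a : f (rshift m a) = f2 a by rewrite ffunE -[rshift m a]/(unsplit (inr a)) unsplitK.
have imL : [set f (lshift m' a) | a : 'I_m] = S.
  by rewrite -im1; apply/setP => v; apply/imsetP/imsetP => -[a _ ->]; exists a.
exists f; last by congr pair; apply/ffunP => a; rewrite ffunE ?fL ?fR.
rewrite inE in_set imL eqxx andbT; apply/isembP; split.
- have f1S a : f1 a \in S by rewrite -im1 imset_f.
  have f2S a : f2 a \in S = false by apply: negbTE; have : f2 a \in B :\: S by [rewrite -im2 imset_f]; rewrite inE => /andP[].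
  move=> v w; rewrite -[v]splitK -[w]splitK; case: (split v) => a; case: (split w) => b /=; rewrite ?fL ?fR.
  + by move/inj1 ->.
  + by move=> e; have := f1S a; rewrite e f2S.
  + by move=> e; have := f1S b; rewrite -e f2S.
  + by move/inj2 ->.
- apply/setP => v; have -> : (v \in B) = (v \in f1 @: setT) || (v \in f2 @: setT).
    by rewrite im1 im2 -{1}(setID B S) (setIidPr SB) in_setU.
  apply/imsetP/orP => [[w _ ->]|[/imsetP[a _ ->]|/imsetP[a _ ->]]].
  + rewrite -[w]splitK; case: (split w) => a /=; rewrite ?fL ?fR; [left|right]; exact: imset_f.
  + by exists (lshift m' a).
  + by exists (rshift m a).
- by move=> v; rewrite -[v]splitK; case: (split v) => a /=; rewrite ?fL ?fR ?udL ?udR.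
move=> v; rewrite -[v]splitK; case: (split v) => a /=; rewrite ?fL ?fR ?uoL ?uoR ?ho1 ?ho2.
  by case: (gout g a) => //= b; rewrite fL.
by case: (gout g' a) => //= b; rewrite fR.
Qed.

Section Classes.
Variables (n : nat) (h : gdata C n).
Implicit Types (B S T : {set 'I_n}) (x : ConnCls C).

Definition oclosed B := forall u v, u \in B -> gout h u = Some v -> v \in B.
Definition clsm B : {cmonom ConnCls C} :=
  \big[mmul/mone]_(T in pcomps h B) (if clsS h T is Some x then ucm x else mone).

Lemma clsS_conn S : conn h S -> exists x, clsS h S = Some x.
Proof. by rewrite -gconnected_subg clsS.unlock => /clsOfP. Qed.

Lemma clsmD B S : S \in pcomps h B ->
  clsm B = mmul (if clsS h S is Some x then ucm x else mone) (clsm (B :\: S)).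
Proof. by move=> hS; rewrite /clsm (big_setD1 S) //= pcompsD. Qed.

Lemma clsmE B x : clsm B x = #|[set T in pcomps h B | clsS h T == Some x]|.
Proof.
rewrite /clsm cm_prodE -sum1dep_card big_mkcondr; apply: eq_bigr => T _.
case: (clsS h T) => [y|]; last by rewrite cm1.
by rewrite cmU; case: (eqVneq y x) => [->|/eqP ne]; rewrite ?eqxx //; case: eqP => // -[].
Qed.

Lemma oclosed_emb m (g : gdata C m) B f : isemb g h B f -> oclosed B.
Proof.
case/isembP => _ <- _ ho u v /imsetP[a _ ->]; rewrite ho.
by case: (gout g a) => //= b [<-]; apply: imset_f.
Qed.

Lemma clsS_emb x S f : isemb (tagged (val x)) h S f -> clsS h S = Some x.
Proof.
case/isembP => inj im hd ho; rewrite -(clsOf_val x) -clsS_setT; apply/esym.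
apply: (@clsS_iso _ _ _ _ _ _ _ f) => // [u v _ _ /inj //|u w _ _].
by rewrite ho; case: (gout _ u) => //= v; apply/eqP/eqP => [[->]|[/inj ->]].
Qed.

Lemma emb_clsS x S : oclosed S -> clsS h S = Some x -> exists f, isemb (tagged (val x)) h S f.
Proof.
rewrite clsS.unlock /clsOf => oS; have [p ->] := canonE (tagged (subg h S)).
set s := tagged _ in p *; case: insubP => // y _ ey [<-]; rewrite ey {y ey}.
change (exists f, isemb (relabel s p) h S f).
have rd v : gdec (relabel s p) (p v) = gdec s v by rewrite /relabel /gdec /= ffunE permK.
have ro v : gout (relabel s p) (p v) = omap p (gout s v) by rewrite /relabel /gout /= ffunE permK.
have pcan u : exists v, u = p v by exists ((p^-1)%g u); rewrite permKV.
exists [ffun u => sgv (S := S) ((p^-1)%g u)]; apply/isembP; split.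
- by move=> u v; rewrite !ffunE => /sgv_inj /perm_inj.
- apply/setP => v; apply/imsetP/idP => [[u _ ->]|/sgv_onto[i <-]].
    by rewrite ffunE sgv_in.
  by exists (p i) => //; rewrite ffunE permK.
- by move=> u; have [v ->] := pcan u; rewrite rd ffunE permK subg_dec.
move=> u; have [v ->] := pcan u; rewrite ro ffunE permK.
case e: (gout h (sgv v)) => [w|].
  have /sgv_onto[j ej] : w \in S by apply: oS e; apply: sgv_in.
  have /eqP -> : gout s v == Some j by rewrite subg_out e ej.
  by rewrite /= ffunE permK ej.
by case es: (gout s v) => [j|] //; move/eqP: es; rewrite subg_out e.
Qed.

Lemma oclosed_pcomps B S : oclosed B -> S \in pcomps h B -> oclosed S /\ oclosed (B :\: S).
Proof.
move=> oB; rewrite mem_pcomps => /and3P[/subsetP sub _ /nocrossP nc].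
split=> u v; first by move=> uS e; apply: nc uS (oB _ _ (sub _ uS) e) _; rewrite /adj e eqxx.
rewrite !inE => /andP[uS uB] e; rewrite (oB _ _ uB e) andbT; apply: contra uS => vS.
by apply: nc vS uB _; rewrite /adj e eqxx orbT.
Qed.

Lemma pcomps_oclosed B S : S \subset B -> conn h S -> oclosed S -> oclosed (B :\: S) ->
  S \in pcomps h B.
Proof.
move=> sub cS oS oB; rewrite mem_pcomps sub cS; apply/nocrossP => u v uS vB.
case/orP => /eqP e; first exact: oS e.
apply/negPn/negP => vS; have : u \in B :\: S by apply: oB e; rewrite inE vS.
by rewrite inE uS.
Qed.

Lemma emb_gt0 m (g : gdata C m) B : (0 < emb g h B)%N -> exists f, isemb g h B f.
Proof. by case/card_gt0P => f; rewrite inE => hf; exists f. Qed.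

(** The first graph [x] can go to any component of its class, in [sigmaC x] ways; their number is
    the multiplicity of [x], as in the recursion [sigU]. *)
Lemma emb_list (l : seq (ConnCls C)) B : oclosed B ->
  emb (tagged (foldr (@gunion C) (gempty C) [seq val x | x <- l])) h B =
  if clsm B == lcmon l then sig (@sigmaC C) (lcmon l) else 0%N.
Proof.
elim: l B => [|x l IH] B oB.
  have -> : lcmon [::] = mone :> {cmonom ConnCls C} by rewrite /lcmon big_nil.
  rewrite /= sig1; case: (set_0Vmem B) => [->|[v vB]].
    rewrite [clsm _]/clsm pcomps0 big_set0 eqxx.
    pose f0 : {ffun 'I_0 -> 'I_n} := [ffun i : 'I_0 => False_rect _ (notF (ltn_ord i))].
    rewrite (@emb_torsor _ _ _ _ _ f0); last first.
      apply/isembP; split; try by case.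
      by apply/setP => v; rewrite inE; apply/imsetP => -[[]].
    rewrite /naut (eq_card (B := setT)) ?cardsT ?card_perm ?card_Sn //.
    by move=> p; rewrite !inE; apply/relabel_fix; split=> -[].
  have -> : (clsm B == mone) = false.
    have [T hT vT] := pcomps_cover h vB; have [y ey] : exists y, clsS h T = Some y.
      by apply: clsS_conn; move: hT; rewrite mem_pcomps => /and3P[].
    apply/negbTE/eqP => /eqP/cmP/(_ y); rewrite clsmE cm1 => /eqP.
    by rewrite cards_eq0 => /eqP/setP/(_ T); rewrite !inE hT ey eqxx.
  apply/eqP; rewrite eqn0Ngt; apply/negP => /emb_gt0[f /isembP[_ im _ _]].
  by move: vB; rewrite -im => /imsetP[[]].
rewrite /= emb_union.
transitivity (\sum_(S in [set T in pcomps h B | clsS h T == Some x])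
    sigmaC x * (if clsm B == lcmon (x :: l) then sig (@sigmaC C) (lcmon l) else 0))%N.
  rewrite big_mkcond [RHS]big_mkcond; apply: eq_bigr => S _; rewrite inE.
  case: (boolP (S \in pcomps h B)) => hS; last first.
    case: ifP => // sub; apply/eqP; rewrite muln_eq0 !eqn0Ngt -negb_and.
    apply: contra hS => /andP[/emb_gt0[f hf] /emb_gt0[f' hf']].
    apply: pcomps_oclosed => //; [|exact: oclosed_emb hf|exact: oclosed_emb hf'].
    by apply: contraT => /clsS_None; rewrite (clsS_emb hf).
  have [oS oBS] := oclosed_pcomps oB hS; rewrite (pcomps_sub hS) IH //=.
  case: (eqVneq (clsS h S) (Some x)) => [ex|ne]; last first.
    have -> : emb (tagged (val x)) h S = 0%N; last by [].
    by apply/eqP; rewrite eqn0Ngt; apply: contra ne => /emb_gt0[f /clsS_emb ->].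
  have [f0 /emb_torsor ->] := emb_clsS oS ex; congr (_ * _)%N.
  have -> : lcmon (x :: l) = mmul (ucm x) (lcmon l) by rewrite /lcmon big_cons.
  rewrite (clsmD hS) ex.
  by congr (if _ then _ else _); apply/eqP/eqP => [->|/mulIcm].
rewrite sum_nat_const -clsmE mulnA; case: eqP => e; last by rewrite muln0.
have -> : lcmon (x :: l) = mmul (ucm x) (lcmon l) by rewrite /lcmon big_cons.
rewrite sigU; congr (_ * _ * _)%N.
by rewrite e /lcmon big_cons cmM cmUU add1n.
Qed.
End Classes.

Lemma sigmaAF_sig (f : AFb C) : sigmaAF f = sig (@sigmaC C) f.
Proof.
rewrite /sigmaAF; set h := tagged _; have := emb_list (h := h) (factors f) (B := setT).
rewrite -[foldr _ _ _]/(forest_graph f) -/h (emb_torsor (emb_id h)) lcmon_factors => e.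
(* The identity is an automorphism, so the zero branch of [emb_list] is excluded without computing
   the components of the forest. *)
have := naut_gt0 h; rewrite {}e //.
by case: ifP.
Qed.

End Emb.

(** * Compatibility with the adjoints and the Hopf algebra of clumps *)

Section Expand.
Variables (K : fieldType) (A : comAlgType K) (E : comAlgType K).
Variables (theta psi : {linear A -> E}) (X V : Type) (U : X -> A) (P : pred X).
Hypothesis psiU : forall ks ts, all (predC P) ks -> all P ts ->
  psi (\prod_(x <- ks) U x * \prod_(x <- ts) U x) = clump_sum theta (map U ks) (map U ts).
Variables (F : V -> A) (r : V -> seq X) (Q : V -> pred X) (c : V -> X -> K) (T : pred V).
Hypothesis FE : forall v, F v = \sum_(x <- r v | Q v x) c v x *: U x.
Hypothesis QP : forall v x, Q v x -> P x = T v.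

(** [psi] is known only on products of generators [U x]. Each [F v] combines generators of the same
    kind, tree or not, so both sides expand linearly; the trees are replaced here and the other
    factors in [expand]. *)
Lemma expand_t ks ts1 ts2 : all (predC P) ks -> all P ts1 -> all T ts2 ->
  psi (\prod_(x <- ks) U x * (\prod_(x <- ts1) U x * \prod_(v <- ts2) F v)) =
  clump_sum theta (map U ks) (map U ts1 ++ map F ts2).
Proof.
move=> hk; elim: ts2 ts1 => [|v ts2 IH] ts1 h1.
  by rewrite big_nil mulr1 cats0; move=> _; apply: psiU.
case/andP => Tv /IH {}IH; rewrite big_cons /= FE clump_sum_sum_t.
rewrite mulr_suml !mulr_sumr linear_sum; apply: eq_bigr => x /QP Px.
rewrite -scalerAl -!scalerAr linearZ /=; congr (_ *: _).
have := IH (rcons ts1 x); rewrite all_rcons Px Tv h1 map_rcons cat_rcons => <- //.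
by rewrite -cats1 big_cat big_seq1 -!mulrA.
Qed.

Lemma expand ks ts : all (predC T) ks -> all T ts ->
  psi (\prod_(v <- ks) F v * \prod_(v <- ts) F v) = clump_sum theta (map F ks) (map F ts).
Proof.
move=> hk ht; suff H ks1 ks2 : all (predC P) ks1 -> all (predC T) ks2 ->
  psi (\prod_(x <- ks1) U x * \prod_(v <- ks2) F v * \prod_(v <- ts) F v) =
  clump_sum theta (map U ks1 ++ map F ks2) (map F ts).
  by have := H [::] ks isT hk; rewrite big_nil mul1r.
elim: ks2 ks1 => [|v ks2 IH] ks1 h1.
  rewrite big_nil mulr1 cats0 => _; have := @expand_t ks1 [::] ts h1 isT ht.
  by rewrite big_nil mul1r.
case/andP => /= Tv /IH {}IH; rewrite big_cons FE clump_sum_sum_k.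
rewrite mulr_suml mulr_sumr mulr_suml linear_sum; apply: eq_bigr => x /QP Px.
rewrite -!scalerAl -scalerAr -scalerAl linearZ /=; congr (_ *: _).
have := IH (rcons ks1 x); rewrite all_rcons /= Px Tv h1 map_rcons cat_rcons => <- //.
by rewrite -cats1 big_cat big_seq1 -!mulrA.
Qed.
End Expand.

Lemma clump_sum_morph (K : fieldType) (A A' : algType K) (E E' : comAlgType K)
  (j : {lrmorphism A -> A'}) (jc : {lrmorphism E -> E'})
  (theta : {linear A -> E}) (theta' : {linear A' -> E'}) :
  (forall a, jc (theta a) = theta' (j a)) ->
  forall ks ts, jc (clump_sum theta ks ts) = clump_sum theta' (map j ks) (map j ts).
Proof.
move=> h ks ts; rewrite /clump_sum (clumps_map (op := *%R)); last exact: rmorphM.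
rewrite big_map rmorph_sum; apply: eq_bigr => l _.
by rewrite rmorph_prod big_map; apply: eq_bigr => a _; apply: h.
Qed.

Section PsiCL.
Variables (K : fieldType) (charK : [pchar K] =i pred0).
Variables (I : choiceType) (isT : pred I) (w : I -> nat).
Hypothesis w0 : forall i, (0 < w i)%N.
Local Notation one_tree := (one_tree isT).
Local Notation CM := {malg K[{cmonom one_tree}]}.
Local Notation AM := {malg K[{cmonom I}]}.

Definition clump_ext : AM -> CM := linext (clump_basis K isT).
HB.instance Definition _ := GRing.Linear.copy clump_ext (linext (clump_basis K isT)).

Lemma Psi_clump_sum ks ts : Psi K isT ks ts =
  clump_sum clump_ext (map (fun v => << ucm v >>) ks) (map (fun v => << ucm v >>) ts).
Proof.
have e s : map (fun v => << ucm v >>) s = map (fun m : {cmonom I} => << m >> : AM) (map (@ucm I) s).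
  by rewrite -map_comp.
rewrite /clump_sum !e (clumps_map (op := mmul)) => [|a b]; last exact: esym (malgUM _ _ _).
rewrite big_map; apply: eq_bigr => l _; rewrite big_map; apply: eq_bigr => m _.
exact: esym (linextU _ _).
Qed.

(** The coefficients depend only on the product of the factors, hence so does [Psi]; the order of
    [factors] does not matter. *)
Lemma Psi_lcmon ks ts : all (predC isT) ks -> all isT ts ->
  Psi K isT ks ts = Psi K isT (Kof isT (lcmon (ks ++ ts))) (Tof isT (lcmon (ks ++ ts))).
Proof.
move=> hk ht; apply/malgP => c; have h := Psi_coef charK w0 c.
have e1 := h _ _ hk ht; apply: etrans e1 _; apply: esym; set b := lcmon _.
apply: etrans (h (Kof isT b) (Tof isT b) (filter_all _ _) (filter_all _ _)) _.
by rewrite (lcmon_KT isT b).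
Qed.

Definition star_b b : CM :=
  \sum_(c <- clumpings isT b | flat (fun y : one_tree => val y) c == b)
    ((sig w b)%:R / (sY (isT := isT) w c)%:R) *: << c >>.

Lemma prodU (s : seq I) : \prod_(v <- s) << ucm v >> = << lcmon s >> :> AM.
Proof.
elim: s => [|v s IH]; first by rewrite /lcmon !big_nil.
have e : lcmon (v :: s) = mmul (ucm v) (lcmon s) by rewrite /lcmon big_cons.
rewrite {}e; apply: etrans _ (malgUM _ _ _).
by apply: etrans (big_cons _ _ _ _ _ _) _; apply: (congr1 (fun z => << ucm v >> * z)).
Qed.

Lemma star_clump_sum ks ts : all (predC isT) ks -> all isT ts ->
  linext star_b (\prod_(v <- ks) << ucm v >> * \prod_(v <- ts) << ucm v >>) =
  clump_sum clump_ext (map (fun v => << ucm v >>) ks) (map (fun v => << ucm v >>) ts).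
Proof.
move=> hk ht; have e : \prod_(v <- ks) << ucm v >> * \prod_(v <- ts) << ucm v >> = << lcmon (ks ++ ts) >> :> AM.
  by rewrite -prodU big_cat.
apply: etrans (congr1 (linext star_b) e) _; apply: etrans (linextU _ _) _.
by rewrite -Psi_clump_sum Psi_lcmon //; apply: clumpings_sum.
Qed.
End PsiCL.

Section ThreeStars.
Variables (K : fieldType) (charK : [pchar K] =i pred0) (C : finType).

HB.instance Definition _ := GRing.LRMorphism.copy (@jcl K C)
  (algext (fun y : AM1b C => linext (@iotaF K C) (jaro << val y >>))).
HB.instance Definition _ := GRing.Linear.copy (@phistar K C) (linext (@phistar_b K C)).
HB.instance Definition _ := GRing.Linear.copy (@psistar K C) (linext (@psistar_b K C)).

Definition clump_extM : AM K C -> CM K C := @clump_ext K _ (@is_wm1 C).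
Definition clump_extF : AF K C -> CF K C := @clump_ext K _ (@isTree C).
HB.instance Definition _ := GRing.Linear.copy clump_extM (linext (clump_basis K (@is_wm1 C))).
HB.instance Definition _ := GRing.Linear.copy clump_extF (linext (clump_basis K (@isTree C))).

Lemma psistar_bE f : psistar_b K f = star_b K (@isTree C) (@sigmaC C) f.
Proof.
have e (c : CFb C) : sigmaCF c = sY (isT := @isTree C) (@sigmaC C) c.
  by apply: eq_bigr => p _; rewrite sigmaAF_sig.
rewrite /psistar_b sigmaAF_sig.
transitivity (\sum_(c <- clumpingsF f | psiF c == f)
  ((sig (@sigmaC C) f)%:R / (sY (isT := @isTree C) (@sigmaC C) c)%:R) *: << c >> : CF K C); last by [].
by apply: eq_bigr => c _; rewrite e.
Qed.

Lemma sum_coef_neq0 (B : choiceType) (J : eqType) (r : seq J) (P : pred J) (F : J -> {malg K[B]}) f :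
  (\sum_(j <- r | P j) F j)@_f != 0 -> exists j, [/\ j \in r, P j & (F j)@_f != 0].
Proof.
rewrite raddf_sum /= => h; have [j jr /andP[Pj hj]] : exists2 j, j \in r & P j && ((F j)@_f != 0).
  apply/hasP; apply: contraNT h => /hasPn h; rewrite big_seq_cond big1 // => j /andP[jr Pj].
  by have := h j jr; rewrite Pj => /negbNE /eqP.
by exists j.
Qed.

Lemma mulr_coef_neq0 (M : monomType) (x y : {malg K[M]}) f : (x * y)@_f != 0 ->
  exists a b, [/\ x@_a != 0, y@_b != 0 & f = mmul a b].
Proof.
rewrite malg_mulE => /sum_coef_neq0[a [ha _ /sum_coef_neq0[b [hb _ h2]]]].
exists a, b; split; rewrite ?mcoeff_neq0 //.
by move: h2; rewrite mcoeffZ mcoeffU1; case: (eqVneq (mmul a b) f) => // _; rewrite mulr0 eqxx.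
Qed.

(** Since j^aro preserves the number of tree factors and the number of all factors, a clump goes to
    clumps and a non-unit to non-units. The default cases of [iotaM] and [iotaF] therefore
    correspond. *)
Lemma jaro_graded m f : (@jaro K C << m >>)@_f != 0 ->
  ntr (@isTree C) f = ntr (@is_wm1 C) m /\ mdeg f = mdeg m.
Proof.
elim/cm_ind: m f => [|v m IH] f.
  have -> : jaro << mone >> = << mone >> :> AF K C by apply: rmorph1.
  by rewrite mcoeffU1; case: (eqVneq mone f) => [<-|_]; rewrite ?eqxx // ntr1 ntr1 !mdeg1.
have -> : jaro << mmul (ucm v) m >> = jaro << ucm v >> * jaro << m >> :> AF K C.
  by apply: etrans _ (rmorphM _ _ _); apply: congr1; apply: esym; apply: malgUM.
case/mulr_coef_neq0 => a [b [ha /IH[e1 e2] ->]]; rewrite !ntrM !mdegM e1 e2.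
suff [-> ->] : ntr (@isTree C) a = ntr (@is_wm1 C) (ucm v) /\ mdeg a = mdeg (ucm v) by [].
move: ha; rewrite jaroU => /sum_coef_neq0[x [_ /eqP hx]].
rewrite mcoeffZ mcoeffU1; case: (eqVneq (ucm x) a) => [<- _|_]; last by rewrite mulr0 eqxx.
rewrite !ntrU !mdegU; split=> //.
by have := PhiC_isTree hx; case: (is_wm1 v) => [->|/negbTE ->].
Qed.

Lemma eq_linext_supp (B : choiceType) (V : lmodType K) (f g : B -> V) (x : {malg K[B]}) :
  (forall b, x@_b != 0 -> f b = g b) -> linext f x = linext g x.
Proof.
by move=> h; apply: eq_big_seq => b; rewrite -mcoeff_neq0 => /h ->.
Qed.

Lemma linext_supp_comp (B : choiceType) (V V' : lmodType K) (L : {linear V -> V'})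
    (G : {linear {malg K[B]} -> V'}) (f : B -> V) (x : {malg K[B]}) :
  (forall b, x@_b != 0 -> L (f b) = G << b >>) -> L (linext f x) = G x.
Proof.
move=> h; rewrite {2}[x]malg_basis /linext !linear_sum; apply: eq_big_seq => b.
by rewrite -mcoeff_neq0 => /h e; rewrite !linearZ /= e.
Qed.

Lemma jclU (y : AM1b C) : jcl << ucm y >> = linext (@iotaF K C) (jaro << val y >>).
Proof. exact: algextU. Qed.

Lemma iotaF_clump (f : AFb C) : f != mone -> iotaF K f = clump_basis K (@isTree C) f.
Proof. by move=> h; rewrite /iotaF (negbTE h). Qed.

Lemma ntr1_neq1 (I : choiceType) (isT : pred I) (f : {cmonom I}) : ntr isT f == 1%N -> f != mone.
Proof. by apply: contraTneq => ->; rewrite ntr1. Qed.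

Lemma jaro_ntr1 (b : AMb C) f : ntr (@is_wm1 C) b == 1%N -> (@jaro K C << b >>)@_f != 0 ->
  ntr (@isTree C) f == 1%N.
Proof. by move=> h /jaro_graded[-> _]. Qed.

Lemma jcl_clump_ext (x : AM K C) : jcl (clump_extM x) = clump_extF (jaro x).
Proof.
pose f : {linear AM K C -> CF K C} := @jcl K C \o clump_extM.
pose g : {linear AM K C -> CF K C} := clump_extF \o @jaro K C.
apply: (eq_linear_malg (f := f) (g := g)) => b; rewrite /f /g /=.
have -> : clump_extM << b >> = clump_basis K (@is_wm1 C) b by apply: linextU.
rewrite /clump_basis; case: insubP => [y hy <-|nb]; last first.
  rewrite linear0; apply: esym.
  transitivity (linext (fun _ : AFb C => 0 : CF K C) (jaro << b >>)); last first.
    by rewrite /linext big1 // => h _; rewrite scaler0.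
  apply: eq_linext_supp => h /jaro_graded[e _]; rewrite /clump_basis insubF //.
  by rewrite e; apply: negbTE.
apply: etrans (jclU _) _; apply: eq_linext_supp => h /(jaro_ntr1 (valP y)) h1.
by apply: iotaF_clump; apply: ntr1_neq1 h1.
Qed.

(** [iotaF] and [clump_extF] differ only at the unit, and so do their counterparts on monomials; the
    grading keeps the unit out of the image of any other monomial. *)
Lemma jcl_iota (b : AMb C) : linext (@iotaF K C) (jaro << b >>) = jcl (iotaM K b).
Proof.
rewrite /iotaM; case: eqP => [->|/eqP b1].
  have -> : jaro << onecm _ >> = << onecm _ >> :> AF K C by apply: rmorph1.
  by apply: etrans (linextU _ _) _; rewrite /iotaF eqxx rmorph1.
have e : clump_extM << b >> = clump_basis K (@is_wm1 C) b by apply: linextU.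
rewrite -[X in jcl X]/(clump_basis K (@is_wm1 C) b) -e jcl_clump_ext.
apply: eq_linext_supp => f /jaro_graded[_ ef]; apply: iotaF_clump.
by rewrite -mdeg_eq0 ef mdeg_eq0.
Qed.

Lemma jaro_star (x : AM K C) : psistar (jaro x) = jcl (phistar x).
Proof.
pose f : {linear AM K C -> CF K C} := @psistar K C \o @jaro K C.
pose g : {linear AM K C -> CF K C} := @jcl K C \o @phistar K C.
apply: (eq_linear_malg (f := f) (g := g)) => b; rewrite /f /g /=.
have hT := filter_all (@is_wm1 C) (factors b).
have hK : all (predC (@is_wm1 C)) (Kof (@is_wm1 C) b) by apply: filter_all.
have wM0 (v : MonG C) : (0 < mfact (val v))%N by apply: mfact_gt0.
have wF0 (z : ConnCls C) : (0 < sigmaC z)%N by apply: naut_gt0.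
pose U (v : MonG C) : AM K C := << ucm v >>.
pose U' (z : ConnCls C) : AF K C := << ucm z >>.
set ks := Kof _ b in hK; set ts := Tof (@is_wm1 C) b.
have eb : << b >> = \prod_(v <- ks) U v * \prod_(v <- ts) U v.
  rewrite -big_cat; apply: etrans _ (esym (prodU K (ks ++ ts))).
  exact: (congr1 (fun z => << z >>) (esym (lcmon_KT (@is_wm1 C) b))).
have e1 : phistar << b >> = clump_sum (E := CM K C) clump_extM (map U ks) (map U ts).
  by rewrite eb; apply: (star_clump_sum charK wM0 hK hT).
rewrite e1; have e2 := clump_sum_morph (A := AM K C) (A' := AF K C) (E := CM K C) (E' := CF K C)
  (j := @jaro K C) (jc := @jcl K C) jcl_clump_ext (map U ks) (map U ts).
apply: etrans _ (esym e2).
have e3 : jaro << b >> = \prod_(v <- ks) jaro (U v) * \prod_(v <- ts) jaro (U v).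
  by rewrite eb rmorphM !rmorph_prod.
rewrite e3 -!map_comp.
have psU k t : all (predC (@isTree C)) k -> all (@isTree C) t ->
  psistar (\prod_(x <- k) U' x * \prod_(x <- t) U' x) = clump_sum (E := CF K C) clump_extF (map U' k) (map U' t).
  move=> hk ht; rewrite -(star_clump_sum charK wF0 hk ht).
  exact: (eq_linext psistar_bE).
(* Each j^aro(v) is a combination of graphs that are trees exactly when v has weight -1, as [expand]
   requires. *)
apply: (expand (psi := @psistar K C) (theta := clump_extF) psU (F := @jaro K C \o U)
  (r := fun v => classes C (mdeg (val v))) (Q := fun v x => PhiC x == val v)
  (c := fun v x => (mfact (val v))%:R / (sigmaC x)%:R) (T := @is_wm1 C) _ _ hK hT) => [v|v z /eqP h].
  exact: jaroU.
by have := PhiC_isTree h; case: (is_wm1 v) => [->//|/negbTE].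
Qed.

Lemma jcl2_mult : monoid_morphism (@jcl2 K C).
Proof.
split; first by apply: etrans (tmapU _ _ _ _) _; rewrite !rmorph1 tens11.
by apply: tmap_mul => a b; rewrite -malgUM rmorphM.
Qed.

HB.instance Definition _ := GRing.Linear.copy (@jcl2 K C)
  (tmap (fun a : CMb C => @jcl K C << a >>) (fun a : CMb C => @jcl K C << a >>)).
HB.instance Definition _ := GRing.LRMorphism.copy (@DeltaBCKcl K C)
  (algext (fun p : ATb C =>
     tmap (fun a : AFb C => psistar << a >>) (@iotaF K C) (DeltaBCKaro << val p >>))).
HB.instance Definition _ := GRing.LRMorphism.copy (@DeltaLOTcl K C)
  (algext (fun y : AM1b C =>
            tmap (fun a : AMb C => phistar << a >>) (@iotaM K C) (DeltaLOTaro << val y >>))).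

Lemma linext_jcl (x : CM K C) : linext (fun a : CMb C => @jcl K C << a >>) x = jcl x.
Proof. by apply/esym/eq_linear_malg => b; rewrite /= linextU. Qed.
Lemma linext_psistar (x : AF K C) : linext (fun a : AFb C => psistar << a >>) x = psistar x.
Proof. by apply/esym/eq_linear_malg => b; rewrite /= linextU. Qed.

Local Notation tF := (tmap (fun a : AFb C => psistar << a >>) (@iotaF K C)).
Local Notation tM := (tmap (fun a : AMb C => phistar << a >>) (@iotaM K C)).

(** The left factors agree by compatibility with the adjoints, the right ones by [jcl_iota]. *)
Lemma jcl2_tM x : jcl2 (tM x) = tF (jaro2 x).
Proof.
pose f : {linear {malg K[mprod (AMb C) (AMb C)]} -> {malg K[mprod (CFb C) (CFb C)]}} := @jcl2 K C \o tM.
pose g : {linear {malg K[mprod (AMb C) (AMb C)]} -> {malg K[mprod (CFb C) (CFb C)]}} := tF \o @jaro2 K C.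
apply: (eq_linear_malg (f := f) (g := g)) => -[a b]; rewrite /f /g /= tmapU.
apply: etrans (tmap_tens _ _ _ _) _; rewrite !linext_jcl.
have e := tmapU (fun a : AMb C => @jaro K C << a >>) (fun a : AMb C => @jaro K C << a >>) a b.
apply: etrans _ (congr1 tF (esym e)).
by rewrite tmap_tens linext_psistar jaro_star jcl_iota.
Qed.

Lemma DeltaBCKcl_jcl (y : AM1b C) :
  DeltaBCKcl (jcl << ucm y >>) = tF (DeltaBCKaro (jaro << val y >>)).
Proof.
rewrite jclU.
pose G : {linear AF K C -> {malg K[mprod (CFb C) (CFb C)]}} := tF \o @DeltaBCKaro K C.
apply: (linext_supp_comp (G := G) (L := @DeltaBCKcl K C)) => f /(jaro_ntr1 (valP y)) hf.
have -> : iotaF K f = << ucm (Sub f hf : ATb C) >>.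
  by rewrite /iotaF (negbTE (ntr1_neq1 hf)) insubT.
exact: algextU.
Qed.

Lemma jcl_Delta (x : CM K C) : jcl2 (DeltaLOTcl x) = DeltaBCKcl (jcl x).
Proof.
pose f : {linear CM K C -> {malg K[mprod (CFb C) (CFb C)]}} := @jcl2 K C \o @DeltaLOTcl K C.
pose g : {linear CM K C -> {malg K[mprod (CFb C) (CFb C)]}} := @DeltaBCKcl K C \o @jcl K C.
apply: (eq_lrmorphism_malg (f := f) (g := g)).
- have [j1 jM] := jcl2_mult; split; first by rewrite /f /= rmorph1.
  by move=> a b; rewrite /f /= rmorphM jM.
- by split; [rewrite /g /= !rmorph1 | move=> a b; rewrite /g /= !rmorphM].
move=> y; rewrite /f /g /= DeltaBCKcl_jcl -jaro_Delta // -jcl2_tM; congr jcl2.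
exact: algextU.
Qed.

End ThreeStars.

(** * Injectivity *)

Section Realize.
Variable C : finType.
Implicit Types (m r : Mon C).

Lemma fertE n (d : gdata C n) v : fert d v = (\sum_u (gout d u == Some v))%N.
Proof. by rewrite /fert -sum1dep_card big_mkcond. Qed.

Lemma Phig_typ n (d : gdata C n) v :
  Phig d = mmul (ucm (typ d v)) (\big[mmul/mone]_(u | u != v) ucm (typ d u)).
Proof. by rewrite /Phig (bigD1 v). Qed.

Lemma mem_Phig n (d : gdata C n) i r : Phig d = mmul (ucm i) r ->
  exists2 v, typ d v = i & r = \big[mmul/mone]_(u | u != v) ucm (typ d u).
Proof.
move=> e; have [v hv] : exists v, typ d v = i.
  have : (0 < Phig d i)%N by rewrite e cmM cmUU.
  by rewrite Phig_monS monSE => /card_gt0P[v]; rewrite inE => /andP[_ /eqP]; exists v.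
by exists v => //; apply: (@mulIcm _ (ucm i)); rewrite -e -{1}hv -Phig_typ.
Qed.

(** The total of the prescribed fertilities: the encoded indices are shifted by one, so the weight
    is this number minus the degree. *)
Definition fsum m : nat := (\sum_(i <- finsupp m) i.2 * m i)%N.

Lemma wt_fsum m : wt m = (fsum m)%:Z - (mdeg m)%:Z.
Proof.
rewrite /wt /fsum mdegE -!natz !natr_sum -sumrB; apply: eq_bigr => i _.
by rewrite mulrBl mul1r natrM !natz.
Qed.

Lemma fsum_pos m : (0 < fsum m)%N -> exists a f r, m = mmul (ucm (a, f.+1)) r.
Proof.
move=> h; have [i hi pi] : exists2 i, i \in enum_fset (finsupp m) & (0 < i.2)%N.
  apply/hasP; apply: contraLR h => /hasPn h; rewrite -eqn0Ngt /fsum big_seq big1 // => i /h.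
  by rewrite -eqn0Ngt => /eqP ->.
case: i hi pi => a [|f] //= hi _; exists a, f, (divcm m (ucm (a, f.+1))).
by rewrite ucm_div.
Qed.

Lemma fsum_leaf m : (fsum m < mdeg m)%N -> exists a r, m = mmul (ucm (a, 0%N)) r.
Proof.
move=> h; have [i hi pi] : exists2 i, i \in enum_fset (finsupp m) & i.2 == 0%N.
  apply/hasP; apply: contraLR h => /hasPn h; rewrite -leqNgt /fsum mdegE big_seq [in leqRHS]big_seq.
  by apply: leq_sum => i /h hi; rewrite leq_pmull // lt0n.
case: i hi pi => a [|f] //= hi _; exists a, (divcm m (ucm (a, 0%N))).
by rewrite ucm_div.
Qed.

Definition addleaf n (d : gdata C n) (v : 'I_n) (a : C) : gdata C n.+1 :=
  ([ffun w => if unlift ord_max w is Some u then omap (lift ord_max) (gout d u)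
              else Some (lift ord_max v)],
   [ffun w => if unlift ord_max w is Some u then gdec d u else a]).

Section AddLeaf.
Variables (n : nat) (d : gdata C n) (v : 'I_n) (a : C).
Local Notation d' := (addleaf d v a).
Local Notation L := (lift (@ord_max n)).

Lemma addleaf_outL u : gout d' (L u) = omap L (gout d u).
Proof. by rewrite /gout ffunE liftK. Qed.
Lemma addleaf_outM : gout d' ord_max = Some (L v).
Proof. by rewrite /gout ffunE unlift_none. Qed.
Lemma addleaf_decL u : gdec d' (L u) = gdec d u.
Proof. by rewrite /gdec ffunE liftK. Qed.
Lemma addleaf_decM : gdec d' ord_max = a.
Proof. by rewrite /gdec ffunE unlift_none. Qed.

Lemma omap_eqS (o : option 'I_n) u : (omap L o == Some (L u)) = (o == Some u).
Proof. by case: o => //= w; apply/eqP/eqP => [/Some_inj/lift_inj ->|[->]]. Qed.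
Lemma L_eq u w : (Some (L u) == Some (L w)) = (u == w).
Proof. by apply/eqP/eqP => [/Some_inj/lift_inj|->]. Qed.
Lemma L_ne u : (L u == ord_max) = false.
Proof. by apply/negbTE; rewrite eq_sym neq_lift. Qed.

Lemma addleaf_fertL u : fert d' (L u) = (fert d u + (v == u))%N.
Proof.
rewrite !fertE (bigD1_ord ord_max) //= addleaf_outM L_eq addnC; congr (_ + _)%N.
by apply: eq_bigr => w _; rewrite addleaf_outL omap_eqS.
Qed.
Lemma addleaf_fertM : fert d' ord_max = 0%N.
Proof.
rewrite fertE (bigD1_ord ord_max) //= addleaf_outM big1 => [|w _].
  by rewrite addn0; apply/eqP; rewrite eqb0; apply/eqP => /Some_inj/eqP; rewrite L_ne.
rewrite addleaf_outL; apply/eqP; rewrite eqb0; case: (gout d w) => //= w'.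
by apply/eqP => /Some_inj/eqP; rewrite L_ne.
Qed.

Lemma addleaf_Phig : Phig d' = mmul (ucm (a, 0%N))
  (mmul (ucm (gdec d v, (fert d v).+1)) (\big[mmul/mone]_(u | u != v) ucm (typ d u))).
Proof.
rewrite /Phig (bigD1_ord ord_max) //= addleaf_decM addleaf_fertM; congr mmul.
rewrite (bigD1 v) //= addleaf_decL addleaf_fertL eqxx addn1; congr mmul.
by apply: eq_bigr => u ne; rewrite addleaf_decL addleaf_fertL eq_sym (negbTE ne) addn0.
Qed.

Lemma addleaf_conn : gconnected d -> gconnected d'.
Proof.
move=> /andP[_ /forallP c]; rewrite /gconnected /=.
have cL u w : connect (adj d') (L u) (L w).
  have /forallP/(_ w) := c u; apply: connect_img => x y h; apply: connect1.
  by rewrite /adj !addleaf_outL !omap_eqS.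
have cM : connect (adj d') ord_max (L v).
  by apply: connect1; rewrite /adj addleaf_outM eqxx.
have cA w : connect (adj d') w (L v).
  by case: (unliftP ord_max w) => [u|] ->.
apply/forallP => u; apply/forallP => w; apply: connect_trans (cA u) _.
by rewrite conn_sym cA.
Qed.
End AddLeaf.

Definition addedge n (d : gdata C n) (s v : 'I_n) : gdata C n :=
  ([ffun w => if w == s then Some v else gout d w], gdec d).

Section AddEdge.
Variables (n : nat) (d : gdata C n) (s v : 'I_n).
Hypothesis s0 : gout d s = None.
Local Notation d' := (addedge d s v).

Lemma addedge_out u : gout d' u = if u == s then Some v else gout d u.
Proof. by rewrite /gout ffunE. Qed.

Lemma addedge_fert u : fert d' u = (fert d u + (v == u))%N.
Proof.
rewrite !fertE (bigD1 s) //= [in RHS](bigD1 s) //= s0 add0n addedge_out eqxx addnC.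
by congr (_ + _)%N; apply: eq_bigr => w ne; rewrite addedge_out (negbTE ne).
Qed.

Lemma addedge_Phig : Phig d' =
  mmul (ucm (gdec d v, (fert d v).+1)) (\big[mmul/mone]_(u | u != v) ucm (typ d u)).
Proof.
rewrite /Phig (bigD1 v) //= addedge_fert eqxx addn1; congr mmul.
by apply: eq_bigr => u ne; rewrite addedge_fert eq_sym (negbTE ne) addn0.
Qed.

Lemma addedge_conn : gconnected d -> gconnected d'.
Proof.
rewrite /gconnected => /andP[-> /forallP c]; apply/forallP => u; apply/forallP => w.
have /forallP/(_ w) := c u; apply: (connect_img (f := id)) => x y h; apply: connect1.
move: h; rewrite /adj !addedge_out.
have ns (o : option 'I_n) z : o == Some z -> o <> None by move/eqP ->.
case: (eqVneq x s) => [->|_]; case: (eqVneq y s) => [->|_]; rewrite ?s0 //=.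
  by move=> ->; rewrite orbT.
by rewrite orbF => ->.
Qed.
End AddEdge.

(** Induction on the degree: remove a variable of fertility 0, lower a positive fertility by one,
    realise the result by a tree and put the leaf back at the lowered vertex. *)
Lemma tree_exists n m : mdeg m = n.+1 -> wt m = -1 -> exists2 d : gdata C n.+1, gconnected d & Phig d = m.
Proof.
elim: n m => [|n IH] m dm wm.
  have [[a j] em] : exists i, m = ucm i.
    move: dm; elim/cm_ind: m {wm} => [|i m _]; first by rewrite mdeg1.
    by rewrite mdegM mdegU add1n => -[/mdeg_eq0I ->]; exists i; rewrite mulm1.
  have j0 : j = 0%N.
    move: wm; rewrite em wtU /= => /eqP; rewrite subr_eq addNr => /eqP [] //.
  pose d : gdata C 1 := ([ffun=> None], [ffun=> a]); exists d.
    apply/andP; split=> //; apply/forallP => u; apply/forallP => w.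
    by rewrite (ord1 u) (ord1 w) connect0.
  rewrite /Phig big_ord1 em j0 /gdec ffunE; congr (ucm (_, _)).
  by rewrite fertE big_ord1 /gout ffunE.
have fm : fsum m = n.+1.
  move: wm; rewrite wt_fsum dm => /eqP; rewrite subr_eq addrC => /eqP e.
  by apply/eqP; rewrite -eqz_nat e -[n.+2]addn1 PoszD addrK.
(* The fertilities add up to one less than the degree, so one of them is 0. *)
have [a [r er]] : exists a r, m = mmul (ucm (a, 0%N)) r by apply: fsum_leaf; rewrite fm dm.
have dr : mdeg r = n.+1 by move: dm; rewrite er mdegM mdegU add1n => -[].
have wr : wt r = 0 by move: wm; rewrite er wtM wtU /= sub0r => /eqP; rewrite -subr_eq0 addrAC addNr add0r => /eqP.
(* The remaining monomial has weight 0 and positive degree, so not all its fertilities vanish. *)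
have [b [f [q eq]]] : exists b f q, r = mmul (ucm (b, f.+1)) q.
  apply: fsum_pos; move: wr; rewrite wt_fsum dr => /eqP; rewrite subr_eq0 => /eqP[->] //.
have wS : wt (ucm (b, f.+1)) = wt (ucm (b, f)) + 1.
  by rewrite !wtU /= -addn1 PoszD addrAC.
have dq : mdeg (mmul (ucm (b, f)) q) = n.+1 by move: dr; rewrite eq !mdegM !mdegU.
have wq : wt (mmul (ucm (b, f)) q) = -1.
  by move: wr; rewrite eq !wtM wS => /eqP; rewrite addrAC addr_eq0 => /eqP.
have [d cd ed] := IH _ dq wq.
have [v tv ev] := mem_Phig ed; exists (addleaf d v a); first exact: addleaf_conn.
by rewrite addleaf_Phig er eq -ev; case: tv => -> ->.
Qed.

(** In weight 0 a positive fertility is lowered to reach weight -1; the new edge from the root of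
    the resulting tree to that vertex restores the fertility and closes the cycle. *)
Lemma PhiC_surj (v : MonG C) : exists x, PhiC x = val v.
Proof.
have real n (d : gdata C n) : gconnected d -> Phig d = val v -> exists x, PhiC x = val v.
  move=> cd ed; have [x hx] := clsOfP cd; exists x.
  rewrite -ed /PhiC; have [p hp] := canonE d; move: hx; rewrite /clsOf; case: insubP => // y _ ey [<-].
  rewrite ey /= hp Phig_monS Phig_monS /monS (reindex_inj (@perm_inj _ p)) /=.
  by apply: eq_big => [u|u _]; rewrite ?inE // typ_relabel.
case/orP: (valP v) => [/eqP w|/andP[/eqP w v1]].
  case e: (mdeg (val v)) => [|n]; first by move: w; rewrite (mdeg_eq0I e) wt1.
  by have [d cd ed] := tree_exists e w; apply: real cd ed.
have d0 : (0 < mdeg (val v))%N by rewrite lt0n mdeg_eq0.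
have [b [f [q eq]]] : exists b f q, val v = mmul (ucm (b, f.+1)) q.
  apply: fsum_pos; move: w; rewrite wt_fsum => /eqP; rewrite subr_eq0 => /eqP[->] //.
have wS : wt (ucm (b, f.+1)) = wt (ucm (b, f)) + 1.
  by rewrite !wtU /= -addn1 PoszD addrAC.
have dq : mdeg (mmul (ucm (b, f)) q) = (mdeg q).+1 by rewrite mdegM mdegU.
have wq : wt (mmul (ucm (b, f)) q) = -1.
  by move: w; rewrite eq !wtM wS => /eqP; rewrite addrAC addr_eq0 => /eqP.
have [d cd ed] := tree_exists dq wq.
have [s hs] : exists s, gout d s = None.
  have [x hx] := clsOfP cd; have sd : supp_on d setT by apply: supp_onP => a a'; rewrite !inE.
  have ws : wt (Phig d) = -1 by rewrite ed.
  move: ws; rewrite Phig_monS (wt_roots sd) // => /oppr_inj [] /eqP/cards1P[s /setP/(_ s)].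
  by rewrite !inE eqxx => /eqP; exists s.
have [u tu eu] := mem_Phig ed; apply: (real _ (addedge d s u)); first exact: addedge_conn.
by rewrite addedge_Phig // eq -eu; case: tu => -> ->.
Qed.
End Realize.

Section Injective.
Variables (K : fieldType) (charK : [pchar K] =i pred0) (C : finType).

Definition repr_class (v : MonG C) : ConnCls C :=
  xchoose (let: ex_intro x e := PhiC_surj v in
           ex_intro (fun x => PhiC x == val v) x (introT eqP e)).

Lemma PhiC_repr v : PhiC (repr_class v) = val v.
Proof. exact/eqP/(xchooseP (P := fun x => PhiC x == val v)). Qed.

(** The factor is the inverse of the coefficient of [repr_class v] in j^aro(v). The outer default is
    never reached, by [PhiC_isMgen]. *)
Definition retr_gen (x : ConnCls C) : AM K C :=
  if insub (PhiC x) is Some v then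
    if x == repr_class v then ((mfact (val v))%:R / (sigmaC x)%:R)^-1 *: << ucm v >> else 0
  else 0.
Definition retr : AF K C -> AM K C := algext retr_gen.
HB.instance Definition _ := GRing.LRMorphism.copy retr (algext retr_gen).

Lemma retr_jaro_gen v : retr (jaro << ucm v >>) = << ucm v >>.
Proof.
rewrite jaroU /class_sum linear_sum.
have mem : repr_class v \in classes C (mdeg (val v)).
  have := mem_classes_val (repr_class v); congr (_ \in classes C _).
  by rewrite -(PhiC_repr v) /PhiC Phig_monS mdeg_monS cardsT card_ord.
have retrU x : retr (AFgen K x) = retr_gen x by apply: algextU.
rewrite big_mkcond (bigD1_seq (repr_class v)) ?undup_uniq //= PhiC_repr eqxx.
rewrite big1 => [|x ne]; last first.
  case: eqP => // ex; rewrite linearZ /= retrU /retr_gen ex valK (negbTE ne).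
  exact: scaler0.
rewrite addr0 linearZ /= retrU /retr_gen PhiC_repr valK eqxx scalerA mulfV ?scale1r //.
by rewrite mulf_neq0 ?invr_neq0 // natK_neq0 ?mfact_gt0 ?naut_gt0.
Qed.

Lemma jaroK : cancel (@jaro K C) retr.
Proof.
pose f : {linear AM K C -> AM K C} := retr \o @jaro K C.
pose g : {linear AM K C -> AM K C} := idfun.
apply: (eq_lrmorphism_malg (f := f) (g := g)) => [||v]; last exact: retr_jaro_gen.
  by split; [rewrite /f /= !rmorph1 | move=> a b; rewrite /f /= !rmorphM].
by split.
Qed.

Definition retr_cl : CF K C -> CM K C := algext (fun p : ATb C => clump_extM (retr << val p >>)).
HB.instance Definition _ := GRing.LRMorphism.copy retr_cl
  (algext (fun p : ATb C => clump_extM (retr << val p >>))).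

(** [retr_cl] is defined clump by clump, but on the clumps occurring in j^cl(y) it is the linear map
    [clump_extM \o retr], so it can be applied to j^aro(y) as a whole. *)
Lemma retr_cl_gen y : retr_cl (jcl << ucm y >>) = << ucm y >>.
Proof.
rewrite jclU; pose G : {linear AF K C -> CM K C} := @clump_extM K C \o retr.
apply: etrans (_ : G (jaro << val y >>) = _); last first.
  rewrite /G /= jaroK; apply: etrans (linextU _ _) _; exact: clump_basis_val.
apply: (linext_supp_comp (G := G) (L := retr_cl)) => f /(jaro_ntr1 (valP y)) hf.
have -> : iotaF K f = << ucm (Sub f hf : ATb C) >>.
  by rewrite /iotaF (negbTE (ntr1_neq1 hf)) insubT.
exact: algextU.
Qed.

Lemma jclK : cancel (@jcl K C) retr_cl.
Proof.
pose f : {linear CM K C -> CM K C} := retr_cl \o @jcl K C.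
pose g : {linear CM K C -> CM K C} := idfun.
apply: (eq_lrmorphism_malg (f := f) (g := g)) => [||v]; last exact: retr_cl_gen.
  by split; [rewrite /f /= !rmorph1 | move=> a b; rewrite /f /= !rmorphM].
by split.
Qed.
End Injective.

Theorem theorem3p10 (K : fieldType) (C : finType) (charK : [pchar K] =i pred0) :
  (* (i) j^aro : (AM, odot, Delta^aro_LOT) -> (AF, ., Delta^aro_BCK) *)
  [/\ injective (@jaro K C),
      @jaro K C 1 = 1,
      (forall x y : AM K C, @jaro K C (x * y) = @jaro K C x * @jaro K C y),
      (forall (a : K) (x y : AM K C),
          @jaro K C (a *: x + y) = a *: @jaro K C x + @jaro K C y) &
      (forall x : AM K C,
          @jaro2 K C (@DeltaLOTaro K C x) = @DeltaBCKaro K C (@jaro K C x))]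
  /\
  (* (ii) j^cl : (CM, diamond, Delta^cl_LOT) -> (CF, ., Delta^cl_BCK) *)
  [/\ injective (@jcl K C),
      @jcl K C 1 = 1,
      (forall x y : CM K C, @jcl K C (x * y) = @jcl K C x * @jcl K C y),
      (forall (a : K) (x y : CM K C),
          @jcl K C (a *: x + y) = a *: @jcl K C x + @jcl K C y) &
      (forall x : CM K C,
          @jcl2 K C (@DeltaLOTcl K C x) = @DeltaBCKcl K C (@jcl K C x))]
  /\
  (* (iii) psi^* o j^aro = j^cl o phi^* as maps AM -> CF *)
  (forall x : AM K C, @psistar K C (@jaro K C x) = @jcl K C (@phistar K C x)).
Proof.
split; [|split; last exact: jaro_star].
  split.
  - by apply: can_inj; apply: jaroK.
  - exact: rmorph1.
  - exact: rmorphM.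
  - exact: linearP.
  - exact: jaro_Delta.
split.
- by apply: can_inj; apply: jclK.
- exact: rmorph1.
- exact: rmorphM.
- exact: linearP.
- exact: jcl_Delta.
Qed.
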